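(* (Taylor's Theorem.) Let $f:T\to T'$ and $t,t_0:T$ be terms of the calculus. If both $f~t$ and $\sum_{k=0}^{\infty}\frac{1}{k!}(f^{(k)}~t_0)*(t\ominus t_0)^k$ are (well-typed and) weak-normalizable, then, in the sense of term equality, $$f~t=\sum_{k=0}^{\infty}\frac{1}{k!}(f^{(k)}~t_0)*(t\ominus t_0)^k.$$
   Context: Types. $\mathsf B$ denotes base types (such as $\mathbb R,\mathbb C$). Types: $T::=\mathsf B\mid (T_1,\dots,T_n)\mid T\to T\mid T+T$. Interpretable types: $iB::=\mathsf B\mid iB\to iB$. Addable types: $T^*::=\mathsf B\mid (T^*,\dots,T^* )\mid T\to T^*$. Notation: $\frac{\partial T}{\partial \mathsf B}=T$, $\frac{\partial T}{\partial (T_1,\dots,T_n)}=(\frac{\partial T}{\partial T_1},\dots,\frac{\partial T}{\partial T_n})$; $\frac{\partial T}{\partial S}$ is undefined if $S$ is a function or sum type. Terms. $t::=c\mid x\mid \lambda x{:}T.t\mid t\,t\mid (t_1,\dots,t_n)\mid \pi_j t\mid t\oplus t\mid t\ominus t\mid t*t\mid \frac{\partial t}{\partial x}|_{t}\mid \int_{t}^{t}t\,dx\mid inl~t\mid inr~t\mid case~t~of~inl~x_1\Rightarrow t\mid inr~x_2\Rightarrow t\mid \mathit{fix}~t$, where constants $c$ have interpretable types; $x$ is bound in $t_1$ in $\frac{\partial t_1}{\partial x}|_{t_2}$ and in $t$ in $\int_{t_1}^{t_2}t\,dx$. Terms are taken up to $\alpha$-equivalence. Typing. The usual rules for constants, variables,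 abstraction, application, tuples, projections, injections, case; $\mathit{fix}~t:T$ if $t:T\to T$; $t_1\oplus t_2,\ t_1\ominus t_2:T^*$ if $t_1,t_2:T^*$; $\Gamma\vdash \frac{\partial t_2}{\partial x}|_{t_1}:\frac{\partial T_2}{\partial T_1}$ if $\Gamma\vdash t_1:T_1$ and $\Gamma,x{:}T_1\vdash t_2:T_2$; $t_1*t_2:T^*$ if $t_1:\frac{\partial T^*}{\partial T}$ and $t_2:T$; $\Gamma\vdash\int_{t_1}^{t_2}t\,dx:T^*$ if $\Gamma\vdash t_1,t_2:T$ and $\Gamma,x{:}T\vdash t:\frac{\partial T^*}{\partial T}$. Reduction $\rightarrow$ is full reduction: any of the following rules may be applied to any subterm (also under binders). $(\lambda x{:}T.t)t_1\rightarrow t[t_1/x]$; $\pi_j(t_1,\dots,t_n)\rightarrow t_j$; $case~(inl~t)~of~inl~x_1\Rightarrow t_1\mid inr~x_2\Rightarrow t_2\rightarrow t_1[t/x_1]$; $case~(inr~t)~of~inl~x_1\Rightarrow t_1\mid inr~x_2\Rightarrow t_2\rightarrow t_2[t/x_2]$; $\mathit{fix}~f\rightarrow f(\mathit{fix}~f)$. Derivative, if $t_0:\mathsf B$: $\frac{\partial(t_1,\dots,t_n)}{\partial x}|_{t_0}\rightarrow(\frac{\partial t_1}{\partial x}|_{t_0},\dots,\frac{\partial t_n}{\partial x}|_{t_0})$; $\frac{\partial\, inl/inr~t}{\partial x}|_{t_0}\rightarrow inl/inr~\frac{\partial t}{\partial x}|_{t_0}$; $\frac{\partial(\lambda y:T.t)}{\partial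 x}|_{t_0}\rightarrow\lambda y{:}T.\frac{\partial t}{\partial x}|_{t_0}$. At a tuple: $\frac{\partial t}{\partial x}|_{(t_1,\dots,t_n)}\rightarrow(\frac{\partial t[t_{1*}/x]}{\partial x_1}|_{t_1},\dots,\frac{\partial t[t_{n*}/x]}{\partial x_n}|_{t_n})$ with $t_{i*}=(t_1,\dots,t_{i-1},x_i,t_{i+1},\dots,t_n)$, $x_i$ fresh. Integral, if $t_1,t_2:\mathsf B$: $\int_{t_1}^{t_2}(s_1,\dots,s_n)dx\rightarrow(\int_{t_1}^{t_2}s_1dx,\dots,\int_{t_1}^{t_2}s_ndx)$; $\int_{t_1}^{t_2}inl/inr~t\,dx\rightarrow inl/inr\int_{t_1}^{t_2}t\,dx$; $\int_{t_1}^{t_2}\lambda y{:}T.t\,dx\rightarrow\lambda y{:}T.\int_{t_1}^{t_2}t\,dx$. Between tuples: $\int_{(t_{11},\dots,t_{1n})}^{(t_{21},\dots,t_{2n})}t\,dx\rightarrow\int_{t_{11}}^{t_{21}}\pi_1(t[t_{1*}/x])dx_1\oplus\cdots\oplus\int_{t_{1n}}^{t_{2n}}\pi_n(t[t_{n*}/x])dx_n$ with $t_{i*}=(t_{21},\dots,t_{2(i-1)},x_i,t_{1(i+1)},\dots,t_{1n})$. For $\odot\in\{\oplus,\ominus\}$: $(t_{11},\dots,t_{1n})\odot(t_{21},\dots,t_{2n})\rightarrow(t_{11}\odot t_{21},\dots,t_{1n}\odot t_{2n})$; $(\lambda x{:}T.t_1)\odot(\lambda y{:}T.t_2)\rightarrow\lambda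 x{:}T.(t_1\odot t_2[x/y])$. Multiplication, if $t_0:\mathsf B$: $(t_1,\dots,t_n)*t_0\rightarrow(t_1*t_0,\dots,t_n*t_0)$; $(\lambda x{:}T.t)*t_0\rightarrow\lambda x{:}T.(t*t_0)$; $(inl/inr~t)*t_0\rightarrow inl/inr~(t*t_0)$. Between tuples: $(t_{11},\dots,t_{1n})*(t_{21},\dots,t_{2n})\rightarrow(t_{11}*t_{21})\oplus\cdots\oplus(t_{1n}*t_{2n})$. Normal forms. $\mathit{nf}::=\mathit{nb}\mid(\mathit{nf},\dots,\mathit{nf})\mid\lambda x{:}T.t$ (with $t$ not further reducible) $\mid inl/inr~\mathit{nf}$, where $\mathit{nb}::=c\mid x$ (constants and variables of interpretable types) $\mid\mathit{nb}~\mathit{nf}\mid\mathit{nb}\oplus\mathit{nf}\mid\mathit{nf}\oplus\mathit{nb}\mid\mathit{nb}\ominus\mathit{nf}\mid\mathit{nf}\ominus\mathit{nb}\mid\mathit{nb}*\mathit{nb}\mid\frac{\partial\,\mathit{nb}}{\partial x}|_{\mathit{nb}}\mid\int_{\mathit{nb}}^{\mathit{nb}}\mathit{nb}\,dx$. A term is weak-normalizable if it reduces to a normal form (which is then unique, reduction being confluent). Higher-order notation. $(\lambda x{:}T.s)'=\lambda x{:}T.\frac{\partial s}{\partial x}|_x$; $f^{(0)}=f$, $f^{(n)}=(f')^{(n-1)}$; $\frac{\partial^0 t_1}{\partial x^0}|_{t_2}=t_1$, $\frac{\partial^n t_1}{\partial x^n}|_{t_2}=\frac{\partial\left(\frac{\partial^{n-1}t_1}{\partial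 x^{n-1}}|_x\right)}{\partial x}|_{t_2}$; $t*t_1^0=t$, $t*t_1^n=(t*t_1)*t_1^{n-1}$; for a base-type scalar $k$, $k\,t$ means $t*k$. $\sum$ denotes iterated $\oplus$; it acts componentwise on tuples and pointwise on functions like $\oplus$, and the infinite sum is the one of the base type interpretation at base types. Base types. There is a default well-defined interpreter evaluating terms built from constants and variables of interpretable types by abstraction, application, $\oplus,\ominus,*$, derivative and integration (under an environment mapping variables to constants). On each base type $\oplus$ and $*$ are associative and commutative, $(a\oplus b)\ominus b=a$, $(a\ominus b)\oplus b=a$, and $a*(b\oplus c)=a*b\oplus a*c$. Standing assumption: on base types, the Newton–Leibniz formula, the Chain Rule and Taylor's theorem hold for all primitive functions and their closures under addition, subtraction, multiplication, derivative and integration; in particular the multivariable Taylor theorem $F(x_0+h)=F(x_0)+\sum_{k=1}^\infty\frac1{k!}\big(\sum_{i=1}^n h_i\frac{\partial}{\partial x_i}\big)^kF(x_0)$ for $n$-dimensional $x_0,h$. Term equality. Open terms: $t_1=t_2$ iff for the free variables $x_1,\dots,x_n$ of $t_1,t_2$ and all closed weak-normalizable terms $u_i$ of the same type as $x_i$, $t_1[u_1/x_1,\dots,u_n/x_n]=t_2[u_1/x_1,\dots,u_n/x_n]$. Closed terms: $t_1=t_2$ iff their normal forms are equal, where normal forms $n_1,n_2$ are equal if: (1) $n_1,n_2$ have the same interpretable type and are equal under the base type interpretation; or (2) $n_1=(t_1,\dots,t_n)$, $n_2=(t_1',\dots,t_n')$ and $t_j=t_j'$ for all $j$; or (3) $n_1=\lambda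 x{:}T.t$, $n_2=\lambda y{:}T.t'$ and $n_1~x$ equals $n_2~x$; or (4) $n_1=inl~t_1'$, $n_2=inl~t_2'$ with $t_1'=t_2'$; or (5) the same with $inr$. Equality between unnormalizable terms is undefined. *)

(* Defs.v *)
From Stdlib Require Import List Arith Relations.
Import ListNotations.

Set Implicit Arguments.
Unset Strict Implicit.
Unset Printing Implicit Defensive.

Inductive ity (B : Type) : Type :=
| IBase (b : B)
| IArr (a c : ity B).

(* Tuple types (T_1, ..., T_n) have n >= 1: head and tail are separated. *)
Inductive ty (B : Type) : Type :=
| TBase (b : B)
| TTup (T : ty B) (Ts : list (ty B))
| TArr (A C : ty B)
| TSum (A C : ty B).

Fixpoint ity_ty (B : Type) (a : ity B) : ty B :=
  match a with
  | IBase b => TBase b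
  | IArr a c => TArr (ity_ty a) (ity_ty c)
  end.

Fixpoint addable (B : Type) (T : ty B) : bool :=
  match T with
  | TBase _ => true
  | TTup T Ts => addable T && forallb (@addable B) Ts
  | TArr _ C => addable C
  | TSum _ _ => false
  end.

(* [dty T A] is the type dT/dA.  It is meaningful only when [has_dty A] holds;
   the value on function and sum types A is junk. *)
Fixpoint has_dty (B : Type) (A : ty B) : bool :=
  match A with
  | TBase _ => true
  | TTup A As => has_dty A && forallb (@has_dty B) As
  | TArr _ _ | TSum _ _ => false
  end.

Fixpoint dty (B : Type) (T A : ty B) : ty B :=
  match A with
  | TBase _ => T
  | TTup A As => TTup (dty T A) (map (dty T) As)
  | TArr _ _ | TSum _ _ => T
  end.

(* [cst a] is the set of constants of the interpretable type [a].  Constants are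
   both syntactic objects and the values computed by the interpreter. *)
Record sig : Type := Sig {
  base : Type;
  cst : ity base -> Type }.

Inductive op : Type := oplus | ominus.

Section Syntax.
Variable Sg : sig.

Local Notation ity := (ity (base Sg)).
Local Notation ty := (ty (base Sg)).

(* Index 0 is bound in: the body of [Lam]; the first argument [t] of
   [Der t s] = d t / d x |_s; the last argument of [Int a b t], the integral of
   [t] from [a] to [b]; each branch of [Case].  [Proj j] is the projection
   pi_(j+1).  Injections carry the other summand of their type, as abstractions
   carry their domain, so that a term has at most one type in a context and side
   conditions such as "t_0 : B" are unambiguous. *)
Inductive tm : Type :=
| Cst (a : ity) (c : cst a)
| Var (i : nat)
| Lam (A : ty) (t : tm)
| App (t s : tm)
| Tup (ts : list tm)
| Proj (j : nat) (t : tm)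
| AddOp (o : op) (t s : tm)
| Mul (t s : tm)
| Der (t s : tm)
| Int (a b t : tm)
| Inl (C : ty) (t : tm)
| Inr (C : ty) (t : tm)
| Case (t t1 t2 : tm)
| Fix (t : tm).

Definition scons (X : Type) (x : X) (f : nat -> X) (i : nat) : X :=
  match i with 0 => x | S i => f i end.

Definition upr (r : nat -> nat) : nat -> nat :=
  scons 0 (fun i => S (r i)).

Fixpoint rename (r : nat -> nat) (t : tm) : tm :=
  match t with
  | Cst c => Cst c
  | Var i => Var (r i)
  | Lam A t => Lam A (rename (upr r) t)
  | App t s => App (rename r t) (rename r s)
  | Tup ts => Tup (map (rename r) ts)
  | Proj j t => Proj j (rename r t)
  | AddOp o t s => AddOp o (rename r t) (rename r s)
  | Mul t s => Mul (rename r t) (rename r s)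
  | Der t s => Der (rename (upr r) t) (rename r s)
  | Int a b t => Int (rename r a) (rename r b) (rename (upr r) t)
  | Inl C t => Inl C (rename r t)
  | Inr C t => Inr C (rename r t)
  | Case t t1 t2 => Case (rename r t) (rename (upr r) t1) (rename (upr r) t2)
  | Fix t => Fix (rename r t)
  end.

Definition shift : tm -> tm := rename S.

Definition ups (s : nat -> tm) : nat -> tm :=
  scons (Var 0) (fun i => shift (s i)).

Fixpoint subst (r : nat -> tm) (t : tm) : tm :=
  match t with
  | Cst c => Cst c
  | Var i => r i
  | Lam A t => Lam A (subst (ups r) t)
  | App t s => App (subst r t) (subst r s)
  | Tup ts => Tup (map (subst r) ts)
  | Proj j t => Proj j (subst r t)
  | AddOp o t s => AddOp o (subst r t) (subst r s)
  | Mul t s => Mul (subst r t) (subst r s)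
  | Der t s => Der (subst (ups r) t) (subst r s)
  | Int a b t => Int (subst r a) (subst r b) (subst (ups r) t)
  | Inl C t => Inl C (subst r t)
  | Inr C t => Inr C (subst r t)
  | Case t t1 t2 => Case (subst r t) (subst (ups r) t1) (subst (ups r) t2)
  | Fix t => Fix (subst r t)
  end.

Definition subst1 (u t : tm) : tm := subst (scons u Var) t.

Definition swap : tm -> tm :=
  rename (fun i => match i with 0 => 1 | 1 => 0 | i => i end).

Fixpoint free (i : nat) (t : tm) : Prop :=
  match t with
  | Cst _ => False
  | Var j => i = j
  | Lam _ t => free (S i) t
  | App t s | AddOp _ t s | Mul t s => free i t \/ free i s
  | Tup ts => fold_right (fun t P => free i t \/ P) False ts
  | Proj _ t | Inl _ t | Inr _ t | Fix t => free i t
  | Der t s => free (S i) t \/ free i s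
  | Int a b t => free i a \/ free i b \/ free (S i) t
  | Case t t1 t2 => free i t \/ free (S i) t1 \/ free (S i) t2
  end.

Definition ctx : Type := list ty.

Inductive has_type : ctx -> tm -> ty -> Prop :=
| ty_cst G a (c : cst a) : has_type G (Cst c) (ity_ty a)
| ty_var G i A : nth_error G i = Some A -> has_type G (Var i) A
| ty_lam G A C t : has_type (A :: G) t C -> has_type G (Lam A t) (TArr A C)
| ty_app G A C t s :
    has_type G t (TArr A C) -> has_type G s A -> has_type G (App t s) C
| ty_tup G ts T Ts :
    Forall2 (has_type G) ts (T :: Ts) -> has_type G (Tup ts) (TTup T Ts)
| ty_proj G j t T Ts A :
    has_type G t (TTup T Ts) -> nth_error (T :: Ts) j = Some A ->
    has_type G (Proj j t) A
| ty_addop G o t s T :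
    addable T = true -> has_type G t T -> has_type G s T ->
    has_type G (AddOp o t s) T
| ty_mul G t s T A :
    addable T = true -> has_dty A = true ->
    has_type G t (dty T A) -> has_type G s A -> has_type G (Mul t s) T
| ty_der G t s T A :
    has_dty A = true ->
    has_type G s A -> has_type (A :: G) t T -> has_type G (Der t s) (dty T A)
| ty_int G a b t T A :
    addable T = true -> has_dty A = true ->
    has_type G a A -> has_type G b A -> has_type (A :: G) t (dty T A) ->
    has_type G (Int a b t) T
| ty_inl G A C t : has_type G t A -> has_type G (Inl C t) (TSum A C)
| ty_inr G A C t : has_type G t A -> has_type G (Inr C t) (TSum C A)
| ty_case G A C T t t1 t2 :
    has_type G t (TSum A C) -> has_type (A :: G) t1 T -> has_type (C :: G) t2 T ->
    has_type G (Case t t1 t2) T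
| ty_fix G t T : has_type G t (TArr T T) -> has_type G (Fix t) T.

Definition osum (t : tm) (ts : list tm) : tm := fold_left (AddOp oplus) ts t.

Definition indexed (X : Type) (l : list X) : list (nat * X) :=
  combine (seq 0 (length l)) l.

(* (l_1, ..., l_(i-1), x, r_(i+1), ..., r_n) with x the new variable 0. *)
Definition star (i : nat) (l r : list tm) : tm :=
  Tup (map shift (firstn i l) ++ Var 0 :: map shift (skipn (S i) r)).

(* t[u/x], where u lives under the new binder 0 that replaces x. *)
Definition subst_under (u t : tm) : tm :=
  subst (scons u (fun i => Var (S i))) t.

Definition is_base (G : ctx) (t : tm) : Prop := exists b, has_type G t (TBase b).

(* The context is needed for the side conditions "t_0 : B". *)
Inductive red : ctx -> tm -> tm -> Prop :=
| red_beta G A t s : red G (App (Lam A t) s) (subst1 s t)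
| red_proj G j ts t : nth_error ts j = Some t -> red G (Proj j (Tup ts)) t
| red_case_inl G C t t1 t2 : red G (Case (Inl C t) t1 t2) (subst1 t t1)
| red_case_inr G C t t1 t2 : red G (Case (Inr C t) t1 t2) (subst1 t t2)
| red_fix G t : red G (Fix t) (App t (Fix t))

| red_der_tup G ts s : is_base G s ->
    red G (Der (Tup ts) s) (Tup (map (fun t => Der t s) ts))
| red_der_inl G C t s : is_base G s -> red G (Der (Inl C t) s) (Inl C (Der t s))
| red_der_inr G C t s : is_base G s -> red G (Der (Inr C t) s) (Inr C (Der t s))
| red_der_lam G A t s : is_base G s ->
    red G (Der (Lam A t) s) (Lam A (Der (swap t) (shift s)))
| red_der_at_tup G t ss :
    red G (Der t (Tup ss))
      (Tup (map (fun p => Der (subst_under (star (fst p) ss ss) t) (snd p))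
                (indexed ss)))

| red_int_tup G a b ts : is_base G a -> is_base G b ->
    red G (Int a b (Tup ts)) (Tup (map (Int a b) ts))
| red_int_inl G a b C t : is_base G a -> is_base G b ->
    red G (Int a b (Inl C t)) (Inl C (Int a b t))
| red_int_inr G a b C t : is_base G a -> is_base G b ->
    red G (Int a b (Inr C t)) (Inr C (Int a b t))
| red_int_lam G a b A t : is_base G a -> is_base G b ->
    red G (Int a b (Lam A t)) (Lam A (Int (shift a) (shift b) (swap t)))
| red_int_between_tup G ts1 ts2 t r rs :
    length ts1 = length ts2 ->
    map (fun p => Int (fst (snd p)) (snd (snd p))
                    (Proj (fst p) (subst_under (star (fst p) ts2 ts1) t)))
        (indexed (combine ts1 ts2)) = r :: rs ->
    red G (Int (Tup ts1) (Tup ts2) t) (osum r rs)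

| red_addop_tup G o ts1 ts2 :
    length ts1 = length ts2 ->
    red G (AddOp o (Tup ts1) (Tup ts2))
      (Tup (map (fun p => AddOp o (fst p) (snd p)) (combine ts1 ts2)))
| red_addop_lam G o A t1 t2 :
    red G (AddOp o (Lam A t1) (Lam A t2)) (Lam A (AddOp o t1 t2))

| red_mul_tup G ts s : is_base G s ->
    red G (Mul (Tup ts) s) (Tup (map (fun t => Mul t s) ts))
| red_mul_lam G A t s : is_base G s ->
    red G (Mul (Lam A t) s) (Lam A (Mul t (shift s)))
| red_mul_inl G C t s : is_base G s -> red G (Mul (Inl C t) s) (Inl C (Mul t s))
| red_mul_inr G C t s : is_base G s -> red G (Mul (Inr C t) s) (Inr C (Mul t s))
| red_mul_between_tup G t1 ts1 t2 ts2 :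
    length ts1 = length ts2 ->
    red G (Mul (Tup (t1 :: ts1)) (Tup (t2 :: ts2)))
      (osum (Mul t1 t2) (map (fun p => Mul (fst p) (snd p)) (combine ts1 ts2)))

| red_in_lam G A t t' : red (A :: G) t t' -> red G (Lam A t) (Lam A t')
| red_in_app1 G t t' s : red G t t' -> red G (App t s) (App t' s)
| red_in_app2 G t s s' : red G s s' -> red G (App t s) (App t s')
| red_in_tup G l t t' r : red G t t' ->
    red G (Tup (l ++ t :: r)) (Tup (l ++ t' :: r))
| red_in_proj G j t t' : red G t t' -> red G (Proj j t) (Proj j t')
| red_in_addop1 G o t t' s : red G t t' -> red G (AddOp o t s) (AddOp o t' s)
| red_in_addop2 G o t s s' : red G s s' -> red G (AddOp o t s) (AddOp o t s')
| red_in_mul1 G t t' s : red G t t' -> red G (Mul t s) (Mul t' s)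
| red_in_mul2 G t s s' : red G s s' -> red G (Mul t s) (Mul t s')
| red_in_der1 G A t t' s :
    has_type G s A -> red (A :: G) t t' -> red G (Der t s) (Der t' s)
| red_in_der2 G t s s' : red G s s' -> red G (Der t s) (Der t s')
| red_in_int1 G a a' b t : red G a a' -> red G (Int a b t) (Int a' b t)
| red_in_int2 G a b b' t : red G b b' -> red G (Int a b t) (Int a b' t)
| red_in_int3 G A a b t t' :
    has_type G a A -> red (A :: G) t t' -> red G (Int a b t) (Int a b t')
| red_in_inl G C t t' : red G t t' -> red G (Inl C t) (Inl C t')
| red_in_inr G C t t' : red G t t' -> red G (Inr C t) (Inr C t')
| red_in_case G t t' t1 t2 : red G t t' -> red G (Case t t1 t2) (Case t' t1 t2)
| red_in_case1 G A C t t1 t1' t2 :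
    has_type G t (TSum A C) -> red (A :: G) t1 t1' ->
    red G (Case t t1 t2) (Case t t1' t2)
| red_in_case2 G A C t t1 t2 t2' :
    has_type G t (TSum A C) -> red (C :: G) t2 t2' ->
    red G (Case t t1 t2) (Case t t1 t2')
| red_in_fix G t t' : red G t t' -> red G (Fix t) (Fix t').

Definition reds (G : ctx) : tm -> tm -> Prop := clos_refl_trans tm (red G).

Inductive nf : ctx -> tm -> Prop :=
| nf_nb G t : nb G t -> nf G t
| nf_tup G ts : Forall (nf G) ts -> nf G (Tup ts)
| nf_lam G A t : (forall t', ~ red (A :: G) t t') -> nf G (Lam A t)
| nf_inl G C t : nf G t -> nf G (Inl C t)
| nf_inr G C t : nf G t -> nf G (Inr C t)
with nb : ctx -> tm -> Prop :=
| nb_cst G a (c : cst a) : nb G (Cst c)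
| nb_var G i a : nth_error G i = Some (ity_ty a) -> nb G (Var i)
| nb_app G t s : nb G t -> nf G s -> nb G (App t s)
| nb_addop1 G o t s : nb G t -> nf G s -> nb G (AddOp o t s)
| nb_addop2 G o t s : nf G t -> nb G s -> nb G (AddOp o t s)
| nb_mul G t s : nb G t -> nb G s -> nb G (Mul t s)
| nb_der G A t s : has_type G s A -> nb (A :: G) t -> nb G s -> nb G (Der t s)
| nb_int G A a b t :
    has_type G a A -> nb G a -> nb G b -> nb (A :: G) t -> nb G (Int a b t).

Definition normalizes_to (G : ctx) (t n : tm) : Prop := reds G t n /\ nf G n.

Definition wn (G : ctx) (t : tm) : Prop := exists n, normalizes_to G t n.

(* f' for f : T -> T'.  A function that is not an abstraction is read as its
   eta-expansion. *)
Definition fprime (T : ty) (f : tm) : tm :=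
  match f with
  | Lam A s => Lam A (Der (rename (upr S) s) (Var 0))
  | _ => Lam T (Der (App (shift (shift f)) (Var 0)) (Var 0))
  end.

Fixpoint fder (T : ty) (n : nat) (f : tm) : tm :=
  match n with
  | 0 => f
  | S n => fder T n (fprime T f)
  end.

Fixpoint mulpow (t h : tm) (n : nat) : tm :=
  match n with
  | 0 => t
  | S n => mulpow (Mul t h) h n
  end.

(* dt/dx_i |_(x_i), where x_i is the free variable i. *)
Definition pder (i : nat) (t : tm) : tm :=
  Der (rename (fun j => if j =? i then 0 else S j) t) (Var i).

(* (h_0 d/dx_0 + ... + h_n d/dx_n)^k t for scalars h_i, the x_i being the free
   variables 0, ..., n of t; the scalars are pulled out of the derivatives:
   D^(k+1) t = sum_i h_i D^k (dt/dx_i). *)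
Fixpoint dirpow (h : tm) (hs : list tm) (k : nat) (t : tm) : tm :=
  match k with
  | 0 => t
  | S k =>
      osum (Mul (dirpow h hs k (pder 0 t)) h)
           (map (fun p => Mul (dirpow h hs k (pder (S (fst p)) t)) (snd p))
                (indexed hs))
  end.

Fixpoint interpretable (t : tm) : Prop :=
  match t with
  | Cst _ | Var _ => True
  | Lam A t => (exists a, A = ity_ty a) /\ interpretable t
  | App t s | AddOp _ t s | Mul t s | Der t s => interpretable t /\ interpretable s
  | Int a b t => interpretable a /\ interpretable b /\ interpretable t
  | Tup _ | Proj _ _ | Inl _ _ | Inr _ _ | Case _ _ _ | Fix _ => False
  end.

End Syntax.

Arguments Var {Sg} i.

(* [mul] covers every product a * x with a and x of base type allowed by the
   typing rule, whose result has the type of a.  [hsum v c] means that the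
   infinite sum of v_0, v_1, ... is defined and equal to c.
   [inv_fact k] is the scalar 1/k!. *)
Record model (Sg : sig) : Type := Model {
  app : forall a c : ity (base Sg), cst (IArr a c) -> cst a -> cst c;
  add : forall b : base Sg, cst (IBase b) -> cst (IBase b) -> cst (IBase b);
  sub : forall b : base Sg, cst (IBase b) -> cst (IBase b) -> cst (IBase b);
  mul : forall b b' : base Sg, cst (IBase b) -> cst (IBase b') -> cst (IBase b);
  der : forall b b' : base Sg,
    (cst (IBase b) -> cst (IBase b')) -> cst (IBase b) -> cst (IBase b');
  int : forall b b' : base Sg,
    cst (IBase b) -> cst (IBase b) -> (cst (IBase b) -> cst (IBase b')) ->
    cst (IBase b');
  hsum : forall b : base Sg, (nat -> cst (IBase b)) -> cst (IBase b) -> Prop;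
  scalar : base Sg;
  inv_fact : nat -> cst (IBase scalar) }.

Section Interpretation.
Variables (Sg : sig) (M : model Sg).

Local Notation ity := (ity (base Sg)).

Definition app_op (o : op) (b : base Sg) :
    cst (IBase b) -> cst (IBase b) -> cst (IBase b) :=
  match o with oplus => @add Sg M b | ominus => @sub Sg M b end.

(* The operations act pointwise on constants of function type.  As a pointwise
   result need not a priori be a constant, these are relations; the last argument
   is the result. *)
Fixpoint op_at (o : op) (a : ity) : cst a -> cst a -> cst a -> Prop :=
  match a with
  | IBase b => fun x y z => z = app_op o x y
  | IArr a c => fun f g k =>
      forall x, op_at o (app M f x) (app M g x) (app M k x)
  end.

Fixpoint mul_at (a : ity) (b : base Sg) : cst a -> cst (IBase b) -> cst a -> Prop :=
  match a with
  | IBase b' => fun x y z => z = mul M x y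
  | IArr a c => fun f y k => forall x, mul_at (app M f x) y (app M k x)
  end.

Fixpoint der_at (b : base Sg) (a : ity) :
    (cst (IBase b) -> cst a) -> cst (IBase b) -> cst a -> Prop :=
  match a with
  | IBase b' => fun F x z => z = der M F x
  | IArr a c => fun F x k => forall y, der_at (fun z => app M (F z) y) x (app M k y)
  end.

Fixpoint int_at (b : base Sg) (a : ity) (l u : cst (IBase b)) :
    (cst (IBase b) -> cst a) -> cst a -> Prop :=
  match a with
  | IBase b' => fun F z => z = int M l u F
  | IArr a c => fun F k => forall y, int_at l u (fun z => app M (F z) y) (app M k y)
  end.

Fixpoint hsum_at (a : ity) : (nat -> cst a) -> cst a -> Prop :=
  match a with
  | IBase b => fun v z => hsum M v z
  | IArr a c => fun v k => forall x, hsum_at (fun n => app M (v n) x) (app M k x)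
  end.

Definition env : Type := list {a : ity & cst a}.

Definition env_ctx (r : env) : ctx Sg := map (fun p => ity_ty (projT1 p)) r.

(* [ev t r c]: the interpreter sends [t] to [c] under the environment [r]. *)
Fixpoint ev (t : tm Sg) (r : env) (a : ity) {struct t} : cst a -> Prop :=
  match t with
  | Cst c0 => fun c => existT _ _ c0 = existT _ a c
  | Var i => fun c => nth_error r i = Some (existT _ a c)
  | Lam A t =>
      match a with
      | IBase _ => fun _ => False
      | IArr a1 a2 => fun c =>
          A = ity_ty a1 /\ forall x, ev t (existT _ a1 x :: r) (app M c x)
      end
  | App t s => fun c =>
      exists a1 (f : cst (IArr a1 a)) (x : cst a1),
        ev t r f /\ ev s r x /\ c = app M f x
  | AddOp o t s => fun c =>
      exists x y : cst a, ev t r x /\ ev s r y /\ op_at o x y c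
  | Mul t s => fun c =>
      exists (x : cst a) (b : base Sg) (y : cst (IBase b)),
        ev t r x /\ ev s r y /\ mul_at x y c
  | Der t s => fun c =>
      exists (b : base Sg) (F : cst (IBase b) -> cst a) (x : cst (IBase b)),
        (forall y, ev t (existT _ (IBase b) y :: r) (F y)) /\ ev s r x /\
        der_at F x c
  | Int l u t => fun c =>
      exists (b : base Sg) (x y : cst (IBase b)) (F : cst (IBase b) -> cst a),
        ev l r x /\ ev u r y /\
        (forall z, ev t (existT _ (IBase b) z :: r) (F z)) /\ int_at x y F c
  | _ => fun _ => False
  end.

Fixpoint nfold (b : base Sg) (n : nat) (x : cst (IBase b)) : cst (IBase b) :=
  match n with
  | 0 => x
  | S n => add M (nfold n x) x
  end.

(* A pair (x, h) of a base point and an increment, in the same base type. *)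
Definition increment : Type := {b : base Sg & (cst (IBase b) * cst (IBase b))%type}.

Definition pt_start (p : increment) : {a : ity & cst a} :=
  existT _ (IBase (projT1 p)) (fst (projT2 p)).

Definition pt_end (p : increment) : {a : ity & cst a} :=
  existT _ (IBase (projT1 p)) (add M (fst (projT2 p)) (snd (projT2 p))).

Definition pt_incr (p : increment) : tm Sg :=
  @Cst Sg (IBase (projT1 p)) (snd (projT2 p)).

(* Standing assumptions on the base types.  Base-type functions are given by
   constants of function type or, for Taylor's theorem, by interpretable terms
   whose first free variables are the arguments x_0, ..., x_n and whose other
   free variables are parameters. *)
Record lawful : Prop := Lawful {
  app_ext : forall (a c : ity) (f g : cst (IArr a c)),
    (forall x, app M f x = app M g x) -> f = g;
  ev_total : forall (t : tm Sg) (r : env) (a : ity),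
    interpretable t -> has_type (env_ctx r) t (ity_ty a) ->
    exists c : cst a, ev t r c;

  addA : forall (b : base Sg) (x y z : cst (IBase b)),
    add M x (add M y z) = add M (add M x y) z;
  addC : forall (b : base Sg) (x y : cst (IBase b)), add M x y = add M y x;
  addK : forall (b : base Sg) (x y : cst (IBase b)), sub M (add M x y) y = x;
  subK : forall (b : base Sg) (x y : cst (IBase b)), add M (sub M x y) y = x;
  mulA : forall (b : base Sg) (x y z : cst (IBase b)),
    mul M x (mul M y z) = mul M (mul M x y) z;
  mulC : forall (b : base Sg) (x y : cst (IBase b)), mul M x y = mul M y x;
  mulDr : forall (b : base Sg) (x y z : cst (IBase b)),
    mul M x (add M y z) = add M (mul M x y) (mul M x z);

  mul_inv_fact0 : forall (b : base Sg) (x : cst (IBase b)),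
    mul M x (inv_fact M 0) = x;
  inv_factS : forall k : nat, nfold k (inv_fact M (S k)) = inv_fact M k;

  hsum_unique : forall (b : base Sg) (v : nat -> cst (IBase b)) (x y : cst (IBase b)),
    hsum M v x -> hsum M v y -> x = y;
  hsum_cons : forall (b : base Sg) (v : nat -> cst (IBase b)) (x : cst (IBase b)),
    hsum M (fun k => v (S k)) x -> hsum M v (add M (v 0) x);

  newton_leibniz : forall (b b' : base Sg) (F : cst (IArr (IBase b) (IBase b')))
      (x y : cst (IBase b)),
    int M x y (der M (app M F)) = sub M (app M F y) (app M F x);
  chain_rule : forall (b1 b2 b3 : base Sg) (F : cst (IArr (IBase b2) (IBase b3)))
      (G : cst (IArr (IBase b1) (IBase b2))) (x : cst (IBase b1)),
    der M (fun y => app M F (app M G y)) x =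
      mul M (der M (app M F) (app M G x)) (der M (app M G) x);
  taylor : forall (p : increment) (ps : list increment) (r : env) (F : tm Sg)
      (b : base Sg) (v : nat -> cst (IBase b)) (w : cst (IBase b)),
    interpretable F ->
    has_type (env_ctx (map pt_start (p :: ps) ++ r)) F (TBase b) ->
    (forall k, ev (dirpow (pt_incr p) (map pt_incr ps) k F)
                  (map pt_start (p :: ps) ++ r) (v k)) ->
    ev F (map pt_end (p :: ps) ++ r) w ->
    exists x : cst (IBase b),
      hsum M (fun k => mul M (v (S k)) (inv_fact M (S k))) x /\
      w = add M (v 0) x }.

(* A term of the calculus, or a formal infinite sum s_0 (+) s_1 (+) ... of such
   terms.  Like (+), the sum commutes with tuples and abstractions: a sum of
   tuples is identified with the tuple of the sums, and a sum of abstractions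
   with the abstraction of the sum, whose application to u is the sum of the
   applications to u. *)
Inductive expr : Type :=
| Fin (t : tm Sg)
| Sum (s : nat -> tm Sg).

Definition expr_map (f : tm Sg -> tm Sg) (e : expr) : expr :=
  match e with
  | Fin t => Fin (f t)
  | Sum s => Sum (fun k => f (s k))
  end.

Definition expr_all (P : tm Sg -> Prop) (e : expr) : Prop :=
  match e with
  | Fin t => P t
  | Sum s => forall k, P (s k)
  end.

Definition expr_free (i : nat) (e : expr) : Prop :=
  match e with
  | Fin t => free i t
  | Sum s => exists k, free i (s k)
  end.

Definition expr_normalizes_to (e n : expr) : Prop :=
  match e, n with
  | Fin t, Fin n => normalizes_to nil t n
  | Sum s, Sum m => forall k, normalizes_to nil (s k) (m k)
  | _, _ => False
  end.

Definition expr_ev (e : expr) (a : ity) (c : cst a) : Prop :=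
  match e with
  | Fin t => ev t nil c
  | Sum s => exists v : nat -> cst a, (forall k, ev (s k) nil (v k)) /\ hsum_at v c
  end.

(* A sum is weak-normalizable iff all its summands are. *)
Definition expr_wn (G : ctx Sg) (e : expr) : Prop := expr_all (wn G) e.

Definition is_tup (m : nat) (t : tm Sg) : Prop :=
  exists ts, t = Tup ts /\ length ts = m.

Definition is_lam (A : ty (base Sg)) (t : tm Sg) : Prop := exists s, t = Lam A s.

Definition component (j : nat) (t : tm Sg) : tm Sg :=
  match t with
  | Tup ts => nth j ts t
  | _ => t
  end.

Inductive closed_eq : expr -> expr -> Prop :=
| closed_eq_nf e1 e2 n1 n2 :
    expr_normalizes_to e1 n1 -> expr_normalizes_to e2 n2 -> nf_eq n1 n2 ->
    closed_eq e1 e2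
with nf_eq : expr -> expr -> Prop :=
| nf_eq_interp (a : ity) (c : cst a) n1 n2 :
    expr_all (fun t => has_type nil t (ity_ty a)) n1 ->
    expr_all (fun t => has_type nil t (ity_ty a)) n2 ->
    expr_ev n1 c -> expr_ev n2 c -> nf_eq n1 n2
| nf_eq_tup m n1 n2 :
    expr_all (is_tup m) n1 -> expr_all (is_tup m) n2 ->
    (forall j, j < m ->
       closed_eq (expr_map (component j) n1) (expr_map (component j) n2)) ->
    nf_eq n1 n2
| nf_eq_lam A n1 n2 :
    expr_all (is_lam A) n1 -> expr_all (is_lam A) n2 ->
    (forall u, has_type nil u A -> wn nil u ->
       closed_eq (expr_map (fun t => App t u) n1) (expr_map (fun t => App t u) n2)) ->
    nf_eq n1 n2
| nf_eq_inl C C' t1 t2 :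
    closed_eq (Fin t1) (Fin t2) -> nf_eq (Fin (Inl C t1)) (Fin (Inl C' t2))
| nf_eq_inr C C' t1 t2 :
    closed_eq (Fin t1) (Fin t2) -> nf_eq (Fin (Inr C t1)) (Fin (Inr C' t2)).

Definition term_eq (G : ctx Sg) (e1 e2 : expr) : Prop :=
  forall u : nat -> tm Sg,
    (forall i A, expr_free i e1 \/ expr_free i e2 -> nth_error G i = Some A ->
       has_type nil (u i) A /\ wn nil (u i)) ->
    closed_eq (expr_map (subst u) e1) (expr_map (subst u) e2).

(* (1/k!) ((f^(k) t0) * (t (-) t0)^k), where f : T -> T' and a scalar multiple
   q s is s * q. *)
Definition taylor_term (T : ty (base Sg)) (f t t0 : tm Sg) (k : nat) : tm Sg :=
  Mul (mulpow (App (fder T k f) t0) (AddOp ominus t t0) k)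
      (@Cst Sg (IBase (scalar M)) (inv_fact M k)).

End Interpretation.

(* Main.v *)
(* Terms are normalizing as soon as they reduce to a term without Fix: confluence
   follows from the diamond property of superdevelopments, and Fix-free terms
   normalize by a reducibility argument.  Weak normalization of f t survives
   replacing t by the tuple X of distinct variables of the shape of T, since no
   reduction step can depend on the components of t, which are of base type.  A
   closed value of type T' is determined by its observations: the values at base
   type reached by projecting and by applying to closed arguments.  Under an
   observation, f X becomes an interpretable term F in the base variables X, the
   derivatives of f become iterated partial derivatives of F, and the product with
   (t - t0)^k adds them up to the k-th directional derivative of F.  So each
   observation of the two sides is an instance of Taylor's theorem at base types,
   and these assemble to an equality of terms by induction on T'. *)
From Stdlib Require Import List Arith Lia Relations Eqdep FunctionalExtensionality ClassicalEpsilon.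
Require Import Defs.
Import ListNotations.

Set Implicit Arguments.
Unset Strict Implicit.
Unset Printing Implicit Defensive.

(** The hypotheses speak of normal forms only at [t] and [t0], whereas the rule for a derivative at
    a tuple puts variables in place of the components; hence the generic point. That [T] has
    derivatives and is addable, and that [t] and [t0] normalize, is read off the summand k = 1,
    which contains [t (-) t0]. Having a normal form is awkward to propagate through contexts and
    substitutions, so it is traded throughout for reducing to a [Fix]-free term. Three arguments
    have the same core: reduction commutes with substitution, parallel steps have the diamond
    property, and reduction survives the replacement of a tuple. In each, a root contraction must be
    matched across a relation that acts inside subterms. They are instances of one lemma on abstract
    relations, [head_cong], whose main requirement is that a constructor inspected by a rule is
    still there on the other side. Two features of the models shape the semantic half: a base type
    may be empty, so values are taken relative to an environment, and it may lack a zero, so finite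
    sums are kept nonempty. *)

(** * Nested induction principles and lists *)

Lemma tm_nested_ind (Sg : sig) (P : tm Sg -> Prop)
  (Hcst : forall a (c : cst a), P (Cst c))
  (Hvar : forall i, P (Var i))
  (Hlam : forall A t, P t -> P (Lam A t))
  (Happ : forall t s, P t -> P s -> P (App t s))
  (Htup : forall ts, Forall P ts -> P (Tup ts))
  (Hproj : forall j t, P t -> P (Proj j t))
  (Haddop : forall o t s, P t -> P s -> P (AddOp o t s))
  (Hmul : forall t s, P t -> P s -> P (Mul t s))
  (Hder : forall t s, P t -> P s -> P (Der t s))
  (Hint : forall a b t, P a -> P b -> P t -> P (Int a b t))
  (Hinl : forall C t, P t -> P (Inl C t))
  (Hinr : forall C t, P t -> P (Inr C t))
  (Hcase : forall t t1 t2, P t -> P t1 -> P t2 -> P (Case t t1 t2))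
  (Hfix : forall t, P t -> P (Fix t)) : forall t, P t.
Proof.
  fix IH 1; intros [].
  - apply Hcst.
  - apply Hvar.
  - apply Hlam, IH.
  - apply Happ; apply IH.
  - apply Htup; induction ts; constructor; [apply IH | assumption].
  - apply Hproj, IH.
  - apply Haddop; apply IH.
  - apply Hmul; apply IH.
  - apply Hder; apply IH.
  - apply Hint; apply IH.
  - apply Hinl, IH.
  - apply Hinr, IH.
  - apply Hcase; apply IH.
  - apply Hfix, IH.
Qed.

Lemma ty_nested_ind (B : Type) (P : ty B -> Prop)
  (Hbase : forall b, P (TBase b))
  (Htup : forall T Ts, P T -> Forall P Ts -> P (TTup T Ts))
  (Harr : forall A C, P A -> P C -> P (TArr A C))
  (Hsum : forall A C, P A -> P C -> P (TSum A C)) : forall T, P T.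
Proof.
  fix IH 1; intros [].
  - apply Hbase.
  - apply Htup; [apply IH |]; induction Ts; constructor; [apply IH | assumption].
  - apply Harr; apply IH.
  - apply Hsum; apply IH.
Qed.

Lemma Forall2_nth_error (X Y : Type) (R : X -> Y -> Prop) l l' :
  Forall2 R l l' -> forall i a, nth_error l i = Some a ->
  exists b, nth_error l' i = Some b /\ R a b.
Proof.
  induction 1; intros [|i] a; simpl; try discriminate.
  - intros [= <-]; eauto.
  - eauto.
Qed.

Lemma Forall2_nth_error_r (X Y : Type) (R : X -> Y -> Prop) l l' :
  Forall2 R l l' -> forall i b, nth_error l' i = Some b ->
  exists a, nth_error l i = Some a /\ R a b.
Proof.
  induction 1; intros [|i] b; simpl; try discriminate.
  - intros [= <-]; eauto.
  - eauto.
Qed.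

Lemma nth_error_Forall2 (X Y : Type) (R : X -> Y -> Prop) l l' :
  length l = length l' ->
  (forall i a b, nth_error l i = Some a -> nth_error l' i = Some b -> R a b) ->
  Forall2 R l l'.
Proof.
  revert l'; induction l as [|a l IH]; intros [|b l'] E H; try discriminate; constructor.
  - apply (H 0); reflexivity.
  - apply IH; [now injection E | intros i; apply (H (S i))].
Qed.

Lemma nth_error_indexed (X : Type) (l : list X) i :
  nth_error (indexed l) i = option_map (fun a => (i, a)) (nth_error l i).
Proof.
  unfold indexed.
  enough (H : forall n, nth_error (combine (seq n (length l)) l) i
            = option_map (fun a => (n + i, a)) (nth_error l i)) by apply H.
  revert i; induction l as [|a l IH]; intros [|i] n; simpl; try reflexivity.
  - now rewrite Nat.add_0_r.
  - rewrite IH. destruct (nth_error l i); simpl; [|reflexivity].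
    repeat f_equal; lia.
Qed.

Lemma length_indexed (X : Type) (l : list X) : length (indexed l) = length l.
Proof. unfold indexed. rewrite length_combine, length_seq. lia. Qed.

Lemma nth_error_combine (X Y : Type) (l : list X) (l' : list Y) i :
  nth_error (combine l l') i =
  match nth_error l i, nth_error l' i with Some a, Some b => Some (a, b) | _, _ => None end.
Proof.
  revert l' i; induction l as [|a l IH]; intros [|b l'] [|i]; simpl; auto.
  now destruct (nth_error l i).
Qed.

(** * Syntax and typing *)

Section Substitution.
Variable Sg : sig.
Implicit Types (t s : tm Sg) (r : nat -> nat) (f g : nat -> tm Sg).

Lemma free_tup i (ts : list (tm Sg)) : free i (Tup ts) <-> Exists (free i) ts.
Proof.
  simpl; induction ts; simpl.
  - split; [easy | inversion 1].
  - rewrite IHts; split; [intros []; auto | inversion 1; auto].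
Qed.

Lemma subst_ext_free f g t : (forall i, free i t -> f i = g i) -> subst f t = subst g t.
Proof.
  revert f g; induction t using tm_nested_ind; intros f g E.
  5: { simpl; f_equal. apply map_ext_in; intros t Ht.
       rewrite Forall_forall in H; apply H; [assumption|].
       intros j Hj; apply E, free_tup, Exists_exists; eauto. }
  all: simpl in *; f_equal; auto.
  all: match goal with H : forall f g, _ -> subst f ?t = subst g ?t |- subst _ ?t = subst _ ?t =>
      apply H; intros [|i] Hi; simpl; [reflexivity | unfold shift; f_equal; auto] end.
Qed.

Lemma subst_ext f g t : (forall i, f i = g i) -> subst f t = subst g t.
Proof. intros E; apply subst_ext_free; auto. Qed.

Lemma rename_subst_var r t : rename r t = subst (fun i => Var (r i)) t.
Proof.
  revert r; induction t using tm_nested_ind; intros r; simpl; f_equal; auto.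
  all: try match goal with H : forall r, rename r ?t = _ |- rename _ ?t = _ =>
    rewrite H; apply subst_ext; intros [|i]; reflexivity end.
  apply map_ext_in; intros t Ht. rewrite Forall_forall in H; auto.
Qed.

Lemma rename_rename r r' t : rename r (rename r' t) = rename (fun i => r (r' i)) t.
Proof.
  revert r r'; induction t using tm_nested_ind; intros r r'; simpl; f_equal; auto.
  all: try match goal with H : forall r r', rename r (rename r' ?t) = _ |- _ =>
    rewrite H, 2!rename_subst_var; apply subst_ext; intros [|i]; reflexivity end.
  rewrite map_map; apply map_ext_in; intros t Ht. rewrite Forall_forall in H; auto.
Qed.

Lemma subst_rename f r t : subst f (rename r t) = subst (fun i => f (r i)) t.
Proof.
  revert f r; induction t using tm_nested_ind; intros f r; simpl; f_equal; auto.
  all: try match goal with H : forall f r, subst f (rename r ?t) = _ |- _ =>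
    rewrite H; apply subst_ext; intros [|i]; reflexivity end.
  rewrite map_map; apply map_ext_in; intros t Ht. rewrite Forall_forall in H; auto.
Qed.

Lemma rename_subst f r t : rename r (subst f t) = subst (fun i => rename r (f i)) t.
Proof.
  revert f r; induction t using tm_nested_ind; intros f r; simpl; f_equal; auto.
  all: try match goal with H : forall f r, rename r (subst f ?t) = _ |- _ =>
    rewrite H; apply subst_ext; intros [|i]; simpl; [reflexivity|];
    unfold shift; rewrite 2!rename_rename; reflexivity end.
  rewrite map_map; apply map_ext_in; intros t Ht. rewrite Forall_forall in H; auto.
Qed.

Lemma subst_subst f g t : subst f (subst g t) = subst (fun i => subst f (g i)) t.
Proof.
  revert f g; induction t using tm_nested_ind; intros f g; simpl; f_equal; auto.
  all: try match goal with H : forall f g, subst f (subst g ?t) = _ |- _ =>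
    rewrite H; apply subst_ext; intros [|i]; simpl; [reflexivity|];
    unfold shift; rewrite subst_rename, rename_subst; reflexivity end.
  rewrite map_map; apply map_ext_in; intros t Ht. rewrite Forall_forall in H; auto.
Qed.

Lemma subst_var t : subst Var t = t.
Proof.
  induction t using tm_nested_ind; simpl; f_equal; auto.
  all: try match goal with H : subst Var ?t = ?t |- subst _ ?t = ?t =>
    rewrite <- H at 2; apply subst_ext; intros [|i]; reflexivity end.
  rewrite <- map_id; apply map_ext_in; intros t Ht. rewrite Forall_forall in H; auto.
Qed.

Lemma subst_id f t : (forall i, f i = Var i) -> subst f t = t.
Proof. intros H; rewrite (subst_ext _ H); apply subst_var. Qed.

End Substitution.

(* Turns all renamings and substitutions of an equation into one substitution per
   subterm, and compares these pointwise. *)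
Ltac subst_norm :=
  unfold subst1, subst_under, swap, shift in *;
  repeat (rewrite ?rename_rename, ?subst_rename, ?rename_subst, ?subst_subst, ?rename_subst_var);
  simpl.
Ltac subst_point :=
  simpl; subst_norm;
  try solve [reflexivity
    | apply subst_id; reflexivity | symmetry; apply subst_id; reflexivity
    | apply subst_ext; intros; reflexivity].
Ltac subst_eq :=
  subst_norm;
  solve [reflexivity
    | apply subst_ext; let i := fresh "i" in intros i;
      subst_point; destruct i as [|i]; subst_point; destruct i as [|i]; subst_point].

Ltac inv H := inversion H; clear H; subst.

Section Free.
Variable Sg : sig.
Implicit Types (t s : tm Sg) (r : nat -> nat) (f g : nat -> tm Sg).

Lemma free_subst i f t : free i (subst f t) -> exists j, free j t /\ free i (f j).
Proof.
  (* Below a binder the substitution is shifted, so the statement for renamings has to come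
     first. *)
  enough (Hr : forall (t : tm Sg) i r, free i (rename r t) -> exists j, free j t /\ i = r j).
  { revert i f; induction t using tm_nested_ind; intros k f Hi.
    5: { simpl in Hi. apply free_tup, Exists_exists in Hi. destruct Hi as [u [Hu Hi]].
         apply in_map_iff in Hu; destruct Hu as [t [<- Ht]].
         rewrite Forall_forall in H. destruct (H t Ht k f Hi) as [j [Hj Hj']].
         exists j; split; [apply free_tup, Exists_exists; eauto | assumption]. }
    all: simpl in *.
    all: repeat match goal with H : _ \/ _ |- _ => destruct H end; try easy.
    all: try (eexists; split; [reflexivity | assumption]).
    all: match goal with
      | IH : forall i f, free i (subst f ?t) -> exists j, free j ?t /\ free i (f j), H : free _ (subst (ups _) ?t) |- _ =>
        destruct (IH _ _ H) as [[|y] [Hj Hj']]; simpl in Hj';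
        [discriminate Hj' | unfold shift in Hj'; destruct (Hr _ _ _ Hj') as [k' [Hk [= ->]]]]; eauto 6
      | IH : forall i f, free i (subst f ?t) -> exists j, free j ?t /\ free i (f j), H : free _ (subst _ ?t) |- _ =>
        destruct (IH _ _ H) as [y [Hj Hj']]; eauto 6 end. }
  clear; intros t; induction t using tm_nested_ind; intros k r Hi.
  5: { simpl in Hi. apply free_tup, Exists_exists in Hi. destruct Hi as [u [Hu Hi]].
       apply in_map_iff in Hu; destruct Hu as [t [<- Ht]].
       rewrite Forall_forall in H. destruct (H t Ht k r Hi) as [j [Hj Hj']].
       exists j; split; [apply free_tup, Exists_exists; eauto | assumption]. }
  all: simpl in *.
  all: repeat match goal with H : _ \/ _ |- _ => destruct H end; try easy; eauto.
  all: match goal with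
    | IH : forall i r, free i (rename r ?t) -> exists j, free j ?t /\ i = r j, H : free _ (rename (upr _) ?t) |- _ =>
      destruct (IH _ _ H) as [[|y] [Hj Hj']]; simpl in Hj';
      [discriminate Hj' | injection Hj' as Hj'; subst]; eauto 6
    | IH : forall i r, free i (rename r ?t) -> exists j, free j ?t /\ i = r j, H : free _ (rename _ ?t) |- _ =>
      destruct (IH _ _ H) as [y [Hj Hj']]; eauto 6 end.
Qed.

Lemma free_rename i r t : free i (rename r t) -> exists j, free j t /\ i = r j.
Proof.
  rewrite rename_subst_var; intros H; destruct (free_subst H) as [j [Hj Hj']]; eauto.
Qed.

End Free.

Section Typing.
Variable Sg : sig.
Implicit Types (t s : tm Sg) (G D : ctx Sg) (A T : ty (base Sg)) (r : nat -> nat) (f g : nat -> tm Sg).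

(** Needed for the uniqueness of types: in a product or an integral the result type [T] is visible
    only inside dT/dA. *)
Lemma dty_inj T T' A : has_dty A = true -> dty T A = dty T' A -> T = T'.
Proof.
  induction A using ty_nested_ind; simpl; intros HA E; try discriminate; try assumption.
  apply andb_prop in HA; injection E; intuition.
Qed.

Lemma typing_free G t T : has_type G t T ->
  forall i, free i t -> exists A, nth_error G i = Some A.
Proof.
  revert G T; induction t using tm_nested_ind; intros G T0 Ht x Hi.
  5: { apply free_tup, Exists_exists in Hi. destruct Hi as [t [Hin Hi]].
       inv Ht. rewrite Forall_forall in H.
       destruct (In_nth_error _ _ Hin) as [y Hk].
       destruct (Forall2_nth_error H2 Hk) as [A [_ HA]]. eauto. }
  all: simpl in Hi; try easy; inv Ht.
  all: repeat match goal with H : _ \/ _ |- _ => destruct H end; eauto.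
  all: match goal with
    | IH : forall G T, has_type G ?t T -> forall i, free i ?t -> exists A, nth_error G i = Some A, H : has_type (_ :: _) ?t _, H' : free _ ?t |- _ =>
      apply (IH _ _ H _ H') end.
Qed.

Lemma typing_rename G t T : has_type G t T -> forall D r,
  (forall i A, free i t -> nth_error G i = Some A -> nth_error D (r i) = Some A) ->
  has_type D (rename r t) T.
Proof.
  revert G T; induction t using tm_nested_ind; intros G T0 Ht D r Hr.
  all: inv Ht; simpl in *; try (econstructor; eauto; fail).
  - constructor. eapply IHt; [eassumption|]. intros [|i] A'; simpl; auto.
  - constructor.
    assert (Hr' : forall i A, Exists (free i) ts -> nth_error G i = Some A -> nth_error D (r i) = Some A).
    { intros i A Hi; apply Hr. now apply (free_tup i ts). }
    clear Hr. revert H2 Hr'. generalize (T :: Ts); intros L HL.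
    induction HL; simpl; intros Hr'; constructor.
    + inv H. eauto.
    + inv H. auto.
  - econstructor; eauto. eapply IHt1; [eassumption|]. intros [|i] A'; simpl; auto.
  - econstructor; eauto. eapply IHt3; [eassumption|]. intros [|i] A'; simpl; auto.
  - econstructor; eauto.
    + eapply IHt2; [eassumption|]. intros [|i] A'; simpl; auto.
    + eapply IHt3; [eassumption|]. intros [|i] A'; simpl; auto.
Qed.

Lemma typing_shift G B t T : has_type G t T -> has_type (B :: G) (shift t) T.
Proof. intros H; apply (typing_rename H); auto. Qed.

Lemma typing_subst G t T : has_type G t T -> forall D f,
  (forall i A, free i t -> nth_error G i = Some A -> has_type D (f i) A) ->
  has_type D (subst f t) T.
Proof.
  revert G T; induction t using tm_nested_ind; intros G T0 Ht D f Hf.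
  all: inv Ht; simpl in *; try (econstructor; eauto; fail); auto.
  - constructor. eapply IHt; [eassumption|].
    intros [|i] A' Hi E; simpl in *; [constructor; auto | apply typing_shift; auto].
  - constructor.
    assert (Hf' : forall i A, Exists (free i) ts -> nth_error G i = Some A -> has_type D (f i) A).
    { intros i A Hi; apply Hf. now apply (free_tup i ts). }
    clear Hf. revert H2 Hf'. generalize (T :: Ts); intros L HL.
    induction HL; simpl; intros Hf'; constructor.
    + inv H. eauto.
    + inv H. auto.
  - econstructor; eauto. eapply IHt1; [eassumption|].
    intros [|i] A' Hi E; simpl in *; [constructor; auto | apply typing_shift; auto].
  - econstructor; eauto. eapply IHt3; [eassumption|].
    intros [|i] A' Hi E; simpl in *; [constructor; auto | apply typing_shift; auto].
  - econstructor; eauto.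
    + eapply IHt2; [eassumption|].
      intros [|i] A' Hi E; simpl in *; [constructor; auto | apply typing_shift; auto].
    + eapply IHt3; [eassumption|].
      intros [|i] A' Hi E; simpl in *; [constructor; auto | apply typing_shift; auto].
Qed.

Lemma typing_unique G t T T' : has_type G t T -> has_type G t T' -> T = T'.
Proof.
  revert G T T'; induction t using tm_nested_ind; intros G T0 T0' H1 H2.
  5: { inv H1. inv H2. rewrite Forall_forall in H.
       assert (E : T :: Ts = T0 :: Ts0); [|congruence].
       apply nth_error_ext; intros i.
       destruct (nth_error ts i) as [t|] eqn:Et.
       - destruct (Forall2_nth_error H3 Et) as [A [-> HA]].
         destruct (Forall2_nth_error H4 Et) as [A' [-> HA']].
         f_equal. eapply H; eauto. eapply nth_error_In; eauto.
       - apply Forall2_length in H3, H4. apply nth_error_None in Et.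
         transitivity (@None (ty (base Sg))); [|symmetry]; apply nth_error_None; congruence. }
  all: inv H1; inv H2; auto; try congruence.
  all: try (f_equal; eauto; fail); eauto.
  - assert (E : TArr A T0 = TArr A0 T0') by eauto. congruence.
  - assert (E : TTup T Ts = TTup T1 Ts0) by eauto. congruence.
  - assert (A = A0) by eauto; subst. eapply dty_inj; [|eauto]; auto.
  - assert (A = A0) by eauto; subst. f_equal; eauto.
  - assert (A = A0) by eauto; subst. eapply dty_inj; [|eauto]; auto.
  - assert (E : TSum A C = TSum A0 C0) by eauto. inv E. eauto.
  - assert (E : TArr T0 T0 = TArr T0' T0') by eauto. congruence.
Qed.

Lemma is_base_inv G s A : is_base G s -> has_type G s A -> exists b, A = TBase b.
Proof. intros [b Hb] Hs; exists b; eapply typing_unique; eauto. Qed.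

Lemma typing_swap G A B t T :
  has_type (A :: B :: G) t T -> has_type (B :: A :: G) (swap t) T.
Proof. intros H; apply (typing_rename H). intros [|[|i]] A'; auto. Qed.

Lemma typing_subst1 G A s t T :
  has_type (A :: G) t T -> has_type G s A -> has_type G (subst1 s t) T.
Proof.
  intros H Hs; apply (typing_subst H). intros [|i] A' _; simpl; [congruence | now constructor].
Qed.

Lemma typing_subst_under G A B s t T :
  has_type (A :: G) t T -> has_type (B :: G) s A -> has_type (B :: G) (subst_under s t) T.
Proof.
  intros H Hs; apply (typing_subst H). intros [|i] A' _; simpl; [congruence | now constructor].
Qed.

Lemma typing_star G i ss1 ss2 (Ts : list (ty (base Sg))) T0 Ts0 B :
  Ts = T0 :: Ts0 ->
  Forall2 (has_type G) ss1 Ts -> Forall2 (has_type G) ss2 Ts -> nth_error Ts i = Some B ->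
  has_type (B :: G) (star i ss1 ss2) (TTup T0 Ts0).
Proof.
  intros -> H1 H2 Hi. constructor.
  rewrite <- (firstn_skipn i (T0 :: Ts0)).
  assert (E : skipn i (T0 :: Ts0) = B :: skipn (S i) (T0 :: Ts0)).
  { revert Hi. generalize (T0 :: Ts0). clear.
    induction i; intros [|C l] Hi; simpl in *; try congruence; try discriminate.
    now rewrite IHi. }
  rewrite E.
  assert (Hsh : forall l L, Forall2 (has_type G) l L -> Forall2 (has_type (B :: G)) (map (@shift Sg) l) L).
  { induction 1; simpl; constructor; auto using typing_shift. }
  apply Forall2_app; [|constructor].
  - apply Hsh. clear - H1. revert ss1 i H1. generalize (T0 :: Ts0).
    induction l; intros ss1 [|i] H; inv H; simpl; constructor; auto.
  - now constructor.
  - apply Hsh. clear - H2. revert ss2 H2. generalize (T0 :: Ts0) (S i). clear i.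
    induction l; intros [|i] ss1 H; inv H; simpl; auto.
Qed.

End Typing.

Ltac base_inv :=
  repeat match goal with
  | H : is_base ?G ?s, H' : has_type ?G ?s ?A |- _ =>
    let b := fresh "b" in let E := fresh "E" in
    destruct (is_base_inv H H') as [b E]; try discriminate E; subst; clear H; simpl in *
  end.

Ltac inv_intro :=
  repeat match goal with
  | H : has_type _ (Lam _ _) _ |- _ => inv H
  | H : has_type _ (Tup _) _ |- _ => inv H
  | H : has_type _ (Inl _ _) _ |- _ => inv H
  | H : has_type _ (Inr _ _) _ |- _ => inv H
  end.

Ltac uniq :=
  repeat match goal with
  | H : existT _ ?a _ = existT _ ?a _ |- _ => apply inj_pair2 in H; subst
  | H1 : has_type ?G ?t ?A, H2 : has_type ?G ?t ?B |- _ =>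
    let E := fresh "E" in
    assert (E : A = B) by (eapply typing_unique; eauto); clear H2;
    first [subst A | subst B | (injection E; clear E; intros; subst) | clear E]
  end.

(** The introduction forms. No rule contracts them at the root, and whenever a rule inspects the
    shape of an argument it looks for one of these; so they are exactly the shapes that a relation
    has to preserve. *)
Definition intro (Sg : sig) (t : tm Sg) : bool :=
  match t with
  | Lam _ _ | Tup _ | Inl _ _ | Inr _ _ => true
  | _ => false
  end.

Lemma Forall2_map_indexed (X Y X' Y' : Type) (R : X' -> Y' -> Prop)
    (f : nat * X -> X') (g : nat * Y -> Y') l l' :
  length l = length l' ->
  (forall i a b, nth_error l i = Some a -> nth_error l' i = Some b -> R (f (i, a)) (g (i, b))) ->
  Forall2 R (map f (indexed l)) (map g (indexed l')).
Proof.
  intros E H. apply nth_error_Forall2.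
  - now rewrite 2!length_map, 2!length_indexed.
  - intros i a b. rewrite 2!nth_error_map, 2!nth_error_indexed.
    destruct (nth_error l i) eqn:Ea, (nth_error l' i) eqn:Eb; simpl; try discriminate.
    intros [= <-] [= <-]; auto.
Qed.

Lemma Forall2_map_combine (X Y X' Y' Z Z' : Type) (R : Z -> Z' -> Prop)
    (R1 : X -> X' -> Prop) (R2 : Y -> Y' -> Prop) (f : X * Y -> Z) (g : X' * Y' -> Z') l1 l2 l1' l2' :
  Forall2 R1 l1 l1' -> Forall2 R2 l2 l2' ->
  (forall a b a' b', R1 a a' -> R2 b b' -> R (f (a, b)) (g (a', b'))) ->
  Forall2 R (map f (combine l1 l2)) (map g (combine l1' l2')).
Proof.
  intros H1; revert l2 l2'; induction H1; intros l2 l2' H2 Hf; simpl; [constructor|].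
  inv H2; simpl; constructor; auto.
Qed.

Lemma Forall2_map2 (X Y X' Y' : Type) (R : X' -> Y' -> Prop) (R1 : X -> Y -> Prop)
    (f : X -> X') (g : Y -> Y') l l' :
  Forall2 R1 l l' -> (forall a b, R1 a b -> R (f a) (g b)) -> Forall2 R (map f l) (map g l').
Proof. induction 1; simpl; constructor; auto. Qed.

(** * Head reduction *)

Section Head.
Variable Sg : sig.
Local Notation tm := (tm Sg).
Local Notation ty := (ty (base Sg)).
Local Notation ctx := (ctx Sg).
Local Notation osum := (@osum Sg).
Implicit Types (G D : ctx) (t s u v w : tm) (T A B C : ty).

(** The root contractions of [red] without the closure under contexts, so that the interplay of the
    rules with a relation on subterms can be studied once and for all. *)
Inductive head_step (G : ctx) : tm -> tm -> Prop :=
| head_beta A t s : head_step G (App (Lam A t) s) (subst1 s t)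
| head_proj j ts t : nth_error ts j = Some t -> head_step G (Proj j (Tup ts)) t
| head_case_inl C t t1 t2 : head_step G (Case (Inl C t) t1 t2) (subst1 t t1)
| head_case_inr C t t1 t2 : head_step G (Case (Inr C t) t1 t2) (subst1 t t2)
| head_fix t : head_step G (Fix t) (App t (Fix t))
| head_der_tup ts s : is_base G s ->
    head_step G (Der (Tup ts) s) (Tup (map (fun t => Der t s) ts))
| head_der_inl C t s : is_base G s -> head_step G (Der (Inl C t) s) (Inl C (Der t s))
| head_der_inr C t s : is_base G s -> head_step G (Der (Inr C t) s) (Inr C (Der t s))
| head_der_lam A t s : is_base G s ->
    head_step G (Der (Lam A t) s) (Lam A (Der (swap t) (shift s)))
| head_der_at_tup t ss :
    head_step G (Der t (Tup ss))
      (Tup (map (fun p => Der (subst_under (star (fst p) ss ss) t) (snd p))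
                (indexed ss)))
| head_int_tup a b ts : is_base G a -> is_base G b ->
    head_step G (Int a b (Tup ts)) (Tup (map (Int a b) ts))
| head_int_inl a b C t : is_base G a -> is_base G b ->
    head_step G (Int a b (Inl C t)) (Inl C (Int a b t))
| head_int_inr a b C t : is_base G a -> is_base G b ->
    head_step G (Int a b (Inr C t)) (Inr C (Int a b t))
| head_int_lam a b A t : is_base G a -> is_base G b ->
    head_step G (Int a b (Lam A t)) (Lam A (Int (shift a) (shift b) (swap t)))
| head_int_between_tup ts1 ts2 t r rs :
    length ts1 = length ts2 ->
    map (fun p => Int (fst (snd p)) (snd (snd p))
                    (Proj (fst p) (subst_under (star (fst p) ts2 ts1) t)))
        (indexed (combine ts1 ts2)) = r :: rs ->
    head_step G (Int (Tup ts1) (Tup ts2) t) (osum r rs)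
| head_addop_tup o ts1 ts2 :
    length ts1 = length ts2 ->
    head_step G (AddOp o (Tup ts1) (Tup ts2))
      (Tup (map (fun p => AddOp o (fst p) (snd p)) (combine ts1 ts2)))
| head_addop_lam o A t1 t2 :
    head_step G (AddOp o (Lam A t1) (Lam A t2)) (Lam A (AddOp o t1 t2))
| head_mul_tup ts s : is_base G s ->
    head_step G (Mul (Tup ts) s) (Tup (map (fun t => Mul t s) ts))
| head_mul_lam A t s : is_base G s ->
    head_step G (Mul (Lam A t) s) (Lam A (Mul t (shift s)))
| head_mul_inl C t s : is_base G s -> head_step G (Mul (Inl C t) s) (Inl C (Mul t s))
| head_mul_inr C t s : is_base G s -> head_step G (Mul (Inr C t) s) (Inr C (Mul t s))
| head_mul_between_tup t1 ts1 t2 ts2 :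
    length ts1 = length ts2 ->
    head_step G (Mul (Tup (t1 :: ts1)) (Tup (t2 :: ts2)))
      (osum (Mul t1 t2) (map (fun p => Mul (fst p) (snd p)) (combine ts1 ts2))).

Lemma head_red G t t' : head_step G t t' -> red G t t'.
Proof. destruct 1; econstructor; eauto. Qed.

Lemma typing_osum G T t ts : addable T = true ->
  has_type G t T -> Forall (fun s => has_type G s T) ts -> has_type G (osum t ts) T.
Proof.
  intros HT; revert t; induction ts; intros t Ht Hts; simpl; inv Hts; auto.
  apply IHts; [now constructor | assumption].
Qed.

Lemma typing_osum_inv G T t ts : has_type G (osum t ts) T ->
  has_type G t T /\ Forall (fun s => has_type G s T) ts.
Proof.
  revert t; induction ts; intros t H; simpl in H; auto.
  destruct (IHts _ H) as [H1 H2]. inv H1. auto.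
Qed.

Lemma addable_nth A As j B : addable (TTup A As) = true -> nth_error (A :: As) j = Some B ->
  addable B = true.
Proof.
  simpl; intros H Hj. apply andb_prop in H; destruct H as [H1 H2].
  destruct j; simpl in Hj; [congruence|].
  rewrite forallb_forall in H2; apply H2; eapply nth_error_In; eauto.
Qed.

Lemma has_dty_nth A As j B : has_dty (TTup A As) = true -> nth_error (A :: As) j = Some B ->
  has_dty B = true.
Proof.
  simpl; intros H Hj. apply andb_prop in H; destruct H as [H1 H2].
  destruct j; simpl in Hj; [congruence|].
  rewrite forallb_forall in H2; apply H2; eapply nth_error_In; eauto.
Qed.

Lemma nth_error_map_dty T A As j :
  nth_error (dty T A :: map (dty T) As) j = option_map (dty T) (nth_error (A :: As) j).
Proof. change (dty T A :: map (dty T) As) with (map (dty T) (A :: As)). apply nth_error_map. Qed.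

Lemma ty_der_base G t s T b :
  has_type G s (TBase b) -> has_type (TBase b :: G) t T -> has_type G (Der t s) T.
Proof. intros Hs Ht. exact (@ty_der Sg G t s T (TBase b) eq_refl Hs Ht). Qed.

Lemma ty_mul_base G t s T b : addable T = true ->
  has_type G t T -> has_type G s (TBase b) -> has_type G (Mul t s) T.
Proof. intros HT Ht Hs. exact (@ty_mul Sg G t s T (TBase b) HT eq_refl Ht Hs). Qed.

Lemma ty_int_base G a b t T c : addable T = true ->
  has_type G a (TBase c) -> has_type G b (TBase c) -> has_type (TBase c :: G) t T ->
  has_type G (Int a b t) T.
Proof. intros HT Ha Hb Ht. exact (@ty_int Sg G a b t T (TBase c) HT eq_refl Ha Hb Ht). Qed.

Lemma addable_tup T Ts : addable (TTup T Ts) = true ->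
  Forall (fun T => addable T = true) (T :: Ts).
Proof.
  simpl; intros H. apply andb_prop in H. destruct H as [H H'].
  constructor; auto. apply Forall_forall, forallb_forall, H'.
Qed.

Lemma has_dty_tup T Ts : has_dty (TTup T Ts) = true ->
  Forall (fun T => has_dty T = true) (T :: Ts).
Proof.
  simpl; intros H. apply andb_prop in H. destruct H as [H H'].
  constructor; auto. apply Forall_forall, forallb_forall, H'.
Qed.

Lemma head_typing G t t' T : head_step G t t' -> has_type G t T -> has_type G t' T.
Proof.
  intros Hh Ht; destruct Hh; inv Ht; base_inv; inv_intro; try discriminate.
  - eapply typing_subst1; eauto.
  - destruct (Forall2_nth_error_r H4 H5) as [s [Hs Hs']]. congruence.
  - eapply typing_subst1; eauto.
  - eapply typing_subst1; eauto.
  - econstructor; eauto. now constructor.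
  - constructor. induction H1; simpl; constructor; eauto using ty_der_base.
  - constructor. eauto using ty_der_base.
  - constructor. eauto using ty_der_base.
  - constructor. eapply ty_der_base; eauto using typing_shift, typing_swap.
  - simpl. constructor.
    change (dty T0 T :: map (dty T0) Ts) with (map (dty T0) (T :: Ts)).
    apply nth_error_Forall2.
    + rewrite 2!length_map, length_indexed. eapply Forall2_length; eauto.
    + intros i a B. rewrite 2!nth_error_map, nth_error_indexed.
      destruct (nth_error ss i) as [s|] eqn:Es; [|discriminate].
      destruct (nth_error (T :: Ts) i) as [B'|] eqn:EB; [|discriminate].
      intros [= <-] [= <-].
      destruct (Forall2_nth_error H2 Es) as [B'' [HB HB']].
      assert (B'' = B') by congruence; subst.
      econstructor; eauto.
      * eapply has_dty_nth; eauto.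
      * eapply typing_subst_under; eauto. eapply typing_star; eauto.
  - constructor. apply addable_tup in H4.
    revert H1 H4; generalize (T0 :: Ts); intros L HL.
    induction HL; simpl; intros Hadd; inv Hadd; constructor; eauto using ty_int_base.
  - constructor. eapply ty_int_base; eauto using typing_shift, typing_swap.
  - assert (HF : Forall (fun s => has_type G s T) (r :: rs)).
    { rewrite <- H0. apply Forall_forall. intros x Hx.
      destruct (In_nth_error _ _ Hx) as [i Hi].
      rewrite nth_error_map, nth_error_indexed, nth_error_combine in Hi.
      destruct (nth_error ts1 i) as [a|] eqn:Ea; try discriminate.
      destruct (nth_error ts2 i) as [b|] eqn:Eb; try discriminate.
      injection Hi as <-. simpl.
      destruct (Forall2_nth_error H8 Ea) as [B [HB HBa]].
      destruct (Forall2_nth_error H3 Eb) as [B' [HB' HBb]].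
      assert (B' = B) by congruence; subst.
      apply ty_int with (A := B); auto.
      - eapply has_dty_nth; eauto.
      - apply ty_proj with (T := dty T T0) (Ts := map (dty T) Ts).
        + eapply typing_subst_under; [exact H10|]. eapply typing_star; eauto.
        + rewrite nth_error_map_dty, HB; reflexivity. }
    inv HF. apply typing_osum; auto.
  - constructor.
    apply nth_error_Forall2.
    + rewrite length_map, length_combine. apply Forall2_length in H2, H5. lia.
    + intros i a B. rewrite nth_error_map, nth_error_combine.
      destruct (nth_error ts1 i) as [s1|] eqn:E1; simpl; try discriminate.
      destruct (nth_error ts2 i) as [s2|] eqn:E2; simpl; try discriminate.
      intros [= <-] HB; simpl.
      destruct (Forall2_nth_error H5 E1) as [B' [HB1 HB1']].
      destruct (Forall2_nth_error H2 E2) as [B'' [HB2 HB2']].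
      simpl in *. constructor; try congruence. eapply addable_nth; eauto.
  - constructor. constructor; auto.
  - constructor. apply addable_tup in H2.
    revert H1 H2; generalize (T0 :: Ts); intros L HL.
    induction HL; simpl; intros Hadd; inv Hadd; constructor; eauto using ty_mul_base.
  - constructor. eapply ty_mul_base; eauto using typing_shift.
  - apply has_dty_tup in H3. inv H7. inv H4. inv H3.
    apply typing_osum; auto.
    + eapply ty_mul; eauto.
    + apply Forall_forall. intros x Hx. destruct (In_nth_error _ _ Hx) as [i Hi].
      rewrite nth_error_map, nth_error_combine in Hi.
      destruct (nth_error ts1 i) as [s1|] eqn:E1; simpl in Hi; try discriminate.
      destruct (nth_error ts2 i) as [s2|] eqn:E2; simpl in Hi; try discriminate.
      injection Hi as <-; simpl.
      match goal with F1 : Forall2 _ ts1 _, F2 : Forall2 _ ts2 _ |- _ =>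
        destruct (Forall2_nth_error F2 E2) as [B [HB1 HB1']];
        destruct (Forall2_nth_error F1 E1) as [B' [HB2 HB2']] end.
      rewrite nth_error_map, HB1 in HB2; injection HB2 as <-.
      apply ty_mul with (A := B); auto.
      match goal with F : Forall _ Ts |- _ => rewrite Forall_forall in F; apply F end.
      eapply nth_error_In; eauto.
Qed.

(** The only overlaps are between the rules at a base type and those at a tuple, for derivatives,
    integrals and products; the side condition [is_base] rules out a tuple. *)
Lemma head_deterministic G t u v : head_step G t u -> head_step G t v -> u = v.
Proof.
  assert (Htup : forall ts, ~ is_base G (Tup ts)) by (intros ts [b Hb]; inv Hb).
  intros H1 H2; destruct H1; inv H2; try congruence;
    exfalso; match goal with H : is_base G (Tup ?ts) |- _ => exact (Htup _ H) end.
Qed.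

(** * Relations compatible with root contractions *)

Section Compatible.
Variables (I : Type) (src tgt : I -> ctx) (up : ty -> I -> I) (R : I -> tm -> tm -> Prop).

(** There is no clause for variables, because a substitution may send a variable to any term. The
    index records the contexts of both sides; the type of a bound variable is found by typing on the
    source side. *)
Inductive cong (i : I) : tm -> tm -> Prop :=
| cong_cst a (c : cst a) : cong i (Cst c) (Cst c)
| cong_lam A t t' : R (up A i) t t' -> cong i (Lam A t) (Lam A t')
| cong_app t t' s s' : R i t t' -> R i s s' -> cong i (App t s) (App t' s')
| cong_tup ts ts' : Forall2 (R i) ts ts' -> cong i (Tup ts) (Tup ts')
| cong_proj j t t' : R i t t' -> cong i (Proj j t) (Proj j t')
| cong_addop o t t' s s' : R i t t' -> R i s s' -> cong i (AddOp o t s) (AddOp o t' s')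
| cong_mul t t' s s' : R i t t' -> R i s s' -> cong i (Mul t s) (Mul t' s')
| cong_der A t t' s s' :
    has_type (src i) s A -> R (up A i) t t' -> R i s s' -> cong i (Der t s) (Der t' s')
| cong_int A a a' b b' t t' :
    has_type (src i) a A -> R i a a' -> R i b b' -> R (up A i) t t' ->
    cong i (Int a b t) (Int a' b' t')
| cong_inl C t t' : R i t t' -> cong i (Inl C t) (Inl C t')
| cong_inr C t t' : R i t t' -> cong i (Inr C t) (Inr C t')
| cong_case A C t t' t1 t1' t2 t2' :
    has_type (src i) t (TSum A C) -> R i t t' -> R (up A i) t1 t1' -> R (up C i) t2 t2' ->
    cong i (Case t t1 t2) (Case t' t1' t2')
| cong_fix t t' : R i t t' -> cong i (Fix t) (Fix t').

(** What is needed to replay a root contraction on the related term. [R_intro] keeps the redex,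
    [R_typing] keeps its side conditions, and the remaining clauses rebuild the reduct, which is
    made from parts of the redex by shifting, swapping and substituting. The instances are
    substitution, parallel reduction and the replacement of tuples. *)
Record compatible : Prop := Compatible {
  src_up : forall A i, src (up A i) = A :: src i;
  tgt_up : forall A i, tgt (up A i) = A :: tgt i;
  R_cong : forall i t w T, has_type (src i) t T -> cong i t w -> R i t w;
  R_var0 : forall A i, R (up A i) (Var 0) (Var 0);
  R_intro : forall i t w T, has_type (src i) t T -> R i t w -> intro t = true -> cong i t w;
  R_typing : forall i t w T, has_type (src i) t T -> R i t w -> has_type (tgt i) w T;
  R_shift : forall A i t w T, has_type (src i) t T -> R i t w -> R (up A i) (shift t) (shift w);
  R_swap : forall A B i t w T, has_type (A :: B :: src i) t T ->
    R (up A (up B i)) t w -> R (up B (up A i)) (swap t) (swap w);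
  R_subst1 : forall A i t w s s' T, has_type (A :: src i) t T -> has_type (src i) s A ->
    R (up A i) t w -> R i s s' -> R i (subst1 s t) (subst1 s' w);
  R_under : forall A B i t w s s' T, has_type (A :: src i) t T -> has_type (B :: src i) s A ->
    R (up A i) t w -> R (up B i) s s' -> R (up B i) (subst_under s t) (subst_under s' w) }.

Hypothesis HR : compatible.

Lemma R_osum i T t w ts ws : has_type (src i) (osum t ts) T ->
  cong i t w -> Forall2 (cong i) ts ws -> R i (osum t ts) (osum w ws).
Proof.
  intros HT Ht Hts. destruct (typing_osum_inv HT) as [Tt Tts].
  assert (Rt : R i t w) by (eapply R_cong; eauto). clear Ht.
  revert t w HT Rt Tt; induction Hts; intros t w HT Rt Tt; simpl in *; auto.
  inv Tts. apply IHHts; auto; destruct (typing_osum_inv HT) as [HA _]; auto.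
  eapply (R_cong HR); eauto. constructor; auto. eapply (R_cong HR); eauto.
Qed.

Lemma R_star i k B l l' r r' Ls Rs :
  Forall2 (has_type (src i)) l Ls -> Forall2 (has_type (src i)) r Rs ->
  Forall2 (R i) l l' -> Forall2 (R i) r r' ->
  (exists T, has_type (B :: src i) (star k l r) T) ->
  R (up B i) (star k l r) (star k l' r').
Proof.
  intros Hl Hr Rl Rr [T HT]. rewrite <- (src_up HR) in HT. eapply R_cong; eauto.
  constructor.
  assert (Hsh : forall l l' L n, Forall2 (has_type (src i)) l L -> Forall2 (R i) l l' ->
    Forall2 (R (up B i)) (map (@shift Sg) (firstn n l)) (map (@shift Sg) (firstn n l'))
    /\ Forall2 (R (up B i)) (map (@shift Sg) (skipn n l)) (map (@shift Sg) (skipn n l'))).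
  { clear - HR. intros l l' L n HL H; revert n L HL.
    induction H; intros [|n] L HL; simpl; split; auto.
    - constructor; inv HL; [eapply R_shift; eauto|].
      now apply (IHForall2 0 l'0).
    - inv HL. constructor; [eapply R_shift; eauto|]. now apply (IHForall2 n l'0).
    - inv HL. now apply (IHForall2 n l'0). }
  apply Forall2_app; [|constructor].
  - eapply Hsh; eauto.
  - apply R_var0; assumption.
  - eapply Hsh; eauto.
Qed.

Lemma R_tup i xs ys T : has_type (src i) (Tup xs) T -> Forall2 (cong i) xs ys -> R i (Tup xs) (Tup ys).
Proof.
  intros H HF. eapply (R_cong HR); eauto. constructor. inv H.
  match goal with F : Forall2 _ xs _ |- _ => revert F end.
  generalize (T0 :: Ts); induction HF; intros L HL; inv HL; constructor; eauto.
  eapply (R_cong HR); eauto.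
Qed.

(** The constructors taken apart by the rule survive on the right by [R_intro], and so does the
    condition of being of base type by [R_typing]; hence the same rule applies to [w]. The two
    reducts are assembled in the same way from related parts. *)
Lemma head_cong i u v w T : has_type (src i) u T -> head_step (src i) u v -> cong i u w ->
  exists z, head_step (tgt i) w z /\ R i v z.
Proof.
  intros Hu Hh Hc.
  pose proof (head_typing Hh Hu) as Hv.
  assert (Sup : forall A i, src (up A i) = A :: src i) by apply (src_up HR).
  assert (Hin : forall i t w T, has_type (src i) t T -> R i t w -> intro t = true -> cong i t w)
    by (intros; eapply R_intro; eauto).
  assert (HinU : forall A i t w T, has_type (A :: src i) t T -> R (up A i) t w ->
    intro t = true -> cong (up A i) t w)
    by (intros A i0 t w0 T0; rewrite <- Sup; eauto).
  assert (HC : forall t w T, has_type (src i) t T -> cong i t w -> R i t w)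
    by (intros; eapply R_cong; eauto).
  assert (HCU : forall A t w T, has_type (A :: src i) t T -> cong (up A i) t w -> R (up A i) t w)
    by (intros A t w0 T0; rewrite <- Sup; intros; eapply R_cong; eauto).
  assert (HB : forall s s' b, has_type (src i) s (TBase b) -> R i s s' -> is_base (tgt i) s')
    by (intros s0 s0' b Hs Rs; exists b; eapply R_typing; eauto).
  assert (Hsh : forall A t w T, has_type (src i) t T -> R i t w -> R (up A i) (shift t) (shift w))
    by (intros; eapply R_shift; eauto).
  assert (Hsw : forall A B t w T, has_type (A :: B :: src i) t T ->
    R (up A (up B i)) t w -> R (up B (up A i)) (swap t) (swap w))
    by (intros; eapply R_swap; eauto).
  destruct Hh; inv Hc; inv Hu; uniq;
  (* Every related subterm that is a constructor is inverted, which exhibits the same redex on the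
     right. *)
  repeat match goal with
    | H : R i ?t ?w, H' : has_type _ ?t _ |- _ =>
      match t with Lam _ _ => idtac | Tup _ => idtac | Inl _ _ => idtac | Inr _ _ => idtac end;
      apply (Hin _ _ _ _ H') in H; [inv H | reflexivity]
    | H : R (up _ i) ?t ?w, H' : has_type _ ?t _ |- _ =>
      match t with Lam _ _ => idtac | Tup _ => idtac | Inl _ _ => idtac | Inr _ _ => idtac end;
      apply (HinU _ _ _ _ _ H') in H; [inv H | reflexivity]
    end;
  repeat match goal with H : has_type _ (Tup _) (TBase _) |- _ => inv H end; base_inv.
  - inv_intro. eexists; split; [constructor|]. eapply (R_subst1 HR); eauto.
  - match goal with F : Forall2 (R i) ts _ |- _ =>
      destruct (Forall2_nth_error F H) as [z [Hz Hz']] end.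
    exists z; split; [now constructor | auto].
  - inv_intro. eexists; split; [constructor|]. eapply (R_subst1 HR); eauto.
  - inv_intro. eexists; split; [constructor|]. eapply (R_subst1 HR); eauto.
  - eexists; split; [constructor|]. eapply HC; eauto. constructor; auto.
    eapply HC; [econstructor; eauto|]. now constructor.
  - eexists; split; [constructor; eauto|]. eapply R_tup; eauto.
    eapply Forall2_map2; eauto. intros x y Hxy. econstructor; eauto.
  - eexists; split; [constructor; eauto|]. eapply HC; eauto. constructor.
    inv Hv. eapply HC; eauto. econstructor; eauto.
  - eexists; split; [constructor; eauto|]. eapply HC; eauto. constructor.
    inv Hv. eapply HC; eauto. econstructor; eauto.
  - eexists; split; [constructor; eauto|]. eapply HC; eauto. constructor.
    inv Hv. eapply HCU; eauto. inv_intro.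
    eapply cong_der; [rewrite Sup; eauto using typing_shift | eapply Hsw; eauto | eapply Hsh; eauto].
  - eexists; split; [constructor|]. eapply R_tup; eauto. inv_intro.
    apply Forall2_map_indexed; [eapply Forall2_length; eauto|].
    intros k x y Hx Hy; simpl.
    match goal with F : Forall2 (has_type _) ss _, F' : Forall2 (R i) ss _ |- _ =>
      rename F into Fty, F' into FR end.
    destruct (Forall2_nth_error Fty Hx) as [B [HBk HxB]].
    destruct (Forall2_nth_error FR Hx) as [y' [Hy' Rxy]].
    replace y' with y in * by congruence.
    pose proof (typing_star eq_refl Fty Fty HBk) as Hst.
    eapply cong_der; eauto. eapply (R_under HR); eauto. eapply R_star; eauto.
  - eexists; split; [constructor; eauto|]. eapply R_tup; eauto.
    eapply Forall2_map2; eauto. intros x y Hxy. econstructor; eauto.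
  - eexists; split; [constructor; eauto|]. eapply HC; eauto. constructor.
    inv Hv. eapply HC; eauto. econstructor; eauto.
  - eexists; split; [constructor; eauto|]. eapply HC; eauto. constructor.
    inv Hv. eapply HC; eauto. econstructor; eauto.
  - eexists; split; [constructor; eauto|]. eapply HC; eauto. constructor.
    inv Hv. eapply HCU; eauto. inv_intro.
    eapply cong_int; [rewrite Sup; eauto using typing_shift | eapply Hsh; eauto | eapply Hsh; eauto
      | eapply Hsw; eauto].
  - inv_intro. pose proof (Forall2_length H2) as L2. pose proof (Forall2_length H3) as L3.
    assert (HF : Forall2 (cong i)
      (map (fun p => Int (fst (snd p)) (snd (snd p))
         (Proj (fst p) (subst_under (star (fst p) ts2 ts1) t))) (indexed (combine ts1 ts2)))
      (map (fun p => Int (fst (snd p)) (snd (snd p))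
         (Proj (fst p) (subst_under (star (fst p) ts' ts'0) t'))) (indexed (combine ts'0 ts')))).
    { apply Forall2_map_indexed; [rewrite 2!length_combine; lia|].
      intros k [a b] [a' b']; simpl. rewrite 2!nth_error_combine.
      destruct (nth_error ts1 k) as [x1|] eqn:E1; [|discriminate].
      destruct (nth_error ts2 k) as [x2|] eqn:E2; [|discriminate].
      destruct (Forall2_nth_error H3 E1) as [x1' [-> R1]].
      destruct (Forall2_nth_error H2 E2) as [x2' [-> R2]].
      intros [= <- <-] [= <- <-].
      destruct (Forall2_nth_error H11 E1) as [B [HBk B1]].
      destruct (Forall2_nth_error H7 E2) as [B' [HBk' B2]].
      assert (B' = B) by congruence; subst.
      pose proof (typing_star eq_refl H7 H11 HBk) as Hst.
      assert (Hsu : has_type (B :: src i) (subst_under (star k ts2 ts1) t) (dty T (TTup T0 Ts)))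
        by (eapply typing_subst_under; eauto).
      assert (Hpr : has_type (B :: src i) (Proj k (subst_under (star k ts2 ts1) t)) (dty T B)).
      { econstructor; [exact Hsu|]. rewrite nth_error_map_dty, HBk. reflexivity. }
      eapply cong_int; eauto. eapply HCU; [exact Hpr|]. constructor.
      eapply (R_under HR); eauto. eapply R_star; eauto. }
    rewrite H0 in HF.
    match type of HF with Forall2 _ _ ?m => destruct m as [|r' rs'] eqn:Em end; inv HF.
    eexists; split; [eapply head_int_between_tup; eauto; lia|].
    eapply R_osum; eauto.
  - inv_intro. eexists; split.
    { constructor. match goal with F : Forall2 (R i) ts1 _, F' : Forall2 (R i) ts2 _ |- _ =>
        apply Forall2_length in F, F' end. lia. }
    eapply R_tup; [constructor; eassumption|]. eapply Forall2_map_combine; eauto.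
    intros; simpl; constructor; auto.
  - eexists; split; [constructor|]. eapply HC; [exact Hv|]. inv_intro. constructor.
    eapply HCU; eauto. constructor; auto.
  - eexists; split; [constructor; eauto|]. eapply R_tup; eauto.
    eapply Forall2_map2; eauto. intros x y Hxy. econstructor; eauto.
  - eexists; split; [constructor; eauto|]. eapply HC; eauto. constructor.
    inv Hv. eapply HCU; eauto. constructor; auto. eapply Hsh; eauto.
  - inv_intro; discriminate.
  - inv_intro; discriminate.
  - inv_intro.
    repeat match goal with F : Forall2 (R i) (_ :: _) _ |- _ => inv F end.
    eexists; split.
    { apply head_mul_between_tup. repeat match goal with F : Forall2 (R i) _ _ |- _ =>
        apply Forall2_length in F end. lia. }
    eapply R_osum; eauto.
    + constructor; auto.
    + eapply Forall2_map_combine; eauto. intros; simpl; constructor; auto.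
Qed.

End Compatible.
End Head.

(** * Confluence *)

Section Reduction.
Variable Sg : sig.
Local Notation tm := (tm Sg).
Local Notation ty := (ty (base Sg)).
Local Notation ctx := (ctx Sg).
Implicit Types (G D : ctx) (t s u v w : tm) (T A B C : ty).

Definition ctx_self (G : ctx) : ctx := G.
Definition ctx_push A (G : ctx) : ctx := A :: G.

Lemma reds_refl G t : reds G t t.
Proof. apply rt_refl. Qed.

Lemma reds_trans G t u v : reds G t u -> reds G u v -> reds G t v.
Proof. apply rt_trans. Qed.

Lemma reds_step G t u : red G t u -> reds G t u.
Proof. apply rt_step. Qed.

Lemma reds_map G D (f : tm -> tm) t t' :
  (forall u u', red G u u' -> red D (f u) (f u')) -> reds G t t' -> reds D (f t) (f t').
Proof.
  intros H; induction 1; [apply reds_step; auto | apply reds_refl | eapply reds_trans; eauto].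
Qed.

Lemma reds_tup G ts ts' : Forall2 (reds G) ts ts' -> reds G (Tup ts) (Tup ts').
Proof.
  intros H. enough (Hl : forall l, reds G (Tup (l ++ ts)) (Tup (l ++ ts'))) by apply (Hl nil).
  induction H as [|t t' ts ts' Ht Hts IH]; intros l; [apply reds_refl|].
  eapply reds_trans.
  - apply (reds_map (G := G) (f := fun u => Tup (l ++ u :: ts))); [|exact Ht].
    intros; now apply red_in_tup.
  - specialize (IH (l ++ [t'])). rewrite <- 2!app_assoc in IH. exact IH.
Qed.

Lemma reds_lam G A t t' : reds (A :: G) t t' -> reds G (Lam A t) (Lam A t').
Proof. apply reds_map; intros; now constructor. Qed.

Lemma reds_app G t t' s s' : reds G t t' -> reds G s s' -> reds G (App t s) (App t' s').
Proof.
  intros H1 H2. eapply reds_trans.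
  - apply (reds_map (f := fun u => App u s)) with (2 := H1); intros; now constructor.
  - apply (reds_map (f := fun u => App t' u)) with (2 := H2); intros; now constructor.
Qed.

Lemma reds_proj G j t t' : reds G t t' -> reds G (Proj j t) (Proj j t').
Proof. apply reds_map; intros; now constructor. Qed.

Lemma reds_addop G o t t' s s' :
  reds G t t' -> reds G s s' -> reds G (AddOp o t s) (AddOp o t' s').
Proof.
  intros H1 H2. eapply reds_trans.
  - apply (reds_map (f := fun u => AddOp o u s)) with (2 := H1); intros; now constructor.
  - apply (reds_map (f := fun u => AddOp o t' u)) with (2 := H2); intros; now constructor.
Qed.

Lemma reds_mul G t t' s s' : reds G t t' -> reds G s s' -> reds G (Mul t s) (Mul t' s').
Proof.
  intros H1 H2. eapply reds_trans.
  - apply (reds_map (f := fun u => Mul u s)) with (2 := H1); intros; now constructor.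
  - apply (reds_map (f := fun u => Mul t' u)) with (2 := H2); intros; now constructor.
Qed.

Lemma reds_der G A t t' s s' : has_type G s A ->
  reds (A :: G) t t' -> reds G s s' -> reds G (Der t s) (Der t' s').
Proof.
  intros Hs H1 H2. eapply reds_trans.
  - apply (reds_map (f := fun u => Der u s)) with (2 := H1); intros; now apply red_in_der1 with A.
  - apply (reds_map (f := fun u => Der t' u)) with (2 := H2); intros; now constructor.
Qed.

Lemma reds_int G A a a' b b' t t' : has_type G a A ->
  reds G a a' -> reds G b b' -> reds (A :: G) t t' -> reds G (Int a b t) (Int a' b' t').
Proof.
  intros Hs H1 H2 H3. eapply reds_trans; [|eapply reds_trans].
  - apply (reds_map (f := fun u => Int a b u)) with (2 := H3); intros; now apply red_in_int3 with A.
  - apply (reds_map (f := fun u => Int u b t')) with (2 := H1); intros; now constructor.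
  - apply (reds_map (f := fun u => Int a' u t')) with (2 := H2); intros; now constructor.
Qed.

Lemma reds_inl G C t t' : reds G t t' -> reds G (Inl C t) (Inl C t').
Proof. apply reds_map; intros; now constructor. Qed.

Lemma reds_inr G C t t' : reds G t t' -> reds G (Inr C t) (Inr C t').
Proof. apply reds_map; intros; now constructor. Qed.

Lemma reds_fix G t t' : reds G t t' -> reds G (Fix t) (Fix t').
Proof. apply reds_map; intros; now constructor. Qed.

Lemma reds_case G A C t t' t1 t1' t2 t2' : has_type G t (TSum A C) ->
  reds G t t' -> reds (A :: G) t1 t1' -> reds (C :: G) t2 t2' ->
  reds G (Case t t1 t2) (Case t' t1' t2').
Proof.
  intros Ht H1 H2 H3. eapply reds_trans; [|eapply reds_trans].
  - apply (reds_map (f := fun u => Case t u t2)) with (2 := H2); intros; eapply red_in_case1; eauto.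
  - apply (reds_map (f := fun u => Case t t1' u)) with (2 := H3); intros; eapply red_in_case2; eauto.
  - apply (reds_map (f := fun u => Case u t1' t2')) with (2 := H1); intros; now constructor.
Qed.

Lemma cong_reds G t t' : cong ctx_self ctx_push (@reds Sg) G t t' -> reds G t t'.
Proof.
  unfold ctx_self, ctx_push; destruct 1.
  - apply reds_refl.
  - now apply reds_lam.
  - now apply reds_app.
  - now apply reds_tup.
  - now apply reds_proj.
  - now apply reds_addop.
  - now apply reds_mul.
  - now apply reds_der with A.
  - now apply reds_int with A.
  - now apply reds_inl.
  - now apply reds_inr.
  - now apply reds_case with A C.
  - now apply reds_fix.
Qed.

(* Substitution instances, only the free variables of the source being required to
   be replaced by terms of the right type. *)
Record sub_index : Type := SubIndex {
  si_src : ctx; si_tgt : ctx; si_fun : nat -> tm; si_dom : nat -> Prop;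
  si_typing : forall i A, si_dom i -> nth_error si_src i = Some A -> has_type si_tgt (si_fun i) A }.

Definition si_up A (x : sub_index) : sub_index.
Proof.
  refine (@SubIndex (A :: si_src x) (A :: si_tgt x) (ups (si_fun x)) (scons True (si_dom x)) _).
  intros [|i] B Hi E; simpl in *; [now constructor|].
  apply typing_shift. now apply (si_typing (s := x)).
Defined.

Definition si_rel (x : sub_index) t w : Prop :=
  w = subst (si_fun x) t /\ forall i, free i t -> si_dom x i.

Lemma si_rel_cong x t w T : has_type (si_src x) t T -> si_rel x t w ->
  (forall i, t <> Var i) -> cong si_src si_up si_rel x t w.
Proof.
  intros Ht [-> Hf] Hv. inv Ht; try (now exfalso; eapply Hv); simpl in *.
  all: try (econstructor; eauto; split; simpl; auto; intros [|i]; simpl; auto; fail).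
  - constructor. assert (Hf' : forall i, Exists (free i) ts -> si_dom x i).
    { intros i Hi; apply Hf, (free_tup i ts), Hi. }
    clear - Hf'. induction ts; simpl; constructor; auto.
    split; auto.
Qed.

Lemma si_compatible : compatible si_src si_tgt si_up si_rel.
Proof.
  split; try reflexivity.
  - intros x t w T Ht Hc; destruct Hc; repeat match goal with H : si_rel _ _ _ |- _ => destruct H end;
      simpl in *; subst; (split; [reflexivity || auto|]); simpl; try tauto.
    all: try (intros i; repeat match goal with H : forall i, _ -> _ |- _ => specialize (H i) end; tauto).
    all: try (intros i Hi; repeat match goal with H : _ \/ _ |- _ => destruct H end;
      auto; match goal with H : forall i, free i ?t -> _, H' : free (S _) ?t |- _ => exact (H _ H') end).
    + simpl. f_equal. clear Ht; induction H as [|? ? ? ? [-> _]]; simpl; f_equal; auto.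
    + intros i Hi. apply (free_tup i ts) in Hi. clear Ht.
      induction H as [|? ? ? ? [_ Ha]]; inv Hi; auto.
  - intros A x; split; [reflexivity|]. intros [|i]; simpl; [auto | discriminate].
  - intros x t w T Ht Hr Hi. eapply si_rel_cong; eauto. intros i ->; discriminate.
  - intros x t w T Ht [-> Hf]. eapply typing_subst; eauto. intros; apply si_typing; auto.
  - intros A x t w T _ [-> Hf]; split.
    + subst_eq.
    + intros i Hi. apply free_rename in Hi. destruct Hi as [j [Hj ->]]. simpl; auto.
  - intros A B x t w T _ [-> Hf]; split.
    + subst_eq.
    + intros i Hi. apply free_rename in Hi. destruct Hi as [j [Hj ->]].
      specialize (Hf _ Hj). destruct j as [|[|j]]; simpl in *; auto.
  - intros A x t w s s' T _ _ [-> Hf] [-> Hf']; split.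
    + subst_eq.
    + intros i Hi. apply free_subst in Hi. destruct Hi as [[|j] [Hj Hj']]; simpl in *; auto.
      specialize (Hf _ Hj); simpl in Hf. now subst.
  - intros A B x t w s s' T _ _ [-> Hf] [-> Hf']; split.
    + subst_eq.
    + intros i Hi. apply free_subst in Hi. destruct Hi as [[|j] [Hj Hj']]; simpl in *; auto.
      specialize (Hf _ Hj); simpl in Hf. now subst.
Qed.

(* Reduction inside all immediate subterms, followed by at most one head step; the
   head step may contract a redex created inside ("superdevelopment"). *)
Inductive par : ctx -> tm -> tm -> Prop :=
| par_var G i : par G (Var i) (Var i)
| par_cong G t u : cong ctx_self ctx_push par G t u -> par G t u
| par_head G t u v : cong ctx_self ctx_push par G t u -> head_step G u v -> par G t v.

Lemma par_typing G t v T : has_type G t T -> par G t v -> has_type G v T.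
Proof.
  enough (H : forall t G u T, has_type G t T -> cong ctx_self ctx_push par G t u -> has_type G u T).
  { intros Ht Hp; inv Hp; eauto using head_typing. }
  clear; intros t. induction t using tm_nested_ind; intros G u T0 Ht Hc.
  all: assert (Hpar : forall t G v T,
      (forall G u T, has_type G t T -> cong ctx_self ctx_push par G t u -> has_type G u T) ->
      has_type G t T -> par G t v -> has_type G v T)
      by (clear; intros t G v T H Ht Hp; inv Hp; eauto using head_typing).
  all: inv Hc; inv Ht; unfold ctx_self, ctx_push in *; uniq; try (econstructor; eauto; fail).
  constructor.
  match goal with F : Forall2 (has_type _) _ _, F' : Forall2 (par _) _ _ |- _ => revert F F' end.
  generalize (T :: Ts); intros L; revert L ts'.
  induction H; intros L ts' HL HF; inv HL; inv HF; constructor; eauto.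
Qed.

Lemma par_refl G t T : has_type G t T -> par G t t.
Proof.
  revert G T; induction t using tm_nested_ind; intros G T0 Ht; inv Ht.
  all: try (constructor; econstructor; unfold ctx_self, ctx_push; eauto; fail).
  apply par_cong. constructor. match goal with F : Forall2 (has_type _) _ _ |- _ => revert F end.
  generalize (T :: Ts).
  induction H; intros L HL; inv HL; constructor; eauto.
Qed.

(** The case of [head_cong] in which the relation is a substitution instance, all variables being in
    its domain. *)
Lemma head_subst G D f t v T : has_type G t T -> head_step G t v ->
  (forall i A, nth_error G i = Some A -> has_type D (f i) A) ->
  head_step D (subst f t) (subst f v).
Proof.
  intros Ht Hh Hf.
  pose (x := @SubIndex G D f (fun _ => True) (fun i A _ => Hf i A)).
  assert (Hr : si_rel x t (subst f t)) by (split; simpl; auto).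
  assert (Hv : forall i, t <> Var i) by (intros i ->; inv Hh).
  destruct (head_cong si_compatible (i := x) Ht Hh (si_rel_cong (x := x) Ht Hr Hv)) as [z [Hz [-> _]]].
  exact Hz.
Qed.

(** Renamings and substitutions by pairs of parallel reducts are treated together: [K] is any class
    of pairs of substitutions that is stable under binders. The instance for renamings is used to
    show this stability for the other one, where going below a binder shifts. *)
Lemma par_subst_gen (K : ctx -> ctx -> (nat -> tm) -> (nat -> tm) -> Prop)
    (K_up : forall A G D f f', K G D f f' -> K (A :: G) (A :: D) (ups f) (ups f'))
    (K_par : forall G D f f' i A, K G D f f' -> nth_error G i = Some A ->
       has_type D (f i) A /\ par D (f i) (f' i)) :
  forall t G D f f' v T, K G D f f' -> has_type G t T -> par G t v ->
  par D (subst f t) (subst f' v).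
Proof.
  assert (Hhead : forall G D f f' t u v T, K G D f f' -> has_type G u T -> head_step G u v ->
    cong ctx_self ctx_push par D (subst f t) (subst f' u) -> par D (subst f t) (subst f' v)).
  { intros G D f f' t u v T HK Hu Hh Hc. eapply par_head; [exact Hc|].
    eapply head_subst; eauto. intros i A Hi. destruct (K_par _ _ _ _ _ _ HK Hi). eapply par_typing; eauto. }
  assert (Hpar : forall G D f f' t v T, K G D f f' -> has_type G t T -> par G t v ->
    (forall u, cong ctx_self ctx_push par G t u ->
       cong ctx_self ctx_push par D (subst f t) (subst f' u)) -> par D (subst f t) (subst f' v)).
  { intros G D f f' t v T HK Ht Hp Hc. inv Hp.
    - simpl. inv Ht. eapply K_par; eauto.
    - apply par_cong; auto.
    - apply (Hhead G D f f' t u v T); auto. eapply par_typing; [eauto|]. now apply par_cong. }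
  induction t using tm_nested_ind; intros G D f f' v T0 HK Ht Hp;
    (eapply Hpar; eauto); intros u Hc; inv Hc; inv Ht; unfold ctx_self, ctx_push in *; uniq; simpl.
  all: try (econstructor; unfold ctx_self, ctx_push; eauto; fail).
  - constructor. clear Hp.
    match goal with F : Forall2 (has_type _) _ _, F' : Forall2 (par _) _ _ |- _ => revert F F' end.
    generalize (T :: Ts); intros L; revert L ts'; induction H; intros L ts' HL HF; inv HL; inv HF; simpl; constructor; eauto.
  - econstructor; unfold ctx_self, ctx_push; eauto. eapply typing_subst; eauto.
    intros; eapply K_par; eauto.
  - econstructor; unfold ctx_self, ctx_push; eauto. eapply typing_subst; eauto.
    intros; eapply K_par; eauto.
  - econstructor; unfold ctx_self, ctx_push; eauto. eapply typing_subst; eauto.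
    intros; eapply K_par; eauto.
Qed.

Lemma par_rename G D r t v T : has_type G t T -> par G t v ->
  (forall i A, nth_error G i = Some A -> nth_error D (r i) = Some A) ->
  par D (rename r t) (rename r v).
Proof.
  intros Ht Hp Hr. rewrite 2!rename_subst_var.
  apply (@par_subst_gen (fun G D f f' => forall i A, nth_error G i = Some A ->
    exists j, f i = Var j /\ f' i = Var j /\ nth_error D j = Some A)) with (G := G) (T := T); auto.
  - clear. intros A G D f f' H [|i] B E; simpl in *.
    + eauto.
    + destruct (H i B E) as [j [-> [-> Hj]]]. exists (S j); auto.
  - clear. intros G D f f' i A H E. destruct (H i A E) as [j [-> [-> Hj]]].
    split; constructor; auto.
  - intros i A E; eauto.
Qed.

Lemma par_subst G D f f' t v T : has_type G t T -> par G t v ->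
  (forall i A, nth_error G i = Some A -> has_type D (f i) A /\ par D (f i) (f' i)) ->
  par D (subst f t) (subst f' v).
Proof.
  intros Ht Hp Hf.
  apply (@par_subst_gen (fun G D f f' => forall i A, nth_error G i = Some A ->
    has_type D (f i) A /\ par D (f i) (f' i))) with (G := G) (T := T); auto.
  clear. intros A G D f f' H [|i] B E; simpl in *.
  - split; now constructor.
  - destruct (H i B E) as [H1 H2]. split; [now apply typing_shift|].
    eapply par_rename; eauto.
Qed.

Lemma par_compatible : compatible ctx_self ctx_self ctx_push par.
Proof.
  split; unfold ctx_self, ctx_push; try reflexivity.
  - intros; now apply par_cong.
  - intros; constructor.
  - intros G t w T Ht Hp Hi. inv Hp; [discriminate | assumption |].
    exfalso. destruct H; try discriminate; inv H0.
  - intros; eapply par_typing; eauto.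
  - intros; eapply par_rename; eauto.
  - intros A B G t w T Ht Hp. eapply par_rename; eauto. intros [|[|i]]; auto.
  - intros A G t w s s' T Ht Hs Hp Hps. eapply par_subst; eauto.
    intros [|i] B E; simpl in *; [|split; now constructor].
    injection E as <-; auto.
  - intros A B G t w s s' T Ht Hs Hp Hps. eapply par_subst; eauto.
    intros [|i] C E; simpl in *; [|split; now constructor].
    injection E as <-; auto.
Qed.

Lemma Forall_diamond (P : tm -> tm -> Prop) (Q : tm -> Prop) ts :
  Forall (fun t => Q t -> forall v1 v2, P t v1 -> P t v2 -> exists w, P v1 w /\ P v2 w) ts ->
  Forall Q ts -> forall vs1 vs2, Forall2 P ts vs1 -> Forall2 P ts vs2 ->
  exists ws, Forall2 P vs1 ws /\ Forall2 P vs2 ws.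
Proof.
  induction 1 as [|t ts H _ IH]; intros HQ vs1 vs2 H1 H2; inv HQ; inv H1; inv H2; eauto.
  destruct (H H4 _ _ H6 H3) as [w [Hw1 Hw2]]. destruct (IH H5 _ _ H8 H9) as [ws [Hws1 Hws2]].
  eauto.
Qed.

Lemma par_inv G t v : par G t v ->
  (t = v /\ exists i, t = Var i) \/
  exists u, cong ctx_self ctx_push par G t u /\ (v = u \/ head_step G u v).
Proof. intros H; inv H; eauto. Qed.

(** The diamond is closed in the immediate subterms. A root contraction on one side is then carried
    to the common term by [head_cong]; if both sides contract, the two carried steps start from the
    same term and agree because root contraction is deterministic. *)
Lemma par_diamond t G v1 v2 T : has_type G t T -> par G t v1 -> par G t v2 ->
  exists w, par G v1 w /\ par G v2 w.
Proof.
  assert (Hd : forall G t T, has_type G t T ->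
    (forall u1 u2, cong ctx_self ctx_push par G t u1 -> cong ctx_self ctx_push par G t u2 ->
       exists w, cong ctx_self ctx_push par G u1 w /\ cong ctx_self ctx_push par G u2 w) ->
    forall v1 v2, par G t v1 -> par G t v2 -> exists w, par G v1 w /\ par G v2 w).
  { clear; intros G t T Ht Hc v1 v2 H1 H2.
    assert (Hu : forall u, cong ctx_self ctx_push par G t u -> has_type G u T)
      by (intros u Hu; eapply par_typing; eauto; now apply par_cong).
    destruct (par_inv H1) as [[<- [i E]] | [u1 [C1 H1']]];
      [subst; exists v2; split; [assumption | eapply par_refl; eauto using par_typing]|].
    destruct (par_inv H2) as [[<- [i E]] | [u2 [C2 H2']]]; [subst; inv C1|].
    destruct (Hc _ _ C1 C2) as [w [Hw1 Hw2]].
    destruct H1' as [-> | H1'], H2' as [-> | H2'].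
    - exists w; split; now apply par_cong.
    - destruct (head_cong par_compatible (i := G) (Hu _ C2) H2' Hw2) as [z [Hz1 Hz2]].
      exists z; split; [eapply par_head; eauto | assumption].
    - destruct (head_cong par_compatible (i := G) (Hu _ C1) H1' Hw1) as [z [Hz1 Hz2]].
      exists z; split; [assumption | eapply par_head; eauto].
    - destruct (head_cong par_compatible (i := G) (Hu _ C1) H1' Hw1) as [z [Hz1 Hz2]].
      destruct (head_cong par_compatible (i := G) (Hu _ C2) H2' Hw2) as [z' [Hz1' Hz2']].
      pose proof (head_deterministic Hz1 Hz1'); subst. eauto. }
  revert G v1 v2 T; induction t using tm_nested_ind; intros G v1 v2 T0 Ht;
    (eapply Hd; eauto); intros u1 u2 H1 H2; inv H1; inv H2; inv Ht; unfold ctx_self, ctx_push in *; uniq.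
  all: repeat match goal with
    | IH : forall G v1 v2 T, has_type G ?t T -> par G ?t v1 -> par G ?t v2 -> exists w, par G v1 w /\ par G v2 w,
      H : has_type ?G ?t ?T, H1 : par ?G ?t ?v1, H2 : par ?G ?t ?v2 |- _ =>
      let w := fresh "w" in let Hw1 := fresh "Hw" in let Hw2 := fresh "Hw" in
      destruct (IH _ _ _ _ H H1 H2) as [w [Hw1 Hw2]]; clear IH
    end.
  all: try (eexists; split; econstructor; unfold ctx_self, ctx_push; eauto using par_typing; fail).
  match goal with F1 : Forall2 (par G) ts ?a, F2 : Forall2 (par G) ts ?b |- _ =>
    destruct (@Forall_diamond (par G) (fun t => exists T, has_type G t T) ts) with (3 := F1) (4 := F2)
      as [ws [W1 W2]] end.
  - eapply Forall_impl; [|exact H]. intros t IH [T' Ht] x1 x2; eauto.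
  - match goal with F : Forall2 (has_type G) ts _ |- _ =>
      clear - F; revert F; generalize (T :: Ts); induction ts; intros L F; inv F; constructor; eauto end.
  - exists (Tup ws); split; now constructor.
Qed.

Lemma Forall2_par_refl G ts Ts : Forall2 (has_type G) ts Ts -> Forall2 (par G) ts ts.
Proof. induction 1; constructor; eauto using par_refl. Qed.

Lemma cong_refl G t T : has_type G t T -> (forall i, t <> Var i) -> cong ctx_self ctx_push par G t t.
Proof.
  intros Ht Hv. pose proof (par_refl Ht) as Hp. inv Ht; try (now exfalso; eapply Hv).
  all: try (econstructor; unfold ctx_self, ctx_push; eauto using par_refl; fail).
  constructor. eapply Forall2_par_refl; eauto.
Qed.

Lemma red_par G t t' T : has_type G t T -> red G t t' -> par G t t'.
Proof.
  intros Ht Hr; revert T Ht; induction Hr; intros T0 Ht.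
  all: try (eapply par_head; [eapply cong_refl; [eassumption | discriminate] | econstructor; eauto]; fail).
  all: apply par_cong; inv Ht; uniq.
  all: try (econstructor; unfold ctx_self, ctx_push; eauto using par_refl; fail).
  constructor. match goal with F : Forall2 _ _ _ |- _ => revert F end.
  generalize (T :: Ts); induction l; intros L F; inv F; constructor; eauto using par_refl.
  eapply Forall2_par_refl; eauto.
Qed.

Lemma red_typing G t t' T : has_type G t T -> red G t t' -> has_type G t' T.
Proof. intros Ht Hr; eapply par_typing, red_par; eauto. Qed.

Lemma reds_typing G t t' T : has_type G t T -> reds G t t' -> has_type G t' T.
Proof. intros Ht Hr; revert Ht; induction Hr; eauto using red_typing. Qed.

(** * Simulation of reduction across a compatible relation *)

Section Simulation.
Variables (I : Type) (src tgt : I -> ctx) (up : ty -> I -> I) (R : I -> tm -> tm -> Prop).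
Hypothesis HR : compatible src tgt up R.
(** Either the relation acts inside the subterms, or it replaces the term as a whole and is
    indifferent to the steps of the replaced term; the other side then does not move. *)
Hypothesis R_or : forall i t w T, has_type (src i) t T -> R i t w ->
  cong src up R i t w \/ (forall v, par (src i) t v -> R i v w).

Lemma Forall_simulation i (Q : tm -> Prop) ts :
  Forall (fun t => Q t -> forall v w, par (src i) t v -> R i t w ->
    exists z, reds (tgt i) w z /\ R i v z) ts -> Forall Q ts ->
  forall vs ws, Forall2 (par (src i)) ts vs -> Forall2 (R i) ts ws ->
  exists zs, Forall2 (reds (tgt i)) ws zs /\ Forall2 (R i) vs zs.
Proof.
  induction 1 as [|t ts H _ IH]; intros HQ vs ws H1 H2; inv HQ; inv H1; inv H2; eauto.
  destruct (H H4 _ _ H6 H3) as [w [Hw1 Hw2]]. destruct (IH H5 _ _ H8 H9) as [zs [Hws1 Hws2]].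
  eauto.
Qed.

(** Parallel steps fit the induction on the term: the inner part is simulated in the subterms, and
    the final root contraction, if there is one, is replayed by [head_cong]. *)
Lemma par_simulation t i v w T : has_type (src i) t T -> par (src i) t v -> R i t w ->
  exists z, reds (tgt i) w z /\ R i v z.
Proof.
  assert (Hd : forall i t T, has_type (src i) t T ->
    (forall u w, cong ctx_self ctx_push par (src i) t u -> cong src up R i t w ->
       exists z, reds (tgt i) w z /\ cong src up R i u z) ->
    forall v w, par (src i) t v -> R i t w -> exists z, reds (tgt i) w z /\ R i v z).
  { clear - HR R_or; intros i t T Ht Hc v w H1 H2.
    destruct (R_or Ht H2) as [H2' | H2']; [|exists w; split; [apply reds_refl | auto]].
    destruct (par_inv H1) as [[<- [k ->]] | [u [C1 H1']]]; [inv H2'|].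
    destruct (Hc _ _ C1 H2') as [z [Hz1 Hz2]].
    assert (Hu : has_type (src i) u T) by (eapply par_typing; [eauto | now apply par_cong]).
    destruct H1' as [-> | H1'].
    - exists z; split; auto. eapply (R_cong HR); eauto.
    - destruct (head_cong HR Hu H1' Hz2) as [z' [Hz1' Hz2']].
      exists z'; split; auto. eapply reds_trans; [eauto|]. now apply reds_step, head_red. }
  revert i v w T; induction t using tm_nested_ind; intros k v w T0 Ht;
    (eapply Hd; eauto); intros u w' H1 H2; inv H1; inv H2; inv Ht; unfold ctx_self, ctx_push in *; uniq;
  repeat rewrite <- (src_up HR) in *.
  all: repeat match goal with
    | IH : forall i v w T, has_type (src i) ?t T -> par (src i) ?t v -> R i ?t w ->
        exists z, reds (tgt i) w z /\ R i v z,
      H : has_type (src ?i) ?t ?T, H1 : par (src ?i) ?t ?v1, H2 : R ?i ?t ?v2 |- _ =>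
      let w := fresh "w" in let Hw1 := fresh "Hw" in let Hw2 := fresh "Hw" in
      destruct (IH _ _ _ _ H H1 H2) as [w [Hw1 Hw2]]; clear IH
    end.
  all: rewrite ?(src_up HR), ?(tgt_up HR) in *; pose proof (R_typing HR) as R_ty.
  all: try (eexists; split; [apply cong_reds; econstructor; unfold ctx_self, ctx_push |
    econstructor]; eauto using par_typing; fail).
  match goal with F1 : Forall2 (par _) ts ?a, F2 : Forall2 (R _) ts ?b |- _ =>
    destruct (@Forall_simulation k (fun t => exists T, has_type (src k) t T) ts) with (3 := F1) (4 := F2)
      as [zs [W1 W2]] end.
  - eapply Forall_impl; [|exact H]. intros t IH [T' Ht] x1 x2; eauto.
  - match goal with F : Forall2 (has_type _) ts _ |- _ =>
      clear - F; revert F; generalize (T :: Ts); induction ts; intros L F; inv F; constructor; eauto end.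
  - exists (Tup zs); split; [now apply reds_tup | now constructor].
Qed.

Lemma reds_simulation i t v w T : has_type (src i) t T -> reds (src i) t v -> R i t w ->
  exists z, reds (tgt i) w z /\ R i v z.
Proof.
  intros Ht Hr; apply clos_rt_rt1n in Hr. revert w Ht; induction Hr as [|t u v Hr _ IH]; intros w Ht Hw.
  - exists w; split; [apply reds_refl | assumption].
  - destruct (par_simulation Ht (red_par Ht Hr) Hw) as [z [Hz Hz']].
    destruct (IH z) as [z' [Hz1 Hz2]]; eauto using red_typing.
    exists z'; split; auto. eapply reds_trans; eauto.
Qed.
End Simulation.

Lemma par_reds G t v T : has_type G t T -> par G t v -> reds G t v.
Proof.
  assert (Hd : forall G t T, has_type G t T ->
    (forall u, cong ctx_self ctx_push par G t u -> reds G t u) ->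
    forall v, par G t v -> reds G t v).
  { clear; intros G t T Ht Hc v H1.
    destruct (par_inv H1) as [[<- _] | [u [C1 H1']]]; [apply reds_refl|].
    destruct H1' as [-> | H1']; auto.
    eapply reds_trans; [eauto|]. now apply reds_step, head_red. }
  revert G v T; induction t using tm_nested_ind; intros G v T0 Ht;
    (eapply Hd; eauto); intros u H1; inv H1; inv Ht; unfold ctx_self, ctx_push in *; uniq.
  all: apply cong_reds.
  all: try (econstructor; unfold ctx_self, ctx_push; eauto; fail).
  constructor. match goal with F1 : Forall2 (par _) ts ?a, F2 : Forall2 (has_type _) ts _ |- _ =>
    revert F1 F2 end.
  generalize (T :: Ts); intros L; revert ts' L.
  induction H; intros ts' L F1 F2; inv F1; inv F2; constructor; eauto.
Qed.

Lemma par_strip G t u v T : has_type G t T -> par G t u -> reds G t v ->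
  exists w, reds G u w /\ par G v w.
Proof.
  intros Ht Hp Hr; apply clos_rt_rt1n in Hr. revert u Ht Hp; induction Hr as [|t t' v Hr _ IH]; intros u Ht Hp.
  - exists u; split; [apply reds_refl | assumption].
  - destruct (par_diamond Ht (red_par Ht Hr) Hp) as [w [W1 W2]].
    destruct (IH w) as [z [Z1 Z2]]; eauto using red_typing.
    exists z; split; auto. eapply reds_trans; [|eauto]. eapply par_reds; eauto using par_typing.
Qed.

Lemma confluence G t u v T : has_type G t T -> reds G t u -> reds G t v ->
  exists w, reds G u w /\ reds G v w.
Proof.
  intros Ht Hr; apply clos_rt_rt1n in Hr. revert v Ht; induction Hr as [|t t' u Hr _ IH]; intros v Ht Hv.
  - exists v; split; [assumption | apply reds_refl].
  - destruct (par_strip Ht (red_par Ht Hr) Hv) as [w [W1 W2]].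
    destruct (IH w) as [z [Z1 Z2]]; eauto using red_typing.
    exists z; split; auto. eapply reds_trans; [|eauto]. eapply par_reds; eauto using reds_typing.
Qed.

(** A variable is its own only parallel reduct, which settles the case where the substitution
    replaces the whole term. *)
Lemma si_rel_or x t w T : has_type (si_src x) t T -> si_rel x t w ->
  cong si_src si_up si_rel x t w \/ (forall v, par (si_src x) t v -> si_rel x v w).
Proof.
  intros Ht Hr.
  assert (H : (exists i, t = Var i) \/ (forall i, t <> Var i)).
  { destruct t; try (right; discriminate). left; eauto. }
  destruct H as [[i ->] | H].
  - right. intros v Hv. inv Hv; [assumption | |]; inv H.
  - left. eapply si_rel_cong; eauto.
Qed.

(** Simulation with the free variables of [t] as the domain of the substitution. The domain is kept
    along the reduction, which therefore creates no free variables. *)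
Lemma reds_subst_free G D f t v T : has_type G t T -> reds G t v ->
  (forall i A, free i t -> nth_error G i = Some A -> has_type D (f i) A) ->
  reds D (subst f t) (subst f v) /\ (forall i, free i v -> free i t).
Proof.
  intros Ht Hr Hf.
  pose (x := @SubIndex G D f (fun i => free i t) Hf).
  destruct (reds_simulation si_compatible si_rel_or (i := x) Ht Hr (w := subst f t)) as [z [Z1 [-> Z2]]].
  - split; auto.
  - auto.
Qed.

Lemma reds_subst G D f t v T : has_type G t T -> reds G t v ->
  (forall i A, nth_error G i = Some A -> has_type D (f i) A) ->
  reds D (subst f t) (subst f v).
Proof. intros Ht Hr Hf. eapply reds_subst_free; eauto. Qed.

Lemma reds_rename G D r t v T : has_type G t T -> reds G t v ->
  (forall i A, nth_error G i = Some A -> nth_error D (r i) = Some A) ->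
  reds D (rename r t) (rename r v).
Proof.
  intros Ht Hr Hf. rewrite 2!rename_subst_var. eapply reds_subst; eauto.
  intros i A E; constructor; auto.
Qed.

End Reduction.

(** * Normalization of Fix-free terms *)

Section Normalization.
Variable Sg : sig.
Local Notation tm := (tm Sg).
Local Notation ty := (ty (base Sg)).
Local Notation ctx := (ctx Sg).
Implicit Types (G D : ctx) (t s u v w n : tm) (T A B C : ty).

Fixpoint fixfree (t : tm) : Prop :=
  match t with
  | Cst _ | Var _ => True
  | Lam _ t | Proj _ t | Inl _ t | Inr _ t => fixfree t
  | App t s | AddOp _ t s | Mul t s | Der t s => fixfree t /\ fixfree s
  | Tup ts => fold_right (fun t P => fixfree t /\ P) True ts
  | Int a b t | Case a b t => fixfree a /\ fixfree b /\ fixfree t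
  | Fix _ => False
  end.

Lemma fixfree_tup (ts : list tm) : fixfree (Tup ts) <-> Forall fixfree ts.
Proof.
  simpl; induction ts; simpl.
  - split; auto.
  - rewrite IHts; split; [intros []; auto | inversion 1; auto].
Qed.

Lemma fixfree_subst (f : nat -> tm) t : fixfree t -> (forall i, fixfree (f i)) -> fixfree (subst f t).
Proof.
  assert (Hren : forall t r, fixfree t -> fixfree (rename r t)).
  { clear; intros t; induction t using tm_nested_ind; intros r Ht; simpl in *; intuition.
    rewrite Forall_forall in H. induction ts; simpl in *; intuition. }
  revert f; induction t using tm_nested_ind; intros f Ht Hf.
  5: { apply fixfree_tup in Ht. apply (fixfree_tup (map (subst f) ts)).
       rewrite Forall_forall in *. intros u Hu. apply in_map_iff in Hu. destruct Hu as [t [<- Hin]]; auto. }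
  all: simpl in *; auto.
  all: assert (Hup : forall i, fixfree (ups f i)) by (intros [|j]; simpl; auto; apply Hren; auto).
  all: intuition.
Qed.

Lemma fixfree_rename r t : fixfree t -> fixfree (rename r t).
Proof. intros H; rewrite rename_subst_var; apply fixfree_subst; simpl; auto. Qed.

Definition irr G n : Prop := forall n', ~ red G n n'.

Definition renok (r : nat -> nat) G G' : Prop :=
  forall i A, nth_error G i = Some A -> nth_error G' (r i) = Some A.

(** The rules depend on the context through their typing side conditions, so irreducibility in one
    context need not pass to a larger one. Asking for it in all renamed contexts makes stability
    immediate. *)
Definition sirr G n : Prop := forall G' r, renok r G G' -> irr G' (rename r n).

Definition neutral G n : Prop := intro n = false /\ sirr G n.

Lemma renok_up r G G' A : renok r G G' -> renok (upr r) (A :: G) (A :: G').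
Proof. intros H [|i] B; simpl; auto. Qed.

Lemma renok_id G : renok (fun i => i) G G.
Proof. intros i A; auto. Qed.

Lemma renok_S G A : renok S G (A :: G).
Proof. intros i B; auto. Qed.

Lemma sirr_irr G n : sirr G n -> irr G n.
Proof.
  intros H. specialize (H G (fun i => i) (renok_id (G := G))).
  now rewrite rename_subst_var, subst_var in H.
Qed.

Lemma sirr_rename G G' r n : renok r G G' -> sirr G n -> sirr G' (rename r n).
Proof.
  intros Hr Hn G'' r' Hr'. rewrite rename_rename. apply Hn. intros i A E; auto.
Qed.

Lemma intro_rename r t : intro (rename r t) = intro t.
Proof. now destruct t. Qed.

Lemma neutral_rename G G' r n : renok r G G' -> neutral G n -> neutral G' (rename r n).
Proof.
  intros Hr [H1 H2]; split; [now rewrite intro_rename | eapply sirr_rename; eauto].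
Qed.

Lemma typing_renok r G G' t T : renok r G G' -> has_type G t T -> has_type G' (rename r t) T.
Proof. intros Hr Ht; eapply typing_rename; eauto. Qed.

Ltac irr_step :=
  let G' := fresh "G'" in let r := fresh "r" in let Hr := fresh "Hr" in
  let u := fresh "u" in let Hu := fresh "Hu" in
  intros G' r Hr u Hu; simpl in Hu; inversion Hu; subst;
  try match goal with H : _ = rename _ ?n |- _ =>
      destruct n; simpl in H; discriminate || (simpl in *; congruence)
    | H : rename _ ?n = _ |- _ => destruct n; simpl in H; discriminate || (simpl in *; congruence) end;
  try match goal with H : sirr ?G ?n, H' : red ?G' (rename ?r ?n) _ |- _ =>
    exact (H _ _ Hr _ H') end.

Lemma sirr_cst G a (c : cst a) : sirr G (Cst c).
Proof. irr_step. Qed.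

Lemma sirr_var G i : sirr G (Var i).
Proof. irr_step. Qed.

Lemma sirr_lam G A t : sirr (A :: G) t -> sirr G (Lam A t).
Proof. intros H; irr_step. eapply H; [|eassumption]. now apply renok_up. Qed.

Lemma sirr_inl G A t : sirr G t -> sirr G (Inl A t).
Proof. intros H; irr_step. Qed.

Lemma sirr_inr G A t : sirr G t -> sirr G (Inr A t).
Proof. intros H; irr_step. Qed.

Lemma sirr_tup G ts : Forall (sirr G) ts -> sirr G (Tup ts).
Proof.
  intros H; irr_step.
  assert (Hin : In t (map (rename r) ts)).
  { match goal with E : _ = map _ ts |- _ => rewrite <- E end. apply in_or_app; simpl; auto. }
  apply in_map_iff in Hin. destruct Hin as [t0 [<- Hin]].
  rewrite Forall_forall in H. eapply H; eauto.
Qed.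

Lemma sirr_app G n s : neutral G n -> sirr G s -> sirr G (App n s).
Proof. intros [Hi Hn] Hs; irr_step. Qed.

Lemma sirr_proj G j n : neutral G n -> sirr G (Proj j n).
Proof. intros [Hi Hn]; irr_step. Qed.

Lemma sirr_addop G o n s : sirr G n -> sirr G s -> intro n = false \/ intro s = false ->
  sirr G (AddOp o n s).
Proof.
  intros Hn Hs Hi; irr_step.
  all: destruct Hi; [destruct n | destruct s]; discriminate.
Qed.

Lemma sirr_case G n t1 t2 A C : has_type G n (TSum A C) ->
  neutral G n -> sirr (A :: G) t1 -> sirr (C :: G) t2 -> sirr G (Case n t1 t2).
Proof.
  intros Ht [Hi Hn] H1 H2; irr_step.
  all: pose proof (typing_renok Hr Ht); uniq.
  - eapply H1; [|eassumption]. now apply renok_up.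
  - eapply H2; [|eassumption]. now apply renok_up.
Qed.

(** A product is a root redex only if its left factor is a constructor and its right factor is of
    base type or a tuple. A non-constructor of tuple type on the right is neither. *)
Lemma sirr_mul G n s : sirr G n -> sirr G s ->
  intro n = false \/ (intro s = false /\ exists A As, has_type G s (TTup A As)) -> sirr G (Mul n s).
Proof.
  intros Hn Hs Hi; irr_step.
  all: destruct Hi as [Hi | [Hi [B0 [Bs Ht]]]]; [destruct n; discriminate|].
  all: try (destruct s; discriminate).
  all: pose proof (typing_renok Hr Ht).
  all: match goal with H : is_base _ _, H' : has_type _ _ _ |- _ =>
    destruct (is_base_inv H H'); discriminate end.
Qed.

(** At a point that is no tuple only the rules with a point of base type could apply, and these
    inspect the body; a tuple type of the point blocks them. *)
Lemma sirr_der G A n s : has_type G s A -> sirr (A :: G) n -> sirr G s ->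
  intro s = false -> intro n = false \/ (exists A0 As, A = TTup A0 As) -> sirr G (Der n s).
Proof.
  intros Ht Hn Hs Hi Hi'; irr_step.
  all: try (destruct s; discriminate).
  all: pose proof (typing_renok Hr Ht) as Ht'.
  all: try (uniq; eapply Hn; [|eassumption]; now apply renok_up).
  all: destruct Hi' as [Hi' | [B0 [Bs ->]]]; [destruct n; discriminate|].
  all: match goal with H : is_base _ _ |- _ =>
    destruct (is_base_inv H Ht'); discriminate end.
Qed.

Lemma sirr_int G A a b n : has_type G a A -> sirr (A :: G) n -> sirr G a -> sirr G b ->
  intro a = false \/ intro b = false ->
  intro n = false \/ (exists A0 As, A = TTup A0 As) -> sirr G (Int a b n).
Proof.
  intros Ht Hn Ha Hb Hi Hi'; irr_step.
  all: try (destruct Hi; [destruct a | destruct b]; discriminate).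
  all: pose proof (typing_renok Hr Ht) as Ht'.
  all: try (uniq; eapply Hn; [|eassumption]; now apply renok_up).
  all: destruct Hi' as [Hi' | [B0 [Bs ->]]]; [destruct n; discriminate|].
  all: match goal with H : is_base ?G ?x, Ht : has_type ?G ?x (TTup _ _) |- _ =>
    destruct (is_base_inv H Ht); discriminate end.
Qed.

(** * Reducibility *)

(** A Kripke-style reducibility predicate by recursion on the type, with contexts as worlds and
    renamings as passages between them. One good reduct is asked for, not the termination of every
    reduction. A neutral reduct is accepted at every type, which makes variables reducible. The list
    of predicates in the tuple case keeps the recursion structural. *)
Fixpoint RED (T : ty) (G : ctx) (t : tm) {struct T} : Prop :=
  has_type G t T /\ exists n, reds G t n /\
    (neutral G n \/
     match T with
     | TBase _ => False
     | TTup A As => exists ts, n = Tup ts /\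
         Forall2 (fun (P : tm -> Prop) u => P u) (RED A G :: map (fun A => RED A G) As) ts
     | TArr A C => exists b, n = Lam A b /\
         forall G' r s, renok r G G' -> RED A G' s ->
           RED C G' (subst (scons s (fun i => Var (r i))) b)
     | TSum A C => (exists u, n = Inl C u /\ RED A G u) \/ (exists u, n = Inr A u /\ RED C G u)
     end).

Lemma RED_typing T G t : RED T G t -> has_type G t T.
Proof. destruct T; simpl; tauto. Qed.

Lemma RED_neutral T G t n : has_type G t T -> reds G t n -> neutral G n -> RED T G t.
Proof. destruct T; simpl; intros; split; eauto. Qed.

Lemma RED_back T G t t' : has_type G t T -> reds G t t' -> RED T G t' -> RED T G t.
Proof.
  intros Ht Hr H; destruct T; simpl in *; destruct H as [_ [n [Hn H]]];
    (split; [assumption | exists n; split; [eapply reds_trans; eauto | assumption]]).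
Qed.

Lemma Forall2_RED A As G ts :
  Forall2 (fun (P : tm -> Prop) u => P u) (RED A G :: map (fun A => RED A G) As) ts <->
  Forall2 (fun A u => RED A G u) (A :: As) ts.
Proof.
  change (RED A G :: map (fun A => RED A G) As) with (map (fun A => RED A G) (A :: As)).
  generalize (A :: As); clear; intros L; revert ts; induction L; intros ts; simpl.
  - split; intros H; inv H; constructor.
  - split; intros H; inv H; constructor; auto; now apply IHL.
Qed.

Lemma RED_tup_inv A As G t : RED (TTup A As) G t ->
  exists n, reds G t n /\ has_type G n (TTup A As) /\
    (neutral G n \/ exists ts, n = Tup ts /\ Forall2 (fun A u => RED A G u) (A :: As) ts).
Proof.
  intros [Ht [n [Hn H]]]. exists n; split; [assumption|].
  split; [eapply reds_typing; eauto|].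
  destruct H as [H | [ts [-> H]]]; auto. right; exists ts; split; auto. now apply Forall2_RED.
Qed.

Lemma RED_arr_inv A C G t : RED (TArr A C) G t ->
  exists n, reds G t n /\ has_type G n (TArr A C) /\
    (neutral G n \/ exists b, n = Lam A b /\
       forall G' r s, renok r G G' -> RED A G' s -> RED C G' (subst (scons s (fun i => Var (r i))) b)).
Proof.
  intros [Ht [n [Hn H]]]. exists n; split; [assumption|].
  split; [eapply reds_typing; eauto | assumption].
Qed.

Lemma Forall2_flip' (X Y : Type) (R : X -> Y -> Prop) l l' :
  Forall2 R l l' -> Forall2 (fun y x => R x y) l' l.
Proof. induction 1; constructor; auto. Qed.

Lemma RED_tup A As G ts : Forall2 (fun A u => RED A G u) (A :: As) ts -> RED (TTup A As) G (Tup ts).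
Proof.
  intros H; split.
  - constructor. apply Forall2_flip' in H. eapply Forall2_impl; [|exact H].
    simpl; intros; now apply RED_typing.
  - exists (Tup ts); split; [apply reds_refl|]. right. exists ts; split; auto. now apply Forall2_RED.
Qed.

Lemma RED_lam A C G b : has_type (A :: G) b C ->
  (forall G' r s, renok r G G' -> RED A G' s -> RED C G' (subst (scons s (fun i => Var (r i))) b)) ->
  RED (TArr A C) G (Lam A b).
Proof.
  intros Hb H; split; [now constructor|].
  exists (Lam A b); split; [apply reds_refl|]; eauto.
Qed.

Lemma RED_inl A C G u : RED A G u -> RED (TSum A C) G (Inl C u).
Proof.
  intros H; split; [constructor; now apply RED_typing|].
  exists (Inl C u); split; [apply reds_refl|]; eauto.
Qed.

Lemma RED_inr A C G u : RED C G u -> RED (TSum A C) G (Inr A u).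
Proof.
  intros H; split; [constructor; now apply RED_typing|].
  exists (Inr A u); split; [apply reds_refl|]; eauto.
Qed.

Lemma RED_var G i A : nth_error G i = Some A -> RED A G (Var i).
Proof.
  intros E. eapply RED_neutral; [constructor; eauto | apply reds_refl |].
  split; [reflexivity | apply sirr_var].
Qed.

Lemma RED_rename T : forall G G' r t, renok r G G' -> RED T G t -> RED T G' (rename r t).
Proof.
  induction T using ty_nested_ind; intros G G' r t Hr Ht.
  all: pose proof (RED_typing Ht) as Hty.
  - destruct Ht as [_ [n [Hn [Hne | []]]]].
    eapply RED_neutral; [eapply typing_renok; eauto | eapply reds_rename; eauto | eapply neutral_rename; eauto].
  - destruct (RED_tup_inv Ht) as [n [Hn [Htn [Hne | [ts [-> Hts]]]]]].
    + eapply RED_neutral; [eapply typing_renok; eauto | eapply reds_rename; eauto | eapply neutral_rename; eauto].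
    + eapply RED_back; [eapply typing_renok; eauto | eapply reds_rename; eauto|].
      simpl. apply RED_tup.
      assert (HA : Forall (fun A => forall G G' r t, renok r G G' -> RED A G t -> RED A G' (rename r t)) (T :: Ts))
        by now constructor.
      clear - HA Hts Hr. induction Hts; simpl; inv HA; constructor; eauto.
  - destruct Ht as [_ [n [Hn [Hne | [b [-> Hb]]]]]].
    + eapply RED_neutral; [eapply typing_renok; eauto | eapply reds_rename; eauto | eapply neutral_rename; eauto].
    + eapply RED_back; [eapply typing_renok; eauto | eapply reds_rename; eauto|].
      simpl. pose proof (reds_typing Hty Hn) as Htn. inv Htn.
      apply RED_lam.
      * eapply typing_renok; [apply renok_up|]; eauto.
      * intros G'' r' s Hr' Hs.
        replace (subst (scons s (fun i => Var (r' i))) (rename (upr r) b))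
          with (subst (scons s (fun i => Var (r' (r i)))) b) by subst_eq.
        apply (Hb G'' (fun i => r' (r i))); auto. intros i A E; auto.
  - destruct Ht as [_ [n [Hn [Hne | [[u [-> Hu]] | [u [-> Hu]]]]]]].
    + eapply RED_neutral; [eapply typing_renok; eauto | eapply reds_rename; eauto | eapply neutral_rename; eauto].
    + eapply RED_back; [eapply typing_renok; eauto | eapply reds_rename; eauto|].
      apply RED_inl; eauto.
    + eapply RED_back; [eapply typing_renok; eauto | eapply reds_rename; eauto|].
      apply RED_inr; eauto.
Qed.

Definition normalizable G t : Prop := exists n, reds G t n /\ sirr G n.

Lemma RED_normalizable T : forall G t, RED T G t -> normalizable G t.
Proof.
  induction T using ty_nested_ind; intros G t Ht; pose proof (RED_typing Ht) as Hty.
  - destruct Ht as [_ [n [Hn [[_ Hne] | []]]]]. exists n; auto.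
  - destruct (RED_tup_inv Ht) as [n [Hn [Htn [[_ Hne] | [ts [-> Hts]]]]]]; [exists n; auto|].
    assert (HA : Forall (fun A => forall G t, RED A G t -> normalizable G t) (T :: Ts)) by now constructor.
    assert (Hns : exists ns, Forall2 (reds G) ts ns /\ Forall (sirr G) ns).
    { clear - HA Hts. induction Hts; inv HA; [exists nil; auto|].
      destruct IHHts as [ns [H1' H2']]; auto. destruct (H2 _ _ H) as [n [Hn Hn']].
      exists (n :: ns); auto. }
    destruct Hns as [ns [H1 H2]]. exists (Tup ns); split.
    + eapply reds_trans; [eauto | now apply reds_tup].
    + now apply sirr_tup.
  - destruct Ht as [_ [n [Hn [[_ Hne] | [b [-> Hb]]]]]]; [exists n; auto|].
    destruct (IHT2 (T1 :: G) b) as [n [Hn' Hn'']].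
    (* The body itself is its instance at the fresh variable in the extended context. *)
    { replace b with (subst (scons (Var 0) (fun i => Var (S i))) b).
      - apply Hb; [apply renok_S | now apply RED_var].
      - apply subst_id. intros [|i]; reflexivity. }
    exists (Lam T1 n); split; [eapply reds_trans; [eauto | now apply reds_lam] | now apply sirr_lam].
  - destruct Ht as [_ [n [Hn [[_ Hne] | [[u [-> Hu]] | [u [-> Hu]]]]]]]; [exists n; auto| |].
    + destruct (IHT1 _ _ Hu) as [n [Hn' Hn'']].
      exists (Inl T2 n); split; [eapply reds_trans; [eauto | now apply reds_inl] | now apply sirr_inl].
    + destruct (IHT2 _ _ Hu) as [n [Hn' Hn'']].
      exists (Inr T1 n); split; [eapply reds_trans; [eauto | now apply reds_inr] | now apply sirr_inr].
Qed.

Lemma RED_app A C G t s : RED (TArr A C) G t -> RED A G s -> RED C G (App t s).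
Proof.
  intros Ht Hs. pose proof (RED_typing Ht). pose proof (RED_typing Hs).
  assert (Hty : has_type G (App t s) C) by (econstructor; eauto).
  destruct Ht as [_ [n [Hn [Hne | [b [-> Hb]]]]]].
  - destruct (RED_normalizable Hs) as [s' [Hs' Hs'']].
    apply RED_neutral with (App n s'); [assumption | now apply reds_app |].
    split; [reflexivity | now apply sirr_app].
  - eapply RED_back; [assumption | |].
    + eapply reds_trans; [apply reds_app; [eauto | apply reds_refl] | apply reds_step; constructor].
    + apply (Hb G (fun i => i)); auto using renok_id.
Qed.

Lemma RED_proj G j t T Ts A : RED (TTup T Ts) G t -> nth_error (T :: Ts) j = Some A ->
  RED A G (Proj j t).
Proof.
  intros Ht E. pose proof (RED_typing Ht).
  assert (Hty : has_type G (Proj j t) A) by (econstructor; eauto).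
  destruct (RED_tup_inv Ht) as [n [Hn [Htn [Hne | [ts [-> Hts]]]]]].
  - apply RED_neutral with (Proj j n); [assumption | now apply reds_proj |].
    split; [reflexivity | now apply sirr_proj].
  - destruct (Forall2_nth_error Hts E) as [u [Eu Hu]].
    eapply RED_back; [assumption | | exact Hu].
    eapply reds_trans; [apply reds_proj; eauto | apply reds_step; now constructor].
Qed.

(** The branches have to normalize on their own for the case of a neutral scrutinee, where nothing
    is ever substituted into them. *)
Lemma RED_case G A C T t t1 t2 : RED (TSum A C) G t ->
  has_type (A :: G) t1 T -> has_type (C :: G) t2 T ->
  normalizable (A :: G) t1 -> normalizable (C :: G) t2 ->
  (forall s, RED A G s -> RED T G (subst1 s t1)) ->
  (forall s, RED C G s -> RED T G (subst1 s t2)) -> RED T G (Case t t1 t2).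
Proof.
  intros Ht T1 T2 [n1 [N1 N1']] [n2 [N2 N2']] H1 H2. pose proof (RED_typing Ht) as Htt.
  assert (Hty : has_type G (Case t t1 t2) T) by (econstructor; eauto).
  destruct Ht as [_ [n [Hn [Hne | [[u [-> Hu]] | [u [-> Hu]]]]]]].
  - apply RED_neutral with (Case n n1 n2); [assumption | eapply reds_case; eauto |].
    split; [reflexivity | eapply sirr_case; eauto using reds_typing].
  - eapply RED_back; [assumption | | apply H1; exact Hu].
    eapply reds_trans; [eapply reds_case; [| exact Hn | apply reds_refl | apply reds_refl]; eauto |
      apply reds_step; constructor].
  - eapply RED_back; [assumption | | apply H2; exact Hu].
    eapply reds_trans; [eapply reds_case; [| exact Hn | apply reds_refl | apply reds_refl]; eauto |
      apply reds_step; constructor].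
Qed.

Lemma nth_error_Forall2_RED (L : list ty) G ts : length L = length ts ->
  (forall i A u, nth_error L i = Some A -> nth_error ts i = Some u -> RED A G u) ->
  Forall2 (fun A u => RED A G u) L ts.
Proof. intros; now apply nth_error_Forall2. Qed.

Lemma reds_head G t u v : reds G t u -> head_step G u v -> reds G t v.
Proof. intros H1 H2; eapply reds_trans; [exact H1 | now apply reds_step, head_red]. Qed.

Lemma typing_tup_length G A As ts : has_type G (Tup ts) (TTup A As) -> length ts = length (A :: As).
Proof. intros H; inv H. eapply Forall2_length; eauto. Qed.

(** Two constructors are contracted and their parts are added at smaller types. As soon as one
    summand reduces to a neutral term, the sum is stuck and hence neutral once the other one is
    normalized. *)
Lemma RED_addop o T : addable T = true -> forall G t s, RED T G t -> RED T G s ->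
  RED T G (AddOp o t s).
Proof.
  induction T using ty_nested_ind; intros HT G t s Ht Hs.
  all: pose proof (RED_typing Ht) as Htt; pose proof (RED_typing Hs) as Hst.
  all: match type of Htt with has_type _ _ ?T =>
    assert (Hty : has_type G (AddOp o t s) T) by (constructor; auto) end.
  all: assert (Hne : forall T n n', has_type G (AddOp o t s) T ->
      reds G t n -> reds G s n' -> sirr G n -> sirr G n' -> intro n = false \/ intro n' = false ->
      RED T G (AddOp o t s)).
  1,3,5,7: clear; intros T n n' Hty Hn Hn' Sn Sn' Hi;
    apply RED_neutral with (AddOp o n n'); [assumption | now apply reds_addop |];
    split; [reflexivity | now apply sirr_addop].
  - destruct Ht as [? [n [Hn [[Hi Hne1] | []]]]]; destruct Hs as [? [n' [Hn' [[Hi' Hne2] | []]]]].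
    eapply Hne; eauto.
  - destruct (RED_tup_inv Ht) as [n [Hn [Htn [[Hi Hne1] | [ts [-> Hts]]]]]].
    { destruct (RED_normalizable Hs) as [n' [Hn' Hne2]]. eapply Hne; eauto. }
    destruct (RED_tup_inv Hs) as [n' [Hn' [Htn' [[Hi' Hne2] | [ts' [-> Hts']]]]]].
    { destruct (RED_normalizable Ht) as [n [Hn1 Hne1]]. eapply Hne; eauto. }
    pose proof (typing_tup_length Htn) as L1. pose proof (typing_tup_length Htn') as L2.
    eapply RED_back; [assumption | |].
    { eapply reds_head; [apply reds_addop; eauto | apply head_addop_tup; congruence]. }
    apply RED_tup. apply nth_error_Forall2_RED.
    { rewrite length_map, length_combine. lia. }
    intros i A u EA. rewrite nth_error_map, nth_error_combine.
    destruct (Forall2_nth_error Hts EA) as [x [-> Hx]].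
    destruct (Forall2_nth_error Hts' EA) as [y [-> Hy]].
    intros [= <-]; simpl.
    assert (HF : Forall (fun T => addable T = true -> forall G t s, RED T G t -> RED T G s ->
      RED T G (AddOp o t s)) (T :: Ts)) by now constructor.
    rewrite Forall_forall in HF. apply HF; auto; [eapply nth_error_In | eapply addable_nth]; eauto.
  - destruct (RED_arr_inv Ht) as [n [Hn [Htn [[Hi Hne1] | [b [-> Hb]]]]]].
    { destruct (RED_normalizable Hs) as [n' [Hn' Hne2]]. eapply Hne; eauto. }
    destruct (RED_arr_inv Hs) as [n' [Hn' [Htn' [[Hi' Hne2] | [b' [-> Hb']]]]]].
    { destruct (RED_normalizable Ht) as [n [Hn1 Hne1]]. eapply Hne; eauto. }
    inv Htn. inv Htn'.
    eapply RED_back; [assumption | |].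
    { eapply reds_head; [apply reds_addop; eauto | apply head_addop_lam]. }
    apply RED_lam; [now constructor|]. intros G' r u Hr Hu. simpl. apply IHT2; auto.
  - discriminate.
Qed.

Lemma RED_osum T : addable T = true -> forall G ts t, RED T G t -> Forall (RED T G) ts ->
  RED T G (osum t ts).
Proof.
  intros HT G ts; induction ts; intros t Ht Hts; simpl; auto. inv Hts.
  apply IHts; auto. now apply RED_addop.
Qed.

Lemma RED_mul_base T b : addable T = true -> forall G t s, RED T G t -> RED (TBase b) G s ->
  RED T G (Mul t s).
Proof.
  induction T using ty_nested_ind; intros HT G t s Ht Hs.
  all: pose proof (RED_typing Ht) as Htt; pose proof (RED_typing Hs) as Hst.
  all: match type of Htt with has_type _ _ ?T =>
    assert (Hty : has_type G (Mul t s) T) by (eapply ty_mul_base; eauto) end.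
  all: destruct (RED_normalizable Hs) as [s' [Hs' Ns']].
  all: assert (Hs'' : is_base G s') by (exists b; eapply reds_typing; eauto).
  all: assert (Hsr : RED (TBase b) G s')
    by (destruct Hs as [? [m [Hm [[Im Nm] | []]]]]; eapply RED_neutral with s';
      [eapply reds_typing; eauto | apply reds_refl | split; auto];
      pose proof (reds_typing Hst Hs') as E; destruct s'; auto; inv E).
  all: assert (Hne : forall T n, has_type G (Mul t s) T -> reds G t n -> neutral G n -> RED T G (Mul t s)).
  1,3,5,7: clear - Hs' Ns'; intros T n Hty Hn [Hi Sn];
    apply RED_neutral with (Mul n s'); [assumption | now apply reds_mul |];
    split; [reflexivity | apply sirr_mul; auto].
  - destruct Ht as [? [n [Hn [HN | []]]]]. eapply Hne; eauto.
  - destruct (RED_tup_inv Ht) as [n [Hn [Htn [HN | [ts [-> Hts]]]]]]; [eapply Hne; eauto|].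
    eapply RED_back; [assumption | |].
    { eapply reds_head; [apply reds_mul; eauto | now apply head_mul_tup]. }
    apply RED_tup. apply nth_error_Forall2_RED.
    { rewrite length_map. eapply Forall2_length; eauto. }
    intros i A u EA. rewrite nth_error_map.
    destruct (Forall2_nth_error Hts EA) as [x [-> Hx]].
    intros [= <-]; simpl.
    assert (HF : Forall (fun T => addable T = true -> forall G t s, RED T G t -> RED (TBase b) G s ->
      RED T G (Mul t s)) (T :: Ts)) by now constructor.
    rewrite Forall_forall in HF. apply HF; auto; [eapply nth_error_In | eapply addable_nth]; eauto.
  - destruct Ht as [Ht0 [n [Hn [HN | [b' [-> Hb]]]]]]; [eapply Hne; eauto|].
    pose proof (reds_typing Ht0 Hn) as E1. inv E1.
    eapply RED_back; [assumption | |].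
    { eapply reds_head; [apply reds_mul; eauto | now apply head_mul_lam]. }
    apply RED_lam.
    { eapply ty_mul_base; eauto using typing_shift, RED_typing. }
    intros G' r u Hr Hu. simpl. apply IHT2; auto.
    replace (subst (scons u (fun i => Var (r i))) (shift s')) with (rename r s') by subst_eq.
    eapply RED_rename; eauto.
  - discriminate.
Qed.

(** Induction on the type of the right factor: a product of tuples becomes a sum of products at the
    component types, down to base type, where the induction on [T] has been done. *)
Lemma RED_mul A : has_dty A = true -> forall T G t s, addable T = true ->
  RED (dty T A) G t -> RED A G s -> RED T G (Mul t s).
Proof.
  induction A using ty_nested_ind; intros HA T0 G t s HT Ht Hs; try discriminate.
  - eapply RED_mul_base; eauto.
  - pose proof (RED_typing Ht) as Htt; pose proof (RED_typing Hs) as Hst.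
    assert (Hty : has_type G (Mul t s) T0) by (eapply ty_mul; eauto).
    destruct (RED_tup_inv Hs) as [s' [Hs' [Hts' [HN | [ss [-> Hss]]]]]].
    { destruct (RED_normalizable Ht) as [n [Hn Sn]]. destruct HN as [Hi Hs''].
      apply RED_neutral with (Mul n s'); [assumption | now apply reds_mul |].
      split; [reflexivity | apply sirr_mul; eauto 6]. }
    simpl in Ht. destruct (RED_tup_inv Ht) as [n [Hn [Htn [[Hi Sn] | [ts [-> Hts]]]]]].
    { destruct (RED_normalizable Hs) as [m [Hm Sm]].
      apply RED_neutral with (Mul n m); [assumption | now apply reds_mul |].
      split; [reflexivity | apply sirr_mul; eauto 6]. }
    assert (HF : Forall (fun A => has_dty A = true -> forall T G t s, addable T = true ->
      RED (dty T A) G t -> RED A G s -> RED T G (Mul t s)) (A :: Ts)) by now constructor.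
    pose proof (has_dty_tup HA) as HD. inv HF. inv HD. inv Hss. inv Hts.
    eapply RED_back; [assumption | |].
    { eapply reds_head; [apply reds_mul; eauto | apply head_mul_between_tup].
      repeat match goal with F : Forall2 _ _ _ |- _ => apply Forall2_length in F end.
      rewrite length_map in *. congruence. }
    apply RED_osum; auto.
    match goal with F : Forall2 _ Ts ?ss, F' : Forall2 _ (map _ Ts) ?ts,
      K : Forall (fun A => has_dty A = true) Ts, K' : Forall _ Ts |- _ =>
      clear - F F' K K' HT; rename F into F1, F' into F2; revert K K'; revert F2; revert F1 end.
    intros F1; revert l'0.
    induction F1; intros l'0 F2 K K'; simpl in *; inv F2; simpl; constructor; inv K; inv K'; auto.
Qed.

(** No constructor has a base type, so an irreducible term of base type is neutral. *)
Lemma RED_irreducible_base G s s' b : RED (TBase b) G s -> reds G s s' -> sirr G s' ->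
  RED (TBase b) G s' /\ neutral G s' /\ is_base G s'.
Proof.
  intros Hs Hr Sn. pose proof (reds_typing (RED_typing Hs) Hr) as Ht.
  assert (HN : neutral G s') by (split; [destruct s'; auto; inv Ht | assumption]).
  split; [|split; [assumption | exists b; assumption]].
  eapply RED_neutral; [assumption | apply reds_refl | assumption].
Qed.

Lemma RED_der_base T b : forall G t s, RED T (TBase b :: G) t -> RED (TBase b) G s ->
  RED T G (Der t s).
Proof.
  induction T using ty_nested_ind; intros G t s Ht Hs.
  all: pose proof (RED_typing Ht) as Htt; pose proof (RED_typing Hs) as Hst.
  all: match type of Htt with has_type _ _ ?T =>
    assert (Hty : has_type G (Der t s) T) by (eapply ty_der_base; eauto) end.
  all: destruct (RED_normalizable Hs) as [s' [Hs' Ns']].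
  all: destruct (RED_irreducible_base Hs Hs' Ns') as [Hsr [[Is _] Hsb]].
  all: assert (Hne : forall T n, has_type G (Der t s) T -> reds (TBase b :: G) t n ->
      neutral (TBase b :: G) n -> RED T G (Der t s)).
  1,3,5,7: clear - Hs' Ns' Hst Is; intros T n Hty Hn [Hi Sn];
    apply RED_neutral with (Der n s'); [assumption | eapply reds_der; eauto |];
    split; [reflexivity | eapply sirr_der; eauto using reds_typing].
  - destruct Ht as [? [n [Hn [HN | []]]]]. eapply Hne; eauto.
  - destruct (RED_tup_inv Ht) as [n [Hn [Htn [HN | [ts [-> Hts]]]]]]; [eapply Hne; eauto|].
    eapply RED_back; [assumption | |].
    { eapply reds_head; [eapply reds_der; eauto | now apply head_der_tup]. }
    apply RED_tup. apply nth_error_Forall2_RED.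
    { rewrite length_map. eapply Forall2_length; eauto. }
    intros i A u EA. rewrite nth_error_map.
    destruct (Forall2_nth_error Hts EA) as [x [-> Hx]].
    intros [= <-]; simpl.
    assert (HF : Forall (fun T => forall G t s, RED T (TBase b :: G) t -> RED (TBase b) G s ->
      RED T G (Der t s)) (T :: Ts)) by now constructor.
    rewrite Forall_forall in HF. apply HF; auto; eapply nth_error_In; eauto.
  - destruct (RED_arr_inv Ht) as [n [Hn [Htn [HN | [b' [-> Hb]]]]]]; [eapply Hne; eauto|].
    inv Htn.
    eapply RED_back; [assumption | |].
    { eapply reds_head; [eapply reds_der; eauto | now apply head_der_lam]. }
    apply RED_lam.
    { eapply ty_der_base; eauto using typing_shift, RED_typing, typing_swap. }
    intros G' r u Hr Hu. simpl. apply IHT2.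
    (* Differentiating an abstraction exchanges two binders. The body of the abstraction is
       reducible in the world that already contains the variable of differentiation, and the
       argument is moved there. *)
    + replace (subst (ups (scons u (fun i => Var (r i)))) (swap b'))
        with (subst (scons (shift u) (fun i => Var (upr r i))) b') by subst_eq.
      apply Hb; [now apply renok_up |]. eapply RED_rename; eauto using renok_S.
    + replace (subst (scons u (fun i => Var (r i))) (shift s')) with (rename r s') by subst_eq.
      eapply RED_rename; eauto.
  - destruct Ht as [_ [n [Hn [HN | [[u [-> Hu]] | [u [-> Hu]]]]]]]; [eapply Hne; eauto| |].
    + eapply RED_back; [assumption | |].
      { eapply reds_head; [eapply reds_der; eauto | now apply head_der_inl]. }
      apply RED_inl; auto.
    + eapply RED_back; [assumption | |].
      { eapply reds_head; [eapply reds_der; eauto | now apply head_der_inr]. }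
      apply RED_inr; auto.
Qed.

Lemma RED_int_base T b : addable T = true -> forall G x y t,
  RED (TBase b) G x -> RED (TBase b) G y -> RED T (TBase b :: G) t -> RED T G (Int x y t).
Proof.
  induction T using ty_nested_ind; intros HT G x y t Hx Hy Ht.
  all: pose proof (RED_typing Ht) as Htt; pose proof (RED_typing Hx) as Hxt; pose proof (RED_typing Hy) as Hyt.
  all: match type of Htt with has_type _ _ ?T =>
    assert (Hty : has_type G (Int x y t) T) by (eapply ty_int_base; eauto) end.
  all: destruct (RED_normalizable Hx) as [x' [Hx' Nx']].
  all: destruct (RED_irreducible_base Hx Hx' Nx') as [Hxr [[Ix _] Hxb]].
  all: destruct (RED_normalizable Hy) as [y' [Hy' Ny']].
  all: destruct (RED_irreducible_base Hy Hy' Ny') as [Hyr [[Iy _] Hyb]].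
  all: assert (Hne : forall T n, has_type G (Int x y t) T -> reds (TBase b :: G) t n ->
      neutral (TBase b :: G) n -> RED T G (Int x y t)).
  1,3,5,7: clear - Hx' Nx' Hxt Ix Hy' Ny'; intros T n Hty Hn [Hi Sn];
    apply RED_neutral with (Int x' y' n); [assumption | eapply reds_int; eauto |];
    split; [reflexivity | eapply sirr_int; eauto using reds_typing].
  - destruct Ht as [? [n [Hn [HN | []]]]]. eapply Hne; eauto.
  - destruct (RED_tup_inv Ht) as [n [Hn [Htn [HN | [ts [-> Hts]]]]]]; [eapply Hne; eauto|].
    eapply RED_back; [assumption | |].
    { eapply reds_head; [eapply reds_int; eauto | now apply head_int_tup]. }
    apply RED_tup. apply nth_error_Forall2_RED.
    { rewrite length_map. eapply Forall2_length; eauto. }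
    intros i A u EA. rewrite nth_error_map.
    destruct (Forall2_nth_error Hts EA) as [z [-> Hz]].
    intros [= <-]; simpl.
    assert (HF : Forall (fun T => addable T = true -> forall G x y t,
      RED (TBase b) G x -> RED (TBase b) G y -> RED T (TBase b :: G) t -> RED T G (Int x y t)) (T :: Ts))
      by now constructor.
    rewrite Forall_forall in HF. apply HF; auto; [eapply nth_error_In | eapply addable_nth]; eauto.
  - destruct (RED_arr_inv Ht) as [n [Hn [Htn [HN | [b' [-> Hb]]]]]]; [eapply Hne; eauto|].
    inv Htn.
    eapply RED_back; [assumption | |].
    { eapply reds_head; [eapply reds_int; eauto | now apply head_int_lam]. }
    apply RED_lam.
    { eapply ty_int_base; eauto using typing_shift, RED_typing, typing_swap. }
    intros G' r u Hr Hu. simpl. apply IHT2; auto.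
    + replace (subst (scons u (fun i => Var (r i))) (shift x')) with (rename r x') by subst_eq.
      eapply RED_rename; eauto.
    + replace (subst (scons u (fun i => Var (r i))) (shift y')) with (rename r y') by subst_eq.
      eapply RED_rename; eauto.
    + replace (subst (ups (scons u (fun i => Var (r i)))) (swap b'))
        with (subst (scons (shift u) (fun i => Var (upr r i))) b') by subst_eq.
      apply Hb; [now apply renok_up |]. eapply RED_rename; eauto using renok_S.
  - discriminate.
Qed.

Lemma RED_star A As G G' r k B ss1 ss2 u : renok r G G' ->
  Forall2 (fun A u => RED A G u) (A :: As) ss1 -> Forall2 (fun A u => RED A G u) (A :: As) ss2 ->
  nth_error (A :: As) k = Some B -> RED B G' u ->
  RED (TTup A As) G' (subst (scons u (fun i => Var (r i))) (star k ss1 ss2)).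
Proof.
  intros Hr H1 H2 Hk Hu. apply RED_tup. fold (@subst Sg).
  rewrite map_app; simpl. rewrite 2!map_map.
  revert k ss1 ss2 H1 H2 Hk. generalize (A :: As).
  assert (Hren : forall L ss, Forall2 (fun A u => RED A G u) L ss -> Forall2 (fun A u => RED A G' u) L
      (map (fun x => subst (scons u (fun i => Var (r i))) (shift x)) ss)).
  { induction 1; simpl; constructor; auto.
    replace (subst (scons u (fun i => Var (r i))) (shift y)) with (rename r y) by subst_eq.
    eapply RED_rename; eauto. }
  induction l as [|C l IH]; intros [|k] ss1 ss2 H1 H2 Hk; try discriminate; inv H1; inv H2; simpl.
  - injection Hk as ->. constructor; auto.
  - constructor.
    + specialize (Hren [C] [y] ltac:(constructor; auto)). now inv Hren.
    + apply IH; auto.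
Qed.

(** The body is assumed reducible under all substitutions, not just as an open term: at a tuple, the
    rule substitutes into it a tuple in which one component is a fresh variable. *)
Lemma RED_der A : has_dty A = true -> forall T G t s, has_type (A :: G) t T ->
  (forall G' r u, renok r G G' -> RED A G' u -> RED T G' (subst (scons u (fun i => Var (r i))) t)) ->
  RED A G s -> RED (dty T A) G (Der t s).
Proof.
  induction A using ty_nested_ind; intros HA T0 G t s Ht Hts Hs; try discriminate.
  all: pose proof (RED_typing Hs) as Hst.
  all: match type of Ht with has_type (?A :: _) _ ?D => assert (Ht' : RED D (A :: G) t) by
    (rewrite <- (@subst_id Sg (scons (Var 0) (fun i => Var (S i))) t);
      [apply (Hts (A :: G) S (Var 0)); [apply renok_S | now apply RED_var] |
     intros [|i]; reflexivity]) end.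
  - eapply RED_der_base; eauto.
  - assert (Hty : has_type G (Der t s) (dty T0 (TTup A Ts))) by (eapply ty_der; eauto).
    destruct (RED_tup_inv Hs) as [s' [Hs' [Hts' [HN | [ss [-> Hss]]]]]].
    { destruct (RED_normalizable Ht') as [n [Hn Sn]]. destruct HN as [Hi Hs''].
      apply RED_neutral with (Der n s'); [assumption | eapply reds_der; eauto |].
      split; [reflexivity | eapply sirr_der; eauto]. }
    eapply RED_back; [assumption | |].
    { eapply reds_head; [eapply reds_der; eauto using reds_refl | now apply head_der_at_tup]. }
    change (dty T0 (TTup A Ts)) with (TTup (dty T0 A) (map (dty T0) Ts)).
    apply RED_tup. change (dty T0 A :: map (dty T0) Ts) with (map (dty T0) (A :: Ts)).
    apply nth_error_Forall2_RED.
    { rewrite 2!length_map, length_indexed. eapply Forall2_length; eauto. }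
    intros i B u. rewrite 2!nth_error_map, nth_error_indexed.
    destruct (nth_error (A :: Ts) i) as [B0|] eqn:EB; [|discriminate]. intros [= <-].
    destruct (Forall2_nth_error Hss EB) as [x [-> Hx]]. intros [= <-]; simpl.
    assert (HF : Forall (fun A => has_dty A = true -> forall T G t s, has_type (A :: G) t T ->
      (forall G' r u, renok r G G' -> RED A G' u -> RED T G' (subst (scons u (fun i => Var (r i))) t)) ->
      RED A G s -> RED (dty T A) G (Der t s)) (A :: Ts)) by now constructor.
    rewrite Forall_forall in HF. inv Hts'. apply HF; auto.
    + eapply nth_error_In; eauto.
    + eapply has_dty_nth; eauto.
    + eapply typing_subst_under; eauto. eapply typing_star; eauto.
    + intros G' r u Hr Hu.
      replace (subst (scons u (fun i => Var (r i))) (subst_under (star i ss ss) t))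
        with (subst (scons (subst (scons u (fun i => Var (r i))) (star i ss ss)) (fun i => Var (r i))) t).
      * apply Hts; auto. eapply RED_star; eauto.
      * unfold subst_under. rewrite subst_subst. apply subst_ext. intros [|j]; reflexivity.
Qed.

Lemma RED_int A : has_dty A = true -> forall T G x y t, addable T = true -> has_type (A :: G) t (dty T A) ->
  (forall G' r u, renok r G G' -> RED A G' u ->
     RED (dty T A) G' (subst (scons u (fun i => Var (r i))) t)) ->
  RED A G x -> RED A G y -> RED T G (Int x y t).
Proof.
  induction A using ty_nested_ind; intros HA T0 G x y t HT Ht Hts Hx Hy; try discriminate.
  all: pose proof (RED_typing Hx) as Hxt; pose proof (RED_typing Hy) as Hyt.
  all: match type of Ht with has_type (?A :: _) _ ?D => assert (Ht' : RED D (A :: G) t) by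
    (rewrite <- (@subst_id Sg (scons (Var 0) (fun i => Var (S i))) t);
      [apply (Hts (A :: G) S (Var 0)); [apply renok_S | now apply RED_var] |
     intros [|i]; reflexivity]) end.
  - apply RED_int_base with b; auto.
  - assert (Hty : has_type G (Int x y t) T0) by (eapply ty_int; eauto).
    destruct (RED_tup_inv Hx) as [x' [Hx' [Htx' [HN | [ss1 [-> Hss1]]]]]].
    { destruct (RED_normalizable Ht') as [n [Hn Sn]]. destruct HN as [Hi Hs''].
      destruct (RED_normalizable Hy) as [m [Hm Sm]].
      apply RED_neutral with (Int x' m n); [assumption | eapply reds_int; eauto |].
      split; [reflexivity | eapply sirr_int; eauto]. }
    destruct (RED_tup_inv Hy) as [y' [Hy' [Hty' [HN | [ss2 [-> Hss2]]]]]].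
    { destruct (RED_normalizable Ht') as [n [Hn Sn]]. destruct HN as [Hi Hs''].
      destruct (RED_normalizable Hx) as [m [Hm Sm]].
      apply RED_neutral with (Int m y' n); [assumption | eapply reds_int; eauto |].
      split; [reflexivity | eapply sirr_int; eauto using reds_typing]. }
    pose proof (typing_tup_length Htx') as L1. pose proof (typing_tup_length Hty') as L2.
    assert (HF : Forall2 (fun (_ : ty) u => RED T0 G u) (A :: Ts)
      (map (fun p => Int (fst (snd p)) (snd (snd p))
                    (Proj (fst p) (subst_under (star (fst p) ss2 ss1) t)))
        (indexed (combine ss1 ss2)))).
    { apply nth_error_Forall2.
      { rewrite length_map, length_indexed, length_combine. lia. }
      intros i B u EB. rewrite nth_error_map, nth_error_indexed, nth_error_combine.
      destruct (Forall2_nth_error Hss1 EB) as [z1 [-> Hz1]].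
      destruct (Forall2_nth_error Hss2 EB) as [z2 [-> Hz2]]. intros [= <-]; simpl.
      assert (HF : Forall (fun A => has_dty A = true -> forall T G x y t, addable T = true ->
        has_type (A :: G) t (dty T A) ->
        (forall G' r u, renok r G G' -> RED A G' u ->
           RED (dty T A) G' (subst (scons u (fun i => Var (r i))) t)) ->
        RED A G x -> RED A G y -> RED T G (Int x y t)) (A :: Ts)) by now constructor.
      rewrite Forall_forall in HF. inv Htx'. inv Hty'.
      assert (HP : nth_error (dty T0 A :: map (dty T0) Ts) i = Some (dty T0 B))
        by (rewrite nth_error_map_dty, EB; reflexivity).
      apply (HF B); auto.
      - eapply nth_error_In; eauto.
      - eapply has_dty_nth; eauto.
      - eapply ty_proj; [|exact HP]. eapply typing_subst_under; [exact Ht|]. eapply typing_star; eauto.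
      - intros G' r u Hr Hu. simpl. eapply RED_proj; [|exact HP].
        replace (subst (scons u (fun i => Var (r i))) (subst_under (star i ss2 ss1) t))
          with (subst (scons (subst (scons u (fun i => Var (r i))) (star i ss2 ss1)) (fun i => Var (r i))) t).
        + apply Hts; auto. eapply RED_star; eauto.
        + unfold subst_under. rewrite subst_subst. apply subst_ext. intros [|j]; reflexivity. }
    match type of HF with Forall2 _ _ ?m => destruct m as [|z zs] eqn:Em end; inv HF.
    eapply RED_back; [assumption | |].
    { eapply reds_head; [eapply reds_int; eauto using reds_refl | eapply head_int_between_tup; eauto]. congruence. }
    apply RED_osum; auto.
    match goal with F : Forall2 _ Ts zs |- _ => clear - F; induction F; constructor; auto end.
Qed.

(** The fundamental lemma of the reducibility argument. Reducible substitutions are needed to pass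
    below binders. [Fix] has to be excluded because its unfolding contains it again at the same
    type. *)
Theorem fixfree_RED t : fixfree t -> forall G T, has_type G t T -> forall D f,
  (forall i A, nth_error G i = Some A -> RED A D (f i)) -> RED T D (subst f t).
Proof.
  assert (Hlift : forall (f : nat -> tm) t u (r : nat -> nat),
    subst (scons u (fun i => Var (r i))) (subst (ups f) t) = subst (scons u (fun i => rename r (f i))) t).
  { clear. intros f t u r. rewrite subst_subst. apply subst_ext. intros [|i]; simpl; auto.
    unfold shift. now rewrite subst_rename, rename_subst_var. }
  induction t using tm_nested_ind; intros Hff G T0 Ht D f Hf; inv Ht.
  5: { apply fixfree_tup in Hff. apply RED_tup. fold (@subst Sg).
    match goal with F : Forall2 _ ts _ |- _ => revert F end. generalize (T :: Ts).
    induction H; intros L F; inv F; inv Hff; simpl; constructor; eauto. }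
  all: simpl in Hff.
  all: assert (HfA : forall A D' r u, renok r D D' -> RED A D' u ->
    forall i B, nth_error (A :: G) i = Some B -> RED B D' (scons u (fun i => rename r (f i)) i))
    by (intros A' D' r' u' Hr' Hu' [|i'] B' E'; simpl in *; [congruence | eapply RED_rename; eauto]).
  all: assert (HfT : forall A t T, has_type (A :: G) t T -> has_type (A :: D) (subst (ups f) t) T)
    by (intros A' t' T' Ht'; eapply typing_subst; [eauto|]; intros [|i'] B' _ E'; simpl in *;
      [now constructor | apply typing_shift, RED_typing; auto]).
  all: assert (HfU : forall A t T, (forall u, RED A (A :: D) u -> RED T (A :: D)
        (subst (scons u (fun i => rename S (f i))) t)) -> RED T (A :: D) (subst (ups f) t))
    by (intros A' t' T' H'; exact (H' (Var 0) (RED_var (G := A' :: D) (i := 0) eq_refl))).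
  - eapply RED_neutral; [constructor | apply reds_refl | split; [reflexivity | apply sirr_cst]].
  - simpl; auto.
  - simpl. apply RED_lam; auto. intros G' r s Hr Hs. rewrite Hlift. eauto.
  - simpl. eapply RED_app; [eapply IHt1 | eapply IHt2]; intuition eauto.
  - simpl. eapply RED_proj; eauto.
  - simpl. apply RED_addop; intuition eauto.
  - simpl. eapply RED_mul; intuition eauto.
  - simpl. eapply RED_der; intuition eauto. rewrite Hlift. eauto.
  - simpl. eapply RED_int with (A := A); intuition eauto. rewrite Hlift. eauto.
  - simpl. apply RED_inl; eauto.
  - simpl. apply RED_inr; eauto.
  - simpl. destruct Hff as [F1 [F2 F3]]. eapply RED_case; eauto.
    + eapply RED_normalizable. apply HfU. intros; eapply IHt2; eauto using renok_S.
    + eapply RED_normalizable. apply HfU. intros; eapply IHt3; eauto using renok_S.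
    + intros s Hs. unfold subst1. change (scons s Var) with (scons s (fun i => Var ((fun i : nat => i) i))).
      rewrite Hlift. eapply IHt2; eauto using renok_id.
    + intros s Hs. unfold subst1. change (scons s Var) with (scons s (fun i => Var ((fun i : nat => i) i))).
      rewrite Hlift. eapply IHt3; eauto using renok_id.
  - easy.
Qed.

Theorem fixfree_normalizable G t T : fixfree t -> has_type G t T ->
  exists n, reds G t n /\ irr G n.
Proof.
  intros Hff Ht. destruct (@RED_normalizable T G t) as [n [Hn Sn]].
  - rewrite <- (subst_var t). eapply fixfree_RED; eauto. intros; now apply RED_var.
  - exists n; split; [assumption | now apply sirr_irr].
Qed.

End Normalization.

(** * Normal forms *)

Section NormalForms.
Variable Sg : sig.
Local Notation tm := (tm Sg).
Local Notation ty := (ty (base Sg)).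
Local Notation ctx := (ctx Sg).
Implicit Types (G D : ctx) (t s u v w n : tm) (T A B C : ty).

Lemma irr_tup G ts : irr G (Tup ts) -> Forall (irr G) ts.
Proof.
  intros H. apply Forall_forall. intros t Hin u Hu.
  destruct (in_split _ _ Hin) as [l [r ->]]. eapply H. apply red_in_tup; eauto.
Qed.

Ltac irr_sub :=
  match goal with H : irr ?G ?t |- irr _ _ =>
    let u := fresh "u" in let Hu := fresh "Hu" in
    intros u Hu; eapply H; econstructor; eassumption end.

(** [Fix] is a redex wherever it stands. Typing comes in because a step in the body of a derivative
    or an integral or in a branch of a case needs the type of another subterm. *)
Lemma irr_fixfree t : forall G T, has_type G t T -> irr G t -> fixfree t.
Proof.
  induction t using tm_nested_ind; intros G T0 Ht Hi.
  5: { apply fixfree_tup. apply irr_tup in Hi. inv Ht.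
       match goal with F : Forall2 _ ts _ |- _ => revert F end. generalize (T :: Ts).
       induction H; intros L F; inv F; inv Hi; constructor; eauto. }
  all: simpl; auto; inv Ht.
  all: repeat match goal with |- _ /\ _ => split end.
  all: try match goal with
    | IH : forall G T, has_type G ?t T -> irr G ?t -> fixfree ?t, H : has_type _ ?t _ |- fixfree ?t =>
      eapply IH; [exact H | irr_sub] end.
  eapply Hi. constructor.
Qed.

Lemma nf_fixfree G n T : nf G n -> has_type G n T -> fixfree n.
Proof.
  intros H; revert T.
  enough (Hg : forall G n, nf G n -> forall T, has_type G n T -> fixfree n) by eauto.
  (* [nf] and [nb] are mutual, and [nf] also occurs inside [Forall]; the recursion on the
     derivations is therefore set up by hand. *)
  clear. fix IH 3. intros G n H.
  assert (IHb : forall G n, nb G n -> forall T, has_type G n T -> fixfree n).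
  { fix IHb 3. intros G0 n0 H0. destruct H0; intros T Ht; simpl; auto; inv Ht; uniq; repeat split; eauto. }
  destruct H; intros T Ht; simpl.
  - eauto.
  - inv Ht. apply (fixfree_tup ts).
    match goal with F : Forall2 _ ts _ |- _ => revert F end. generalize (T0 :: Ts).
    induction H; intros L F; inv F; constructor; eauto.
  - inv Ht. eapply irr_fixfree; eauto.
  - inv Ht. eauto.
  - inv Ht. eauto.
Qed.

(** * Reduction to [Fix]-free terms *)

(** The working substitute for weak normalization. A well-typed normal form is [Fix]-free and a
    well-typed [Fix]-free term normalizes, but [Fix]-freeness, unlike being normal, is preserved by
    putting such terms together. *)
Definition FF G t : Prop := exists n, reds G t n /\ fixfree n.

Lemma FF_back G t t' : reds G t t' -> FF G t' -> FF G t.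
Proof. intros Hr [n [Hn Hf]]. exists n; split; [eapply reds_trans; eauto | assumption]. Qed.

Lemma fixfree_FF G t : fixfree t -> FF G t.
Proof. intros H; exists t; split; [apply reds_refl | assumption]. Qed.

Lemma wn_FF G t T : has_type G t T -> wn G t -> FF G t.
Proof.
  intros Ht [n [Hn Hnf]]. exists n; split; [assumption|].
  eapply nf_fixfree; eauto. eapply reds_typing; eauto.
Qed.

Lemma FF_tup G ts : Forall (FF G) ts -> FF G (Tup ts).
Proof.
  intros H. assert (Hns : exists ns, Forall2 (reds G) ts ns /\ Forall (@fixfree Sg) ns).
  { induction H as [|t ts [n [Hn Hf]] _ [ns [H1 H2]]]; [exists nil; auto | exists (n :: ns); auto]. }
  destruct Hns as [ns [H1 H2]]. exists (Tup ns); split; [now apply reds_tup | now apply fixfree_tup].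
Qed.

Lemma reds_tup_inv G ts n : reds G (Tup ts) n -> exists ns, n = Tup ns /\ Forall2 (reds G) ts ns.
Proof.
  intros Hr; apply clos_rt_rt1n in Hr. remember (Tup ts) as t eqn:E. revert ts E.
  induction Hr as [|t t' n Hr _ IH]; intros ts ->.
  - exists ts; split; auto. induction ts; constructor; auto using reds_refl.
  - inv Hr. destruct (IH _ eq_refl) as [ns [-> Hns]]. exists ns; split; auto.
    apply Forall2_app_inv_l in Hns. destruct Hns as [ns1 [ns2 [K1 [K2 ->]]]]. inv K2.
    apply Forall2_app; auto. constructor; auto. eapply reds_trans; [apply reds_step|]; eauto.
Qed.

Lemma reds_lam_inv G A t n : reds G (Lam A t) n -> exists n', n = Lam A n' /\ reds (A :: G) t n'.
Proof.
  intros Hr; apply clos_rt_rt1n in Hr. remember (Lam A t) as u eqn:E. revert t E.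
  induction Hr as [|u u' n Hr _ IH]; intros t ->.
  - exists t; split; auto using reds_refl.
  - inv Hr. destruct (IH _ eq_refl) as [n' [-> Hn]]. exists n'; split; auto.
    eapply reds_trans; [apply reds_step|]; eauto.
Qed.

Lemma FF_tup_inv G ts : FF G (Tup ts) -> Forall (FF G) ts.
Proof.
  intros [n [Hn Hf]]. destruct (reds_tup_inv Hn) as [ns [-> Hns]]. apply fixfree_tup in Hf.
  clear Hn. induction Hns; inv Hf; constructor; auto. exists y; auto.
Qed.

Lemma FF_lam_inv G A t : FF G (Lam A t) -> FF (A :: G) t.
Proof.
  intros [n [Hn Hf]]. destruct (reds_lam_inv Hn) as [n' [-> Hn']]. exists n'; auto.
Qed.

Lemma FF_lam G A t : FF (A :: G) t -> FF G (Lam A t).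
Proof. intros [n [Hn Hf]]. exists (Lam A n); split; [now apply reds_lam | assumption]. Qed.

(** The extra variable does not occur in [shift t], so any term may replace it, whatever its type;
    [Var 0] is an arbitrary choice. *)
Lemma FF_unshift G A t T : has_type G t T -> FF (A :: G) (shift t) -> FF G t.
Proof.
  intros Ht [n [Hn Hf]].
  destruct (@reds_subst_free Sg (A :: G) G (scons (Var 0) Var) (shift t) n T) as [Hr _]; auto.
  - now apply typing_shift.
  - intros [|i] B Hi E; simpl in *; [|now constructor].
    apply free_rename in Hi. destruct Hi as [j [_ E']]; discriminate.
  - exists (subst (scons (Var 0) Var) n); split.
    + replace (subst (scons (Var 0) Var) (shift t)) with t in Hr; [assumption|].
      unfold shift. rewrite subst_rename. symmetry. apply subst_id. reflexivity.
    + apply fixfree_subst; auto. intros [|i]; simpl; auto.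
Qed.

(** Up to the first root contraction a reduction takes place inside the two summands. *)
Lemma reds_addop_inv G o a b n : reds G (AddOp o a b) n ->
  (exists a' b', n = AddOp o a' b' /\ reds G a a' /\ reds G b b') \/
  (exists a' b' v, reds G a a' /\ reds G b b' /\ head_step G (AddOp o a' b') v /\ reds G v n).
Proof.
  intros Hr; apply clos_rt_rt1n in Hr. remember (AddOp o a b) as u eqn:E. revert a b E.
  induction Hr as [|u u' n Hr Hr' IH]; intros a b ->.
  - left; exists a, b; auto using reds_refl.
  - apply clos_rt1n_rt in Hr'. inv Hr.
    all: try (right; do 3 eexists; split; [apply reds_refl|]; split; [apply reds_refl|];
      split; [|exact Hr']; econstructor; eauto; fail).
    + destruct (IH _ _ eq_refl) as [[a' [b' [-> [K1 K2]]]] | [a' [b' [v [K1 [K2 [K3 K4]]]]]]].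
      * left; exists a', b'; repeat split; auto. eapply reds_trans; [apply reds_step|]; eauto.
      * right; exists a', b', v; repeat split; auto. eapply reds_trans; [apply reds_step|]; eauto.
    + destruct (IH _ _ eq_refl) as [[a' [b' [-> [K1 K2]]]] | [a' [b' [v [K1 [K2 [K3 K4]]]]]]].
      * left; exists a', b'; repeat split; auto. eapply reds_trans; [apply reds_step|]; eauto.
      * right; exists a', b', v; repeat split; auto. eapply reds_trans; [apply reds_step|]; eauto.
Qed.

Lemma reds_mul_inv G a b n : reds G (Mul a b) n ->
  (exists a' b', n = Mul a' b' /\ reds G a a' /\ reds G b b') \/
  (exists a' b' v, reds G a a' /\ reds G b b' /\ head_step G (Mul a' b') v /\ reds G v n).
Proof.
  intros Hr; apply clos_rt_rt1n in Hr. remember (Mul a b) as u eqn:E. revert a b E.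
  induction Hr as [|u u' n Hr Hr' IH]; intros a b ->.
  - left; exists a, b; auto using reds_refl.
  - apply clos_rt1n_rt in Hr'. inv Hr.
    all: try (right; do 3 eexists; split; [apply reds_refl|]; split; [apply reds_refl|];
      split; [|exact Hr']; econstructor; eauto; fail).
    + destruct (IH _ _ eq_refl) as [[a' [b' [-> [K1 K2]]]] | [a' [b' [v [K1 [K2 [K3 K4]]]]]]].
      * left; exists a', b'; repeat split; auto. eapply reds_trans; [apply reds_step|]; eauto.
      * right; exists a', b', v; repeat split; auto. eapply reds_trans; [apply reds_step|]; eauto.
    + destruct (IH _ _ eq_refl) as [[a' [b' [-> [K1 K2]]]] | [a' [b' [v [K1 [K2 [K3 K4]]]]]]].
      * left; exists a', b'; repeat split; auto. eapply reds_trans; [apply reds_step|]; eauto.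
      * right; exists a', b', v; repeat split; auto. eapply reds_trans; [apply reds_step|]; eauto.
Qed.

Lemma FF_combine_inv (f : tm -> tm -> tm) G L ts1 ts2 :
  Forall (fun T => forall a b, has_type G a T -> has_type G b T -> FF G (f a b) -> FF G a /\ FF G b) L ->
  Forall2 (has_type G) ts1 L -> Forall2 (has_type G) ts2 L ->
  Forall (FF G) (map (fun p => f (fst p) (snd p)) (combine ts1 ts2)) ->
  Forall (FF G) ts1 /\ Forall (FF G) ts2.
Proof.
  intros HL H1; revert ts2 HL; induction H1; intros ts2 HL H2 HF; inv H2; simpl in HF; auto.
  inv HF. inv HL. match goal with K : forall a b, _ -> _ -> FF G (f a b) -> _ |- _ =>
    destruct (K x x0); auto end. edestruct IHForall2; eauto.
Qed.

(** Used to recover [t] and [t0] from [t (-) t0]. If the sum is never contracted at the root, its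
    summands are seen in the result; otherwise they are constructors, and the claim passes to their
    parts at smaller types. *)
Lemma FF_addop_inv o T : addable T = true -> forall G a b, has_type G a T -> has_type G b T ->
  FF G (AddOp o a b) -> FF G a /\ FF G b.
Proof.
  induction T using ty_nested_ind; intros HT G x y Hx Hy [n [Hn Hf]].
  all: destruct (reds_addop_inv Hn) as [[a' [b' [-> [H1 H2]]]] | [a' [b' [v [H1 [H2 [H3 H4]]]]]]];
    [simpl in Hf; destruct Hf; split; eexists; eauto|].
  all: pose proof (reds_typing Hx H1) as Ha; pose proof (reds_typing Hy H2) as Hb.
  all: inv H3; inv Ha; inv Hb.
  - assert (HF : FF G (Tup (map (fun p => AddOp o (fst p) (snd p)) (combine ts1 ts2))))
      by (eexists; eauto).
    apply FF_tup_inv in HF.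
    destruct (@FF_combine_inv (AddOp o) G (T :: Ts) ts1 ts2) as [F1 F2]; auto.
    + apply addable_tup in HT. rewrite Forall_forall in *. intros B HB.
      destruct HB as [<- | HB]; [apply IHT | apply H]; auto; apply HT; simpl; auto.
    + split; (eapply FF_back; [eassumption | now apply FF_tup]).
  - assert (HF : FF G (Lam T1 (AddOp o t1 t2))) by (eexists; eauto).
    apply FF_lam_inv in HF. destruct (IHT2 HT (T1 :: G) t1 t2) as [F1 F2]; auto.
    split; (eapply FF_back; [eassumption | now apply FF_lam]).
Qed.

Lemma FF_osum_inv T : addable T = true -> forall G ts t, has_type G (osum t ts) T ->
  FF G (osum t ts) -> FF G t /\ Forall (FF G) ts.
Proof.
  intros HT G ts; induction ts as [|s ts IH]; intros t Ht HF; simpl in *; auto.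
  destruct (IH _ Ht HF) as [H1 H2]. destruct (typing_osum_inv Ht) as [Ha _]. inv Ha.
  destruct (@FF_addop_inv oplus T HT G t s); auto.
Qed.

Lemma FF_mul_base_inv T b : addable T = true -> forall G t s, has_type G t T -> has_type G s (TBase b) ->
  FF G (Mul t s) -> FF G t /\ FF G s.
Proof.
  induction T using ty_nested_ind; intros HT G t s Ht Hs [n [Hn Hf]].
  all: destruct (reds_mul_inv Hn) as [[a' [b' [-> [H1 H2]]]] | [a' [b' [v [H1 [H2 [H3 H4]]]]]]];
    [simpl in Hf; destruct Hf; split; eexists; eauto|].
  all: pose proof (reds_typing Ht H1) as Ha; pose proof (reds_typing Hs H2) as Hb.
  all: inv H3; inv Ha; try (now inv Hb).
  - assert (HF : FF G (Tup (map (fun t => Mul t b') ts))) by (eexists; eauto).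
    apply FF_tup_inv in HF.
    assert (HI : Forall (FF G) ts /\ FF G b').
    { assert (HL : Forall (fun T => forall G t s, has_type G t T -> has_type G s (TBase b) ->
        FF G (Mul t s) -> FF G t /\ FF G s) (T :: Ts)).
      { apply addable_tup in HT. rewrite Forall_forall in *. intros B HB.
        destruct HB as [<- | HB]; [apply IHT | apply H]; auto; apply HT; simpl; auto. }
      match goal with F : Forall2 _ ts _ |- _ => clear - F HL HF Hb; inv F; rename l into l1 end.
      inv HL. simpl in HF. inv HF. destruct (H1 _ _ _ H2 Hb H5) as [F1 F2]. split; auto. constructor; auto.
      clear - H3 H4 H6 Hb. induction H3; simpl in *; inv H4; inv H6; constructor; auto.
      destruct (H2 _ _ _ H Hb H4); assumption. }
    destruct HI. split; (eapply FF_back; [eassumption|]; auto using FF_tup).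
  - assert (HF : FF G (Lam T1 (Mul t0 (shift b')))) by (eexists; eauto).
    apply FF_lam_inv in HF. destruct (IHT2 HT (T1 :: G) t0 (shift b')) as [F1 F2]; auto using typing_shift.
    split; (eapply FF_back; [eassumption|]); eauto using FF_lam, FF_unshift.
Qed.

Lemma FF_mul_combine_inv T G As ts1 ts2 : addable T = true ->
  Forall (fun A => has_dty A = true -> forall T G t s, addable T = true ->
    has_type G t (dty T A) -> has_type G s A -> FF G (Mul t s) -> FF G s) As ->
  Forall (fun A => has_dty A = true) As ->
  Forall2 (has_type G) ts1 (map (dty T) As) -> Forall2 (has_type G) ts2 As ->
  Forall (FF G) (map (fun p => Mul (fst p) (snd p)) (combine ts1 ts2)) -> Forall (FF G) ts2.
Proof.
  intros HT HI HD H1 H2; revert ts1 HI HD H1.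
  induction H2; intros ts1 HI HD H1 HF; simpl in H1; inv H1; inv HI; inv HD; simpl in HF; inv HF;
    constructor; eauto.
Qed.

(** The right factor is what matters: in a summand of the series it is the difference [t (-) t0]. In
    a contracted product of tuples each component of the right factor occurs in one term of the
    resulting sum. *)
Lemma FF_mul_inv A : has_dty A = true -> forall T G t s, addable T = true ->
  has_type G t (dty T A) -> has_type G s A -> FF G (Mul t s) -> FF G s.
Proof.
  induction A using ty_nested_ind; intros HA T0 G t s HT Ht Hs HFF; try discriminate.
  - eapply FF_mul_base_inv; eauto.
  - destruct HFF as [n [Hn Hf]].
    destruct (reds_mul_inv Hn) as [[a' [b' [-> [H1 H2]]]] | [a' [b' [v [H1 [H2 [H3 H4]]]]]]];
      [simpl in Hf; destruct Hf; eexists; eauto|].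
    pose proof (reds_typing Ht H1) as Ha; pose proof (reds_typing Hs H2) as Hb.
    assert (Hv : has_type G v T0).
    { eapply head_typing; eauto. eapply ty_mul; eauto. }
    inv H3; try (match goal with K : is_base _ _ |- _ =>
      destruct (is_base_inv K Hb); discriminate end).
    simpl in Ha. inv Ha. inv Hb.
    eapply FF_back; [eassumption|]. apply FF_tup.
    destruct (FF_osum_inv HT Hv) as [F1 F2]; [eexists; eauto|].
    pose proof (has_dty_tup HA) as HD.
    repeat match goal with K : Forall2 _ (_ :: _) _ |- _ => inv K | K : Forall _ (_ :: _) |- _ => inv K end.
    constructor; [eapply IHA; eauto|].
    eapply (@FF_mul_combine_inv T0 G Ts ts1 ts2); eauto.
Qed.

(* Replaces, at any places, subterms of a tuple type over base types by terms that
   do not mention the variables bound so far; the index counts these. *)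
Record hole_index : Type := HoleIndex { hi_ctx : ctx; hi_depth : nat }.

Definition hi_up A (x : hole_index) : hole_index := HoleIndex (A :: hi_ctx x) (S (hi_depth x)).

Inductive xtuple : ty -> tm -> Prop :=
| xtuple_var b i : xtuple (TBase b) (Var i)
| xtuple_tup A As ts : Forall2 xtuple (A :: As) ts -> xtuple (TTup A As) (Tup ts).

(** The replacement [w] is written outside the [hi_depth] binders crossed so far and shifted past
    them, so it is untouched by whatever is substituted for the variables bound there. *)
Inductive rep : hole_index -> tm -> tm -> Prop :=
| rep_var x i : rep x (Var i) (Var i)
| rep_cong x t w : cong hi_ctx hi_up rep x t w -> rep x t w
| rep_hole x A s w : has_type (hi_ctx x) s A ->
    xtuple A w -> has_type (hi_ctx x) (rename (Nat.add (hi_depth x)) w) A ->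
    rep x s (rename (Nat.add (hi_depth x)) w).

Lemma rep_typing x t w T : has_type (hi_ctx x) t T -> rep x t w -> has_type (hi_ctx x) w T.
Proof.
  revert x w T; induction t using tm_nested_ind; intros x w T0 Ht Hr.
  all: inv Hr; try assumption; try (uniq; assumption).
  all: match goal with K : cong _ _ _ _ _ _ |- _ => inv K end; inv Ht; uniq.
  all: repeat match goal with
    | IH : forall x w T, has_type (hi_ctx x) ?t T -> rep x ?t w -> has_type (hi_ctx x) w T,
      K : rep (hi_up ?A ?x) ?t ?w, Ht : has_type (?A :: _) ?t ?T |- _ =>
      pose proof (IH (hi_up A x) w T Ht K); clear K; simpl in * end.
  all: try (econstructor; eauto; fail).
  constructor.
  match goal with F : Forall2 (has_type _) _ _, F' : Forall2 (rep _) _ _ |- _ => revert F F' end.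
  generalize (T :: Ts); intros L; revert L ts'.
  induction H; intros L ts' HL HF; inv HL; inv HF; constructor; eauto.
Qed.

Lemma rep_refl x t T : has_type (hi_ctx x) t T -> rep x t t.
Proof.
  revert x T; induction t using tm_nested_ind; intros x T0 Ht; inv Ht.
  all: try (constructor; econstructor; simpl; eauto; fail).
  all: try (apply rep_cong; econstructor; simpl; eauto; fail).
  apply rep_cong; constructor.
  match goal with F : Forall2 (has_type _) _ _ |- _ => revert F end.
  generalize (T :: Ts).
  induction H; intros L HL; inv HL; constructor; eauto.
Qed.

Lemma rep_fixfree t x w : rep x t w -> fixfree t -> fixfree w.
Proof.
  assert (Hx : forall A w, xtuple A w -> fixfree w).
  { fix IH 3. intros A w0 Hw. destruct Hw; [exact I|]. apply (fixfree_tup ts).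
    induction H; constructor; eauto. }
  revert x w; induction t using tm_nested_ind; intros x w Hr Hf.
  all: inv Hr; try (apply fixfree_rename; eauto; fail); auto.
  all: match goal with K : cong _ _ _ _ _ _ |- _ => inv K end; simpl in Hf |- *;
    repeat match goal with K : _ /\ _ |- _ => destruct K | |- _ /\ _ => split end; eauto.
  apply (fixfree_tup ts'). apply (fixfree_tup ts) in Hf.
  match goal with F' : Forall2 (rep _) _ _ |- _ => revert F' end. revert ts'.
  induction H; intros ts' HF; inv Hf; inv HF; constructor; eauto.
Qed.

Lemma rep_subst_gen (K : hole_index -> hole_index -> (nat -> tm) -> (nat -> tm) -> Prop)
    (K_up : forall A x y f f', K x y f f' -> K (hi_up A x) (hi_up A y) (ups f) (ups f'))
    (K_rep : forall x y f f' i A, K x y f f' -> nth_error (hi_ctx x) i = Some A ->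
       has_type (hi_ctx y) (f i) A /\ rep y (f i) (f' i))
    (K_hole : forall x y f f' i, K x y f f' -> f' (hi_depth x + i) = Var (hi_depth y + i)) :
  forall t x y f f' w T, K x y f f' -> has_type (hi_ctx x) t T -> rep x t w ->
  rep y (subst f t) (subst f' w).
Proof.
  assert (Hrep : forall x y f f' t w T, K x y f f' -> has_type (hi_ctx x) t T -> rep x t w ->
    (cong hi_ctx hi_up rep x t w -> cong hi_ctx hi_up rep y (subst f t) (subst f' w)) ->
    rep y (subst f t) (subst f' w)).
  { intros x y f f' t w T HK Ht Hr Hc. inv Hr.
    - inv Ht. eapply K_rep; eauto.
    - apply rep_cong; auto.
    - assert (E : subst f' (rename (Nat.add (hi_depth x)) w0) = rename (Nat.add (hi_depth y)) w0).
      { rewrite subst_rename, rename_subst_var. apply subst_ext. intros i; eapply K_hole; eauto. }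
      rewrite E. uniq. eapply rep_hole; eauto.
      + eapply typing_subst; eauto. intros; eapply K_rep; eauto.
      + rewrite <- E. eapply typing_subst; eauto. intros i B _ Ei.
        destruct (K_rep _ _ _ _ _ _ HK Ei). eapply rep_typing; eauto. }
  induction t using tm_nested_ind; intros x y f f' w T0 HK Ht Hr;
    (eapply Hrep; eauto); intros Hc; inv Hc; inv Ht; uniq; simpl.
  all: try (econstructor; eauto; fail).
  - constructor. clear Hr.
    match goal with F : Forall2 (has_type _) _ _, F' : Forall2 (rep _) _ _ |- _ => revert F F' end.
    generalize (T :: Ts); intros L; revert L ts'.
    induction H; intros L ts' HL HF; inv HL; inv HF; simpl; constructor; eauto.
  - match goal with K1 : has_type _ t2 ?A |- _ => apply cong_der with A end; eauto;
      try (eapply typing_subst; [eassumption|]; intros; eapply K_rep; eassumption).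
  - match goal with K1 : has_type _ t1 ?A |- _ => apply cong_int with A end; eauto;
      try (eapply typing_subst; [eassumption|]; intros; eapply K_rep; eassumption).
  - match goal with K1 : has_type _ t1 (TSum ?A ?C) |- _ => apply cong_case with A C end; eauto;
      try (eapply typing_subst; [eassumption|]; intros; eapply K_rep; eassumption).
Qed.

Lemma rep_rename x y r t w T : has_type (hi_ctx x) t T -> rep x t w ->
  renok r (hi_ctx x) (hi_ctx y) -> (forall i, r (hi_depth x + i) = hi_depth y + i) ->
  rep y (rename r t) (rename r w).
Proof.
  intros Ht Hp Hr Hd. rewrite 2!rename_subst_var.
  apply (@rep_subst_gen (fun x y f f' => exists r, (forall i, f i = Var (r i) /\ f' i = Var (r i)) /\
    renok r (hi_ctx x) (hi_ctx y) /\ (forall i, r (hi_depth x + i) = hi_depth y + i)))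
    with (x := x) (T := T); auto.
  - clear. intros A x y f f' [r [Hf [Hr Hd]]]. exists (upr r). split; [|split].
    + intros [|i]; simpl; auto. destruct (Hf i) as [-> ->]. auto.
    + now apply renok_up.
    + intros i; simpl. now rewrite Hd.
  - clear. intros x y f f' i A [r [Hf [Hr Hd]]] E. destruct (Hf i) as [-> ->].
    split; [constructor; auto | apply rep_var].
  - clear. intros x y f f' i [r [Hf [Hr Hd]]]. destruct (Hf (hi_depth x + i)) as [_ ->]. now rewrite Hd.
  - exists r; auto.
Qed.

Lemma rep_subst x y f f' t w T : has_type (hi_ctx x) t T -> rep x t w ->
  (forall i A, nth_error (hi_ctx x) i = Some A -> has_type (hi_ctx y) (f i) A /\ rep y (f i) (f' i)) ->
  (forall i, f' (hi_depth x + i) = Var (hi_depth y + i)) ->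
  rep y (subst f t) (subst f' w).
Proof.
  intros Ht Hp Hf Hd.
  apply (@rep_subst_gen (fun x y f f' => (forall i A, nth_error (hi_ctx x) i = Some A ->
      has_type (hi_ctx y) (f i) A /\ rep y (f i) (f' i)) /\
    (forall i, f' (hi_depth x + i) = Var (hi_depth y + i)))) with (x := x) (T := T); auto.
  - clear. intros A x y f f' [Hf Hd]. split.
    + intros [|i] B E; simpl in *.
      * split; [now constructor | apply rep_var].
      * destruct (Hf i B E) as [H1 H2]. split; [now apply typing_shift|].
        eapply rep_rename; eauto. intros j C; auto.
    + intros i; simpl. now rewrite Hd.
  - clear. intros x y f f' i A [Hf Hd] E; auto.
  - clear. intros x y f f' i [Hf Hd]; auto.
Qed.

(** The point is that a constructor on the left stays one on the right. At a base type there is no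
    well-typed constructor, so nothing can be lost; at a tuple type the replacement is a tuple too,
    and its components are again replacements of the components. *)
Lemma rep_compatible : compatible hi_ctx hi_ctx hi_up rep.
Proof.
  split; try reflexivity.
  - intros; now apply rep_cong.
  - intros; apply rep_var.
  - intros x t w T Ht Hr Hi. inv Hr; [discriminate | assumption |].
    uniq. match goal with K : xtuple _ _ |- _ => inv K end; [destruct t; try discriminate; inv Ht|].
    destruct t; try discriminate; inv Ht. constructor. simpl in H1. inv H1.
    match goal with F1 : Forall2 (has_type _) ts0 _, F2 : Forall2 (has_type _) (map _ _) _, F3 : Forall2 xtuple _ _ |- _ =>
      clear - F1 F2 F3; revert F1 F2 F3 end.
    generalize (A0 :: As); intros L F1; revert ts.
    induction F1; intros ts F2 F3; inv F3; simpl in F2; inv F2; simpl; constructor; auto.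
    eapply rep_hole; eauto.
  - intros; eapply rep_typing; eauto.
  - intros A x t w T Ht Hr. eapply rep_rename; eauto. intros i B; auto.
  - intros A B x t w T Ht Hr. apply rep_rename with (x := hi_up A (hi_up B x)) (T := T); [exact Ht | exact Hr | intros [|[|i]] C; auto | intros i; reflexivity].
  - intros A x t w s s' T Ht Hs Hr Hrs.
    apply rep_subst with (x := hi_up A x) (T := T); [exact Ht | exact Hr | | intros i; reflexivity].
    intros [|i] B E; simpl in *; [|split; [now constructor | apply rep_var]].
    injection E as <-; auto.
  - intros A B x t w s s' T Ht Hs Hr Hrs.
    apply rep_subst with (x := hi_up A x) (T := T); [exact Ht | exact Hr | | intros i; reflexivity].
    intros [|i] C E; simpl in *; [|split; [now constructor | apply rep_var]].
    injection E as <-; auto.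
Qed.

(** A hole accepts every term of its type, and reduction preserves types; so a step inside the
    replaced term leaves the replacement as it is. *)
Lemma rep_or x t w T : has_type (hi_ctx x) t T -> rep x t w ->
  cong hi_ctx hi_up rep x t w \/ (forall v, par (hi_ctx x) t v -> rep x v w).
Proof.
  intros Ht Hr. inv Hr; [right | now left | right].
  - intros v Hv. inv Hv; [apply rep_var | |]; inv H.
  - intros v Hv. eapply rep_hole; [eapply par_typing; [exact H | exact Hv] | eassumption | assumption].
Qed.

(** The reduction of [App f t] is simulated with [w] in place of [t], and replacing parts of a
    [Fix]-free term by tuples of variables leaves it [Fix]-free. *)
Lemma FF_app_xtuple G T T' f t w : has_type G f (TArr T T') -> has_type G t T ->
  has_type G w T -> xtuple T w -> FF G (App f t) -> FF G (App f w).
Proof.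
  intros Hf Ht Hw Hx [n [Hn Hff]].
  assert (Hty : has_type G (App f t) T') by (econstructor; eauto).
  destruct (@reds_simulation Sg hole_index (@hi_ctx) (@hi_ctx) hi_up rep rep_compatible rep_or
    (HoleIndex G 0) (App f t) n (App f w) T') as [z [Hz Hz']]; auto.
  - apply rep_cong. constructor; [eapply rep_refl; eauto|].
    assert (E : rename (Nat.add 0) w = w) by (rewrite rename_subst_var; now apply subst_id).
    replace (rep (HoleIndex G 0) t w) with (rep (HoleIndex G 0) t (rename (Nat.add 0) w)) by now rewrite E.
    apply (@rep_hole (HoleIndex G 0) T); auto.
    change (has_type G (rename (Nat.add 0) w) T). now rewrite E.
  - exists z; split; [assumption | eapply rep_fixfree; eauto].
Qed.

(** * Irreducible terms are normal forms *)

Definition ictx G : Prop := forall i A, nth_error G i = Some A -> exists a, A = ity_ty a.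

Lemma ictx_cons G a : ictx G -> ictx (ity_ty a :: G).
Proof. intros H [|i] A E; simpl in E; [injection E as <-|]; eauto. Qed.

Lemma irr_not_head G t v : irr G t -> ~ head_step G t v.
Proof. intros H Hh; eapply H, head_red, Hh. Qed.

Lemma ity_has_dty (a : ity (base Sg)) : has_dty (ity_ty a) = true -> exists b, a = IBase b.
Proof. destruct a; simpl; [eauto | discriminate]. Qed.

(** The three claims are proved together. An irreducible term that is no constructor is headed by
    constants and variables of interpretable type, and so has such a type itself. Interpretable
    types contain no tuples and no sums; therefore projections and cases are never stuck, and a
    point of differentiation, a bound or a right factor that is no constructor is of base type. *)
Lemma irr_nf t : forall G T, ictx G -> has_type G t T -> irr G t ->
  nf G t /\ (intro t = false -> nb G t /\ exists a, T = ity_ty a) /\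
  (forall a, T = ity_ty a -> interpretable t).
Proof.
  assert (Hnb : forall G t T, nb G t -> (exists a, T = ity_ty a) -> interpretable t ->
    nf G t /\ (intro t = false -> nb G t /\ exists a, T = ity_ty a) /\
    (forall a, T = ity_ty a -> interpretable t)) by (intros; split; [now constructor | auto]).
  assert (Hb : forall G s A, has_dty A = true ->
    (intro s = false -> nb G s /\ exists a, A = ity_ty a) -> intro s = false -> exists b, A = TBase b).
  { intros G s A HA H Hi. destruct (H Hi) as [_ [a ->]]. destruct (ity_has_dty HA) as [b ->].
    exists b; reflexivity. }
  assert (Hi0 : forall G s A, has_dty A = true -> has_type G s A -> intro s = true ->
    exists ss A0 As, s = Tup ss /\ A = TTup A0 As /\ Forall2 (has_type G) ss (A0 :: As)).
  { intros G s A HA Hs Hi. destruct s; try discriminate; inv Hs; try discriminate; eauto 7. }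
  induction t using tm_nested_ind; intros G T0 HG Ht Hi.
  - inv Ht. apply Hnb; simpl; eauto. constructor.
  - inv Ht. destruct (HG _ _ H1) as [a ->]. apply Hnb; simpl; eauto. econstructor; eauto.
  - inv Ht. split; [|split].
    + apply nf_lam. intros t' Hr. eapply Hi. eapply red_in_lam; eauto.
    + discriminate.
    + intros [|a c] E; inv E. simpl. split; [eauto|].
      eapply IHt; [apply ictx_cons; eauto | eauto | irr_sub | reflexivity].
  - inv Ht.
    edestruct (IHt1 G) as [_ [N1 I1]]; [exact HG | eassumption | irr_sub |].
    edestruct (IHt2 G) as [N2 [_ I2]]; [exact HG | eassumption | irr_sub |].
    assert (Hn : intro t1 = false).
    { destruct t1; auto; inv H2. exfalso; eapply irr_not_head; [exact Hi | constructor]. }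
    destruct (N1 Hn) as [B1 [[|a c] E]]; inv E.
    apply Hnb; [now constructor | eauto|].
    split; [apply (I1 (IArr a c)) | apply (I2 a)]; reflexivity.
  - inv Ht. split; [|split; [discriminate | intros [|] E; discriminate]].
    apply nf_tup. apply irr_tup in Hi.
    match goal with F : Forall2 _ ts _ |- _ => revert F end. generalize (T :: Ts).
    induction H; intros L F; inv F; inv Hi; constructor; eauto. eapply H; eauto.
  - inv Ht. edestruct (IHt G) as [_ [N1 I1]]; [exact HG | eassumption | irr_sub |]. exfalso.
    destruct t; try (destruct (N1 eq_refl) as [_ [[|] E]]; discriminate); try (match goal with K : has_type _ _ _ |- _ => now inv K end).
    inv_intro. match goal with F : Forall2 _ ts _ |- _ => destruct (Forall2_nth_error_r F ltac:(eassumption)) as [u [Eu _]] end.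
    eapply irr_not_head; [exact Hi | eapply head_proj; eauto].
  - inv Ht.
    edestruct (IHt1 G) as [N1 [B1 I1]]; [exact HG | eassumption | irr_sub |].
    edestruct (IHt2 G) as [N2 [B2 I2]]; [exact HG | eassumption | irr_sub |].
    destruct (intro t1) eqn:E1; [destruct (intro t2) eqn:E2|].
    + exfalso. destruct t1; try discriminate; inv_intro; try discriminate;
        destruct t2; try discriminate; inv_intro; eapply irr_not_head; try exact Hi.
      * constructor.
      * constructor. repeat match goal with F : Forall2 _ _ _ |- _ => apply Forall2_length in F end.
        simpl in *; lia.
    + destruct (B2 eq_refl) as [Nb [a ->]]. apply Hnb; simpl; eauto. now apply nb_addop2.
    + destruct (B1 eq_refl) as [Nb [a ->]]. apply Hnb; simpl; eauto. now apply nb_addop1.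
  - inv Ht.
    edestruct (IHt1 G) as [N1 [B1 I1]]; [exact HG | eassumption | irr_sub |].
    edestruct (IHt2 G) as [N2 [B2 I2]]; [exact HG | eassumption | irr_sub |].
    destruct (Bool.bool_dec (intro t2) true) as [E2 | E2%Bool.not_true_is_false].
    + exfalso. match goal with D : has_dty _ = true, K : has_type _ t2 _ |- _ =>
        destruct (Hi0 _ _ _ D K E2) as [ss [A0 [As [-> [-> Hss]]]]] end.
      destruct t1; try (destruct (B1 eq_refl) as [_ [[|] E]]; discriminate); inv_intro.
      repeat match goal with F : Forall2 _ _ (_ :: _) |- _ => inv F end. eapply irr_not_head; [exact Hi | apply head_mul_between_tup].
      repeat match goal with F : Forall2 _ _ _ |- _ => apply Forall2_length in F end.
      rewrite length_map in *. congruence.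
    + match goal with D : has_dty _ = true |- _ =>
        destruct (Hb _ _ _ D B2 E2) as [b ->] end. simpl in *.
      destruct (B2 E2) as [Nb2 [a2 Ea2]].
      assert (E1 : intro t1 = false).
      { assert (Hbs : is_base G t2) by (exists b; auto).
        destruct t1; auto; exfalso; eapply irr_not_head; try exact Hi; now constructor. }
      destruct (B1 E1) as [Nb [a ->]]. apply Hnb; simpl; eauto. now constructor.
  - inv Ht.
    edestruct (IHt2 G) as [N2 [B2 I2]]; [exact HG | eassumption | irr_sub |].
    destruct (Bool.bool_dec (intro t2) true) as [E2 | E2%Bool.not_true_is_false].
    + exfalso. match goal with D : has_dty _ = true, K : has_type _ t2 _ |- _ =>
        destruct (Hi0 _ _ _ D K E2) as [ss [A0 [As [-> [-> Hss]]]]] end.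
      eapply irr_not_head; [exact Hi | constructor].
    + match goal with D : has_dty _ = true |- _ =>
        destruct (Hb _ _ _ D B2 E2) as [b ->] end. simpl in *.
      destruct (B2 E2) as [Nb2 [a2 Ea2]].
      edestruct (IHt1 (TBase b :: G)) as [N1 [B1 I1]]; [exact (@ictx_cons _ (IBase b) HG) | eassumption | |].
      { intros u Hu. eapply Hi. eapply red_in_der1; eauto. }
      assert (E1 : intro t1 = false).
      { assert (Hbs : is_base G t2) by (exists b; auto).
        destruct t1; auto; exfalso; eapply irr_not_head; try exact Hi; now constructor. }
      destruct (B1 E1) as [Nb [a ->]]. apply Hnb; simpl; eauto. econstructor; eauto.
  - inv Ht.
    edestruct (IHt1 G) as [N1 [B1 I1]]; [exact HG | eassumption | irr_sub |].
    edestruct (IHt2 G) as [N2 [B2 I2]]; [exact HG | eassumption | irr_sub |].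
    (* Two tuples as bounds would form a redex, and a bound that is no constructor forces the base
       type, which excludes a tuple as the other bound. *)
    assert (HN : intro t1 = false /\ intro t2 = false).
    { destruct (Bool.bool_dec (intro t1) true) as [E1 | E1%Bool.not_true_is_false],
        (Bool.bool_dec (intro t2) true) as [E2 | E2%Bool.not_true_is_false]; auto; exfalso.
      - match goal with D : has_dty _ = true, K : has_type _ t1 _ |- _ =>
        destruct (Hi0 _ _ _ D K E1) as [ss [A0 [As [-> [-> Hss]]]]] end.
        match goal with D : has_dty _ = true, K : has_type _ t2 _ |- _ =>
        destruct (Hi0 _ _ _ D K E2) as [ss' [A0' [As' [-> [EA Hss']]]]] end. inv EA.
        inv Hss. inv Hss'. eapply irr_not_head; [exact Hi | eapply head_int_between_tup; [|reflexivity]].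
        repeat match goal with F : Forall2 _ _ _ |- _ => apply Forall2_length in F end. simpl; congruence.
      - match goal with D : has_dty _ = true |- _ =>
        destruct (Hb _ _ _ D B2 E2) as [b ->] end. destruct t1; try discriminate; inv_intro.
      - match goal with D : has_dty _ = true |- _ =>
        destruct (Hb _ _ _ D B1 E1) as [b ->] end. destruct t2; try discriminate; inv_intro. }
    destruct HN as [E1 E2].
    match goal with D : has_dty _ = true |- _ =>
        destruct (Hb _ _ _ D B2 E2) as [b ->] end. simpl in *.
    destruct (B2 E2) as [Nb2 [a2 Ea2]]. destruct (B1 E1) as [Nb1 [a1 Ea1]].
    edestruct (IHt3 (TBase b :: G)) as [N3 [B3 I3]]; [exact (@ictx_cons _ (IBase b) HG) | eassumption | |].
    { intros u Hu. eapply Hi. eapply red_in_int3; eauto. }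
    assert (E3 : intro t3 = false).
    { assert (Hbs : is_base G t1) by (exists b; auto). assert (Hbs' : is_base G t2) by (exists b; auto).
      destruct t3; auto; exfalso; eapply irr_not_head; try exact Hi; now constructor. }
    destruct (B3 E3) as [Nb [a ->]]. apply Hnb; simpl; eauto 6. econstructor; eauto.
  - inv Ht. split; [|split; [discriminate | intros [|] E; discriminate]].
    apply nf_inl. eapply IHt; eauto. irr_sub.
  - inv Ht. split; [|split; [discriminate | intros [|] E; discriminate]].
    apply nf_inr. eapply IHt; eauto. irr_sub.
  - inv Ht. edestruct (IHt1 G) as [_ [N1 I1]]; [exact HG | eassumption | irr_sub |]. exfalso.
    destruct t1; try (destruct (N1 eq_refl) as [_ [[|] E]]; discriminate); try (match goal with K : has_type G (_ _) (TSum _ _) |- _ => now inv K end).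
    all: eapply irr_not_head; [exact Hi | constructor].
  - exfalso. eapply irr_not_head; [exact Hi | constructor].
Qed.

End NormalForms.

(** * Values of reducts *)

Section Values.
Variables (Sg : sig) (M : model Sg).
Hypothesis HM : lawful M.
Local Notation tm := (tm Sg).
Local Notation ty := (ty (base Sg)).
Local Notation ity := (ity (base Sg)).
Local Notation ctx := (ctx Sg).
Local Notation env := (env Sg).
Implicit Types (G D : ctx) (t s u v w n : tm) (T A B C : ty) (a : ity) (r : env).

Lemma ev_rename t : forall r r' (p : nat -> nat) a (c : cst a),
  (forall i x, nth_error r i = Some x -> nth_error r' (p i) = Some x) ->
  ev M t r c -> ev M (rename p t) r' c.
Proof.
  assert (Hup : forall r r' (p : nat -> nat) x,
    (forall i x, nth_error r i = Some x -> nth_error r' (p i) = Some x) ->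
    forall i y, nth_error (x :: r) i = Some y -> nth_error (x :: r') (upr p i) = Some y).
  { intros r r' p x H [|i] y; simpl; auto. }
  induction t using tm_nested_ind; intros r r' p z c0 Hp He; simpl in *; try easy; auto.
  - destruct z as [|a1 a2]; [easy|]. destruct He as [-> He]. split; auto.
    intros x. eapply IHt; eauto.
  - destruct He as [a1 [f [x [H1 [H2 ->]]]]]. exists a1, f, x; eauto.
  - destruct He as [x [y [H1 [H2 H3]]]]. exists x, y; eauto.
  - destruct He as [x [b [y [H1 [H2 H3]]]]]. exists x, b, y; eauto.
  - destruct He as [b [F [x [H1 [H2 H3]]]]]. exists b, F, x; repeat split; eauto.
  - destruct He as [b [x [y [F [H1 [H2 [H3 H4]]]]]]]. exists b, x, y, F; repeat split; eauto.
Qed.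

Lemma ev_shift t r x a (c : cst a) : ev M t r c -> ev M (shift t) (x :: r) c.
Proof. apply ev_rename; auto. Qed.

Lemma ev_swap t r x y a (c : cst a) : ev M t (x :: y :: r) c -> ev M (swap t) (y :: x :: r) c.
Proof. apply ev_rename. intros [|[|i]] z; auto. Qed.

Lemma ev_subst t : forall r r' (f : nat -> tm) a (c : cst a),
  (forall i a (c : cst a), nth_error r i = Some (existT _ a c) -> ev M (f i) r' c) ->
  ev M t r c -> ev M (subst f t) r' c.
Proof.
  assert (Hup : forall r r' (f : nat -> tm) x,
    (forall i a (c : cst a), nth_error r i = Some (existT _ a c) -> ev M (f i) r' c) ->
    forall i a (c : cst a), nth_error (x :: r) i = Some (existT _ a c) -> ev M (ups f i) (x :: r') c).
  { intros r r' f x Hf [|i] a c E; simpl in *; auto. apply ev_shift; auto. }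
  induction t using tm_nested_ind; intros r r' f z c0 Hf He; simpl in *; try easy; auto.
  - destruct z as [|a1 a2]; [easy|]. destruct He as [-> He]. split; auto.
    intros x. eapply IHt; eauto.
  - destruct He as [a1 [g [x [H1 [H2 ->]]]]]. exists a1, g, x; eauto.
  - destruct He as [x [y [H1 [H2 H3]]]]. exists x, y; eauto.
  - destruct He as [x [b [y [H1 [H2 H3]]]]]. exists x, b, y; eauto.
  - destruct He as [b [F [x [H1 [H2 H3]]]]]. exists b, F, x; repeat split; eauto.
  - destruct He as [b [x [y [F [H1 [H2 [H3 H4]]]]]]]. exists b, x, y, F; repeat split; eauto.
Qed.

(** Tuples, injections and [Fix] have no value, so only the rules for abstractions matter; what
    these express is that the operations on function constants are pointwise. *)
Lemma ev_red G t t' : red G t t' -> forall r a (c : cst a), ev M t r c -> ev M t' r c.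
Proof.
  induction 1; intros r0 z c0 He; simpl in He; try easy.
  (* A body without a value contradicts the evaluation of a derivative or an integral, because the
     value of the point or bound inhabits the domain. *)
  all: try (repeat match goal with K : exists _, _ |- _ => destruct K | K : _ /\ _ |- _ => destruct K end;
    match goal with
    | K : False |- _ => destruct K
    | K : forall y : cst (IBase ?b), False, x : cst (IBase ?b) |- _ => destruct (K x) end).
  - destruct He as [a1 [g [x [[_ H1] [H2 ->]]]]].
    eapply ev_subst; [|apply (H1 x)]. intros [|i] a c E; simpl in *; auto.
    injection E as E1 E2; subst. apply inj_pair2 in E2; subst; auto.
  - destruct He as [b [F [x [H1 [H2 H3]]]]].
    destruct z as [|a1 a2]; [destruct (H1 x)|]. simpl.
    split; [apply (H1 x)|]. intros y. exists b, (fun z => app M (F z) y), x.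
    split; [|split]; [|now apply ev_shift | apply H3].
    intros z. apply ev_swap, (H1 z).
  - destruct He as [b0 [x [y [F [H1 [H2 [H3 H4]]]]]]].
    destruct z as [|a1 a2]; [destruct (H3 x)|]. simpl.
    split; [apply (H3 x)|]. intros w. exists b0, x, y, (fun z => app M (F z) w).
    split; [|split; [|split]]; [now apply ev_shift | now apply ev_shift | | apply H4].
    intros z. apply ev_swap, (H3 z).
  - destruct He as [x [y [H1 [H2 H3]]]]. destruct z as [|a1 a2]; [easy|]. simpl.
    destruct H1 as [-> H1], H2 as [_ H2]. split; auto.
    intros z. exists (app M x z), (app M y z). auto.
  - destruct He as [x [b [y [H1 [H2 H3]]]]]. destruct z as [|a1 a2]; [easy|]. simpl.
    destruct H1 as [-> H1]. split; auto.
    intros z. exists (app M x z), b, y. auto using ev_shift.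
  - destruct z as [|a1 a2]; [easy|]. destruct He as [-> He]. split; auto.
  - destruct He as [a1 [f [x [H1 [H2 ->]]]]]. exists a1, f, x; eauto.
  - destruct He as [a1 [f [x [H1 [H2 ->]]]]]. exists a1, f, x; eauto.
  - destruct He as [x [y [H1 [H2 H3]]]]. exists x, y; eauto.
  - destruct He as [x [y [H1 [H2 H3]]]]. exists x, y; eauto.
  - destruct He as [x [b [y [H1 [H2 H3]]]]]. exists x, b, y; eauto.
  - destruct He as [x [b [y [H1 [H2 H3]]]]]. exists x, b, y; eauto.
  - destruct He as [b [F [x [H1 [H2 H3]]]]]. exists b, F, x; repeat split; eauto.
  - destruct He as [b [F [x [H1 [H2 H3]]]]]. exists b, F, x; repeat split; eauto.
  - destruct He as [b0 [x [y [F [H1 [H2 [H3 H4]]]]]]]. exists b0, x, y, F; repeat split; eauto.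
  - destruct He as [b0 [x [y [F [H1 [H2 [H3 H4]]]]]]]. exists b0, x, y, F; repeat split; eauto.
  - destruct He as [b0 [x [y [F [H1 [H2 [H3 H4]]]]]]]. exists b0, x, y, F; repeat split; eauto.
Qed.

Lemma ev_reds G t t' r a (c : cst a) : reds G t t' -> ev M t r c -> ev M t' r c.
Proof. intros Hr; revert c; induction Hr; intros c He; eauto using ev_red. Qed.

Lemma interpretable_rename t : forall p, interpretable t -> interpretable (rename p t).
Proof. induction t using tm_nested_ind; intros p Ht; simpl in *; intuition. Qed.

Lemma interpretable_subst t : forall f : nat -> tm, interpretable t ->
  (forall i, interpretable (f i)) -> interpretable (subst f t).
Proof.
  induction t using tm_nested_ind; intros f Ht Hf; simpl in *; auto.
  all: assert (Hup : forall i, interpretable (ups f i))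
    by (intros [|i']; simpl; auto; apply interpretable_rename; auto).
  all: intuition.
Qed.

Lemma interpretable_red G t t' : red G t t' -> interpretable t -> interpretable t'.
Proof.
  induction 1; simpl; intros Hi; try easy; try tauto.
  - apply interpretable_subst; [tauto|]. intros [|i]; simpl; tauto.
  - intuition; unfold swap, shift; now apply interpretable_rename.
  - intuition; unfold swap, shift; now apply interpretable_rename.
  - intuition; unfold swap, shift; now apply interpretable_rename.
Qed.

Lemma interpretable_reds G t t' : reds G t t' -> interpretable t -> interpretable t'.
Proof. induction 1; eauto using interpretable_red. Qed.

Lemma ity_ty_inj a a' : ity_ty a = ity_ty a' -> a = a'.
Proof.
  revert a'; induction a; intros [] E; simpl in E; try discriminate; inv E; f_equal; auto.
Qed.

(* Agreement of types up to the codomains of arrows with an empty domain: there [ev]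
   does not determine the type of an abstraction. *)
Fixpoint agree a T : Prop :=
  match a, T with
  | IBase b, TBase b' => b = b'
  | IArr a1 a2, TArr A C => ity_ty a1 = A /\ (inhabited (cst a1) -> agree a2 C)
  | _, _ => False
  end.

Lemma agree_refl a : agree a (ity_ty a).
Proof. induction a; simpl; auto. Qed.

Lemma ev_agree t : forall r a T (c : cst a), has_type (env_ctx r) t T -> ev M t r c -> agree a T.
Proof.
  assert (Hb : forall b A, agree (IBase b) A -> A = TBase b)
    by (intros b [] E; simpl in E; [congruence | easy ..]).
  induction t using tm_nested_ind; intros r z T0 c0 Ht He; simpl in He; try easy; inv Ht.
  - pose proof (f_equal (@projT1 _ _) He) as E; simpl in E; subst. apply agree_refl.
  - match goal with K : nth_error _ _ = Some T0 |- _ => rename K into E end.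
    unfold env_ctx in E. rewrite nth_error_map, He in E. injection E as <-. apply agree_refl.
  - destruct z as [|a1 a2]; [easy|]. destruct He as [-> He].
    simpl; split; auto. intros [x]. eapply IHt; [|apply (He x)]. assumption.
  - destruct He as [a1 [f [x [H1 [H3 ->]]]]].
    match goal with K : has_type _ t1 _ |- _ => destruct (IHt1 _ _ _ _ K H1) as [_ K'] end.
    apply K'. now constructor.
  - destruct He as [x [y [K1 [K2 K3]]]]. eauto.
  - destruct He as [x [b [y [K1 [K K3]]]]].
    match goal with K' : has_type _ t2 _ |- _ => pose proof (Hb _ _ (IHt2 _ _ _ _ K' K)); subst end.
    simpl in *. eauto.
  - destruct He as [b [F [x [K1 [K K3]]]]].
    match goal with K' : has_type _ t2 _ |- _ => pose proof (Hb _ _ (IHt2 _ _ _ _ K' K)); subst end.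
    simpl in *. eapply (IHt1 (existT _ (IBase b) x :: r)); eauto.
  - destruct He as [b [x [y [F [K [K2 [K3 K4]]]]]]].
    match goal with K' : has_type _ t1 _ |- _ => pose proof (Hb _ _ (IHt1 _ _ _ _ K' K)); subst end.
    simpl in *. eapply (IHt3 (existT _ (IBase b) x :: r)); eauto.
Qed.

Lemma op_at_det o a : forall x y z z' : cst a, op_at M o x y z -> op_at M o x y z' -> z = z'.
Proof.
  induction a; simpl; intros x y z z' H1 H2; [congruence|].
  apply (app_ext HM). intros u. eauto.
Qed.

Lemma mul_at_det a b (y : cst (IBase b)) : forall x z z' : cst a, mul_at M x y z -> mul_at M x y z' -> z = z'.
Proof.
  induction a; simpl; intros x z z' H1 H2; [congruence|].
  apply (app_ext HM). intros u. eauto.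
Qed.

Lemma der_at_det b a (x : cst (IBase b)) : forall (F : cst (IBase b) -> cst a) z z',
  der_at M F x z -> der_at M F x z' -> z = z'.
Proof.
  induction a; simpl; intros F z z' H1 H2; [congruence|].
  apply (app_ext HM). intros u. eapply IHa2; [apply H1 | apply H2].
Qed.

Lemma int_at_det b a (x y : cst (IBase b)) : forall (F : cst (IBase b) -> cst a) z z',
  int_at M x y F z -> int_at M x y F z' -> z = z'.
Proof.
  induction a; simpl; intros F z z' H1 H2; [congruence|].
  apply (app_ext HM). intros u. eapply IHa2; [apply H1 | apply H2].
Qed.

(** The interpreter quantifies existentially over the types of intermediate values. Typing pins
    these down through [ev_agree], and extensionality identifies the function constants. *)
Lemma ev_det t : forall r a T (c c' : cst a), has_type (env_ctx r) t T ->
  ev M t r c -> ev M t r c' -> c = c'.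
Proof.
  assert (Hb : forall t r b b' A (x : cst (IBase b)) (x' : cst (IBase b')), has_type (env_ctx r) t A ->
    ev M t r x -> ev M t r x' -> b = b' /\ A = TBase b).
  { intros t0 r b b' A x x' Ht H1 H2.
    pose proof (ev_agree Ht H1) as E1. pose proof (ev_agree Ht H2) as E2.
    destruct A; simpl in *; try easy; subst; auto. }
  induction t using tm_nested_ind; intros r z T0 c0 c1 Ht H1 H2; simpl in H1, H2; try easy; inv Ht.
  - rewrite H1 in H2. now apply inj_pair2 in H2.
  - rewrite H1 in H2. injection H2 as E. now apply inj_pair2 in E.
  - destruct z as [|a1 a2]; [easy|]. destruct H1 as [-> H1], H2 as [_ H2].
    apply (app_ext HM). intros x. eapply IHt; [|apply (H1 x) | apply (H2 x)]. eassumption.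
  - destruct H1 as [a1 [f [x [K1 [K2 ->]]]]]. destruct H2 as [a1' [f' [x' [L1 [L2 ->]]]]].
    match goal with K : has_type _ t1 _ |- _ =>
      pose proof (ev_agree K K1) as [E1 _]; pose proof (ev_agree K L1) as [E2 _] end.
    subst A. apply ity_ty_inj in E2; subst a1'.
    f_equal; eauto.
  - destruct H1 as [x [y [K1 [K2 K3]]]]. destruct H2 as [x' [y' [L1 [L2 L3]]]].
    replace x' with x in * by eauto. replace y' with y in * by eauto.
    eapply op_at_det; eauto.
  - destruct H1 as [x [b [y [K1 [K2 K3]]]]]. destruct H2 as [x' [b' [y' [L1 [L2 L3]]]]].
    match goal with K : has_type _ t2 _ |- _ => destruct (Hb _ _ _ _ _ _ _ K K2 L2); subst end.
    replace x' with x in * by eauto. replace y' with y in * by eauto.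
    eapply mul_at_det; eauto.
  - destruct H1 as [b [F [x [K1 [K2 K3]]]]]. destruct H2 as [b' [F' [x' [L1 [L2 L3]]]]].
    match goal with K : has_type _ t2 _ |- _ => destruct (Hb _ _ _ _ _ _ _ K K2 L2); subst end.
    replace x' with x in * by eauto.
    assert (EF : F' = F).
    { apply functional_extensionality. intros y.
      eapply (IHt1 (existT _ (IBase b') y :: r)); eauto. }
    subst F'. eapply der_at_det; eauto.
  - destruct H1 as [b [x [y [F [K1 [K2 [K3 K4]]]]]]]. destruct H2 as [b' [x' [y' [F' [L1 [L2 [L3 L4]]]]]]].
    match goal with K : has_type _ t1 _ |- _ => destruct (Hb _ _ _ _ _ _ _ K K1 L1); subst end.
    replace x' with x in * by eauto. replace y' with y in * by eauto.
    assert (EF : F' = F).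
    { apply functional_extensionality. intros w.
      eapply (IHt3 (existT _ (IBase b') w :: r)); eauto. }
    subst F'. eapply int_at_det; eauto.
Qed.

(** A term that contains tuples has no value, although it may reduce to a term that has one; hence
    the passage to an interpretable reduct. Nothing is required of [phi] at environments of another
    context. *)
Definition val D a t (phi : env -> cst a) : Prop :=
  exists F, reds D t F /\ interpretable F /\ forall r, env_ctx r = D -> ev M F r (phi r).

Lemma val_ext D a t (phi phi' : env -> cst a) :
  (forall r, env_ctx r = D -> phi r = phi' r) -> val D t phi -> val D t phi'.
Proof.
  intros E [F [H1 [H2 H3]]]. exists F; repeat split; auto. intros r Hr. rewrite <- E; auto.
Qed.

Lemma val_back D a t t' (phi : env -> cst a) : reds D t t' -> val D t' phi -> val D t phi.
Proof.
  intros Hr [F [H1 [H2 H3]]]. exists F; repeat split; auto. eapply reds_trans; eauto.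
Qed.

Lemma val_forward D a t t' T (phi : env -> cst a) : has_type D t T -> reds D t t' ->
  val D t phi -> val D t' phi.
Proof.
  intros Ht Hr [F [H1 [H2 H3]]]. destruct (confluence Ht H1 Hr) as [F' [K1 K2]].
  exists F'; repeat split; eauto using interpretable_reds, ev_reds.
Qed.

Lemma val_det D a t T (phi phi' : env -> cst a) : has_type D t T -> val D t phi -> val D t phi' ->
  forall r, env_ctx r = D -> phi r = phi' r.
Proof.
  intros Ht [F [H1 [H2 H3]]] [F' [H1' [H2' H3']]] r Hr.
  destruct (confluence Ht H1 H1') as [F'' [K1 K2]].
  eapply (@ev_det F''); [rewrite Hr; eapply reds_typing; [|exact K1]; eapply reds_typing; eauto | |];
    eauto using ev_reds.
Qed.

Lemma env_ictx r : ictx (env_ctx r).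
Proof.
  intros i A E. unfold env_ctx in E. rewrite nth_error_map in E.
  destruct (nth_error r i) as [[a c]|]; [|discriminate]. injection E as <-. eauto.
Qed.

(** The context is given by an environment because carriers may be empty: evaluating at [r0]
    produces the default that makes [phi] a total function. *)
Lemma interpretable_val a t r0 : has_type (env_ctx r0) t (ity_ty a) -> interpretable t ->
  exists phi, val (env_ctx r0) t (fun r => phi r : cst a).
Proof.
  intros Ht Hi.
  destruct (ev_total HM Hi Ht) as [c0 _].
  assert (H : forall r, exists c : cst a, env_ctx r = env_ctx r0 -> ev M t r c).
  { intros r. destruct (classic (env_ctx r = env_ctx r0)) as [E | E]; [|exists c0; easy].
    rewrite <- E in Ht. destruct (ev_total HM Hi Ht) as [c Hc]. exists c; auto. }
  exists (fun r => proj1_sig (constructive_indefinite_description _ (H r))).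
  exists t; repeat split; auto using reds_refl.
  intros r Hr. destruct (constructive_indefinite_description _ (H r)) as [c Hc]; simpl; auto.
Qed.

Lemma FF_irr D t T : has_type D t T -> FF D t -> exists n, reds D t n /\ irr D n /\ fixfree n.
Proof.
  intros Ht [m [Hm Hf]]. pose proof (reds_typing Ht Hm) as Htm.
  destruct (fixfree_normalizable Hf Htm) as [n [Hn Hi]].
  exists n; repeat split; auto; [eapply reds_trans; eauto|].
  eapply irr_fixfree; [eapply reds_typing; eauto | assumption].
Qed.

Lemma val_exists a t r0 : has_type (env_ctx r0) t (ity_ty a) -> FF (env_ctx r0) t ->
  exists phi, val (env_ctx r0) t (fun r => phi r : cst a).
Proof.
  intros Ht HF. destruct (FF_irr Ht HF) as [n [Hn [Hi _]]].
  pose proof (reds_typing Ht Hn) as Htn.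
  destruct (irr_nf (env_ictx (r := r0)) Htn Hi) as [_ [_ I]].
  destruct (interpretable_val Htn (I _ eq_refl)) as [phi Hphi].
  exists phi. eapply val_back; eauto.
Qed.

End Values.

(** * Observations at base types *)

Section Observations.
Variables (Sg : sig) (M : model Sg).
Hypothesis HM : lawful M.
Local Notation tm := (tm Sg).
Local Notation ty := (ty (base Sg)).
Local Notation ity := (ity (base Sg)).
Local Notation ctx := (ctx Sg).
Local Notation env := (env Sg).
Implicit Types (G D : ctx) (t s u v w n X : tm) (T A B C : ty) (a : ity) (r : env).

Inductive obs : Type := OProj (j : nat) | OApp (u : tm).

Definition observe (K : list obs) t : tm :=
  fold_left (fun t o => match o with OProj j => Proj j t | OApp u => App t u end) K t.

(** Arguments are closed, so that observations commute with substitution and can be moved below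
    binders. Restricting them to [Fix]-free terms is harmless, as a normalizable argument reduces to
    one. *)
Inductive path : ty -> list obs -> base Sg -> Prop :=
| path_nil b : path (TBase b) [] b
| path_proj j T Ts A K b : nth_error (T :: Ts) j = Some A -> path A K b ->
    path (TTup T Ts) (OProj j :: K) b
| path_app A C u K b : has_type [] u A -> fixfree u -> path C K b ->
    path (TArr A C) (OApp u :: K) b.

Lemma closed_subst u A f : has_type [] u A -> subst f u = u.
Proof.
  intros Hu. rewrite <- (subst_var u) at 2. apply subst_ext_free.
  intros i Hi. destruct (typing_free Hu Hi) as [B E]. destruct i; discriminate.
Qed.

Lemma closed_typing D u A : has_type [] u A -> has_type D u A.
Proof.
  intros Hu. rewrite <- (subst_var u). eapply typing_subst; eauto.
  intros [|i] B _ E; discriminate.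
Qed.

Lemma observe_typing T K b : path T K b -> forall D t, has_type D t T ->
  has_type D (observe K t) (TBase b).
Proof.
  induction 1; intros D t Ht; simpl; auto.
  - apply IHpath. econstructor; eauto.
  - apply IHpath. econstructor; eauto using closed_typing.
Qed.

Lemma observe_reds K : forall D t t', reds D t t' -> reds D (observe K t) (observe K t').
Proof.
  induction K as [|[j|u] K IH]; intros D t t' Hr; simpl; auto.
  - apply IH. now apply reds_proj.
  - apply IH. apply reds_app; auto using reds_refl.
Qed.

Lemma observe_subst T K b : path T K b -> forall f t, subst f (observe K t) = observe K (subst f t).
Proof.
  induction 1; intros f t; simpl; auto.
  - rewrite IHpath. change (subst f (App t u)) with (App (subst f t) (subst f u)).
    replace (subst f u) with u by (symmetry; eapply closed_subst; eauto).
    reflexivity.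
Qed.

Lemma observe_fixfree T K b : path T K b -> forall t, fixfree t -> fixfree (observe K t).
Proof. induction 1; intros t Ht; simpl; auto. apply IHpath. simpl; auto. Qed.

Lemma closed_val a u : has_type [] u (ity_ty a) -> fixfree u ->
  exists x : cst a, forall D, val M D u (fun _ => x).
Proof.
  intros Hu Hf. destruct (@val_exists Sg M HM a u nil Hu (fixfree_FF _ Hf)) as [phi [F [H1 [H2 H3]]]].
  exists (phi nil). intros D. exists F; repeat split; auto.
  - pose proof (reds_rename (D := D) (r := fun i => i) Hu H1) as H.
    rewrite 2!rename_subst_var in H. erewrite 2!closed_subst in H; eauto using reds_typing.
    apply H. intros [|i] A E; discriminate.
  - intros r _. pose proof (reds_typing Hu H1) as HF.
    replace F with (rename (fun i => i) F) by (rewrite rename_subst_var; eapply closed_subst; eauto).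
    apply ev_rename with (r := []); auto. intros [|i] x E; discriminate.
Qed.

Lemma val_app D a c t s (phi : env -> cst (IArr a c)) (psi : env -> cst a) :
  val M D t phi -> val M D s psi -> val M D (App t s) (fun r => app M (phi r) (psi r)).
Proof.
  intros [F [H1 [H2 H3]]] [F' [H1' [H2' H3']]]. exists (App F F').
  split; [now apply reds_app|]. split; [now split|].
  intros r Hr. exists a, (phi r), (psi r); auto.
Qed.

Lemma observe_interpretable T K b : path T K b -> forall a, T = ity_ty a ->
  exists g : cst a -> cst (IBase b),
    (forall D X (phi : env -> cst a), val M D X phi -> val M D (observe K X) (fun r => g (phi r))) /\
    (forall o x y z, op_at M o x y z -> g z = app_op M o (g x) (g y)) /\
    (forall b' x (y : cst (IBase b')) z, mul_at M x y z -> g z = mul M (g x) y) /\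
    (forall b' (F : cst (IBase b') -> cst a) x z, der_at M F x z ->
       g z = der M (fun y => g (F y)) x).
Proof.
  induction 1 as [b | j T Ts A K b E HK IH | A C u K b Hu Hf HK IH]; intros a E'.
  - destruct a as [b'|]; [|discriminate]. simpl in E'. injection E' as <-.
    exists (fun x => x). repeat split; auto.
  - destruct a; discriminate.
  - destruct a as [|a1 a2]; [discriminate|]. simpl in E'. injection E' as -> ->.
    destruct (IH a2 eq_refl) as [g [G1 [G2 [G3 G4]]]].
    destruct (closed_val Hu Hf) as [x0 Hx0].
    exists (fun x => g (app M x x0)). repeat split.
    + intros D X phi HX. simpl. apply (G1 D (App X u) (fun r => app M (phi r) x0)).
      apply (val_app HX (Hx0 D)).
    + intros o x y z Hz. apply G2, (Hz x0).
    + intros b' x y z Hz. apply G3, (Hz x0).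
    + intros b' F x z Hz. apply (G4 b' (fun z => app M (F z) x0)), (Hz x0).
Qed.

Lemma interpretable_choice a t r0 : has_type (env_ctx r0) t (ity_ty a) -> interpretable t ->
  exists phi : env -> cst a, forall r, env_ctx r = env_ctx r0 -> ev M t r (phi r).
Proof.
  intros Ht Hi.
  destruct (ev_total HM Hi Ht) as [c0 _].
  assert (H : forall r, exists c : cst a, env_ctx r = env_ctx r0 -> ev M t r c).
  { intros r. destruct (classic (env_ctx r = env_ctx r0)) as [E | E]; [|exists c0; easy].
    rewrite <- E in Ht. destruct (ev_total HM Hi Ht) as [c Hc]. exists c; auto. }
  exists (fun r => proj1_sig (constructive_indefinite_description _ (H r))).
  intros r Hr. destruct (constructive_indefinite_description _ (H r)) as [c Hc]; simpl; auto.
Qed.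

Lemma val_mul_at r0 a b t s (phi : env -> cst a) (psi : env -> cst (IBase b)) :
  addable (ity_ty a) = true ->
  has_type (env_ctx r0) t (ity_ty a) -> has_type (env_ctx r0) s (TBase b) ->
  val M (env_ctx r0) t phi -> val M (env_ctx r0) s psi ->
  exists chi : env -> cst a, val M (env_ctx r0) (Mul t s) chi /\
    forall r, env_ctx r = env_ctx r0 -> mul_at M (phi r) (psi r) (chi r).
Proof.
  intros Ha Ht Hs [F [H1 [H2 H3]]] [F' [H1' [H2' H3']]].
  pose proof (reds_typing Ht H1) as HF. pose proof (reds_typing Hs H1') as HF'.
  assert (Hty : has_type (env_ctx r0) (Mul F F') (ity_ty a)) by (eapply ty_mul_base; eauto).
  destruct (interpretable_choice Hty) as [chi Hchi]; [now split|].
  exists chi; split.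
  - exists (Mul F F'). split; [now apply reds_mul|]. split; [now split | auto].
  - intros r Hr. destruct (Hchi r Hr) as [x [b' [y [K1 [K2 K3]]]]].
    rewrite <- Hr in HF, HF'. pose proof (ev_agree HF' K2) as E. simpl in E; subst b'.
    replace (phi r) with x by exact (ev_det HM HF K1 (H3 r Hr)).
    replace (psi r) with y by exact (ev_det HM HF' K2 (H3' r Hr)). assumption.
Qed.

Lemma val_op_at o r0 a t s (phi psi : env -> cst a) :
  addable (ity_ty a) = true ->
  has_type (env_ctx r0) t (ity_ty a) -> has_type (env_ctx r0) s (ity_ty a) ->
  val M (env_ctx r0) t phi -> val M (env_ctx r0) s psi ->
  exists chi : env -> cst a, val M (env_ctx r0) (AddOp o t s) chi /\
    forall r, env_ctx r = env_ctx r0 -> op_at M o (phi r) (psi r) (chi r).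
Proof.
  intros Ha Ht Hs [F [H1 [H2 H3]]] [F' [H1' [H2' H3']]].
  pose proof (reds_typing Ht H1) as HF. pose proof (reds_typing Hs H1') as HF'.
  assert (Hty : has_type (env_ctx r0) (AddOp o F F') (ity_ty a)) by (constructor; eauto).
  destruct (interpretable_choice Hty) as [chi Hchi]; [now split|].
  exists chi; split.
  - exists (AddOp o F F'). split; [now apply reds_addop|]. split; [now split | auto].
  - intros r Hr. destruct (Hchi r Hr) as [x [y [K1 [K2 K3]]]].
    rewrite <- Hr in HF, HF'.
    replace (phi r) with x by exact (ev_det HM HF K1 (H3 r Hr)).
    replace (psi r) with y by exact (ev_det HM HF' K2 (H3' r Hr)). assumption.
Qed.

Definition bind b (y : cst (IBase b)) r : env := existT _ (IBase b) y :: r.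

Lemma val_der_at r0 a b t s (phi : env -> cst a) (psi : env -> cst (IBase b)) :
  has_type (TBase b :: env_ctx r0) t (ity_ty a) -> has_type (env_ctx r0) s (TBase b) ->
  val M (TBase b :: env_ctx r0) t phi -> val M (env_ctx r0) s psi ->
  exists chi : env -> cst a, val M (env_ctx r0) (Der t s) chi /\
    forall r, env_ctx r = env_ctx r0 -> der_at M (fun y => phi (bind y r)) (psi r) (chi r).
Proof.
  intros Ht Hs [F [H1 [H2 H3]]] [F' [H1' [H2' H3']]].
  pose proof (reds_typing Ht H1) as HF. pose proof (reds_typing Hs H1') as HF'.
  assert (Hty : has_type (env_ctx r0) (Der F F') (ity_ty a)) by (eapply ty_der_base; eauto).
  destruct (interpretable_choice Hty) as [chi Hchi]; [now split|].
  exists chi; split.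
  - exists (Der F F'). split; [now apply reds_der with (TBase b)|]. split; [now split | auto].
  - intros r Hr. destruct (Hchi r Hr) as [b' [G [y [K1 [K2 K3]]]]].
    rewrite <- Hr in HF, HF'. pose proof (ev_agree HF' K2) as E. simpl in E; subst b'.
    replace (psi r) with y by exact (ev_det HM HF' K2 (H3' r Hr)).
    replace (fun y => phi (bind y r)) with G; [assumption|].
    apply functional_extensionality. intros z.
    refine (ev_det HM (r := bind z r) HF (K1 z) (H3 _ _)). simpl. now rewrite Hr.
Qed.

(* Every observation starts with the elimination of a constructor or applies to a
   neutral term, whose type is interpretable. *)
Lemma observe_cases r0 T X : has_type (env_ctx r0) X T -> FF (env_ctx r0) X ->
  exists n, reds (env_ctx r0) X n /\ has_type (env_ctx r0) n T /\ fixfree n /\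
    (intro n = true \/ exists a, T = ity_ty a).
Proof.
  intros HX HF. destruct (FF_irr HX HF) as [n [Hn [Hi Hf]]].
  pose proof (reds_typing HX Hn) as Htn.
  destruct (irr_nf (env_ictx (r := r0)) Htn Hi) as [_ [N _]].
  exists n; repeat split; auto. destruct (intro n); auto. right; now apply N.
Qed.

(** If the type of [X] is interpretable, the observation is a map of constants and commutes with the
    product. Otherwise [X] reduces to a constructor, the product moves inside it by reduction, and
    the first step of the observation cancels that constructor. *)
Lemma val_observe_mul T K b : path T K b -> forall r0 X s b' phi psi,
  addable T = true -> has_type (env_ctx r0) X T -> FF (env_ctx r0) X ->
  has_type (env_ctx r0) s (TBase b') ->
  val M (env_ctx r0) s (psi : env -> cst (IBase b')) ->
  val M (env_ctx r0) (observe K X) (phi : env -> cst (IBase b)) ->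
  val M (env_ctx r0) (observe K (Mul X s)) (fun r => mul M (phi r) (psi r)).
Proof.
  intros HK; pose proof HK as HK'.
  induction HK as [b | j T Ts A K b E HK IH | A C u K b Hu Hf HK IH];
    intros r0 X s b' phi psi HT HX HF Hs Hvs HvX;
    destruct (observe_cases HX HF) as [n [Hn [Htn [Hfn Hc]]]].
  all: assert (Hbs : is_base (env_ctx r0) s) by (exists b'; assumption).
  all: destruct (excluded_middle_informative (exists a, has_type (env_ctx r0) n (ity_ty a))) as [[a Ha] | Hna].
  1,3,5: pose proof (typing_unique Htn Ha) as ET;
    destruct (val_exists HM Ha (fixfree_FF _ Hfn)) as [xi Hxi];
    destruct (observe_interpretable HK' ET) as [g [G1 [_ [G3 _]]]];
    rewrite ET in HT; destruct (val_mul_at HT Ha Hs Hxi Hvs) as [chi [Hchi Hmul]];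
    eapply val_back; [apply observe_reds, reds_mul; [exact Hn | apply reds_refl]|];
    eapply val_ext; [|apply G1, Hchi]; intros r Hr; simpl; rewrite (G3 _ _ _ _ (Hmul r Hr)); f_equal;
    refine (val_det HM (phi := fun r => g (xi r)) (observe_typing HK' HX) _ HvX Hr);
    eapply val_back; [apply observe_reds; exact Hn | apply G1; assumption].
  - exfalso. apply Hna. exists (IBase b). assumption.
  - destruct Hc as [Hc | [a Ea]]; [|exfalso; apply Hna; exists a; now rewrite <- Ea].
    destruct n; try discriminate; inv Htn.
    match goal with F : Forall2 _ _ _ |- _ => destruct (Forall2_nth_error_r F E) as [x [Ex Hx]] end.
    simpl. eapply val_back.
    { apply observe_reds. eapply reds_trans; [apply reds_proj, reds_mul; [exact Hn | apply reds_refl]|].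
      eapply reds_trans; [apply reds_proj, reds_step, red_mul_tup; assumption|].
      apply reds_step, red_proj. rewrite nth_error_map, Ex. reflexivity. }
    eapply IH; eauto.
    + eapply addable_nth; eauto.
    + apply fixfree_FF. apply fixfree_tup in Hfn. rewrite Forall_forall in Hfn.
      apply Hfn. eapply nth_error_In; eauto.
    + eapply val_forward; [| |exact HvX].
      * eapply observe_typing; eauto.
      * apply (observe_reds (OProj j :: K)) in Hn. eapply reds_trans; [exact Hn|].
        simpl. apply observe_reds, reds_step. now constructor.
  - destruct Hc as [Hc | [a Ea]]; [|exfalso; apply Hna; exists a; now rewrite <- Ea].
    destruct n; try discriminate; inv Htn.
    simpl. eapply val_back.
    { apply observe_reds. eapply reds_trans; [apply reds_app; [apply reds_mul; [exact Hn | apply reds_refl] | apply reds_refl]|].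
      eapply reds_trans; [apply reds_app; [apply reds_step, red_mul_lam; assumption | apply reds_refl]|].
      apply reds_step, red_beta. }
    replace (subst1 u (Mul n (shift s))) with (Mul (subst1 u n) s).
    2: { unfold subst1; simpl; f_equal. unfold shift. rewrite subst_rename. symmetry. apply subst_id. reflexivity. }
    eapply IH; eauto.
    + eapply typing_subst1; eauto using closed_typing.
    + apply fixfree_FF, fixfree_subst; auto. intros [|i]; simpl; auto.
    + eapply val_forward; [| |exact HvX].
      * eapply observe_typing; eauto.
      * apply (observe_reds (OApp u :: K)) in Hn. eapply reds_trans; [exact Hn|].
        simpl. apply observe_reds, reds_step. constructor.
Qed.

(** As for products; at a type that is not interpretable both summands reduce to constructors, so
    that the rules for sums apply. *)
Lemma val_observe_addop o T K b : path T K b -> forall r0 X Y phi psi,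
  addable T = true -> has_type (env_ctx r0) X T -> FF (env_ctx r0) X ->
  has_type (env_ctx r0) Y T -> FF (env_ctx r0) Y ->
  val M (env_ctx r0) (observe K X) (phi : env -> cst (IBase b)) ->
  val M (env_ctx r0) (observe K Y) (psi : env -> cst (IBase b)) ->
  val M (env_ctx r0) (observe K (AddOp o X Y)) (fun r => app_op M o (phi r) (psi r)).
Proof.
  intros HK; pose proof HK as HK'.
  induction HK as [b | j T Ts A K b E HK IH | A C u K b Hu Hf HK IH];
    intros r0 X Y phi psi HT HX HF HY HFY HvX HvY;
    destruct (observe_cases HX HF) as [n [Hn [Htn [Hfn Hc]]]];
    destruct (observe_cases HY HFY) as [m [Hm [Htm [Hfm Hc']]]].
  all: destruct (excluded_middle_informative (exists a, has_type (env_ctx r0) n (ity_ty a))) as [[a Ha] | Hna].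
  1,3,5: pose proof (typing_unique Htn Ha) as ET; rewrite ET in Htm, HT;
    destruct (val_exists HM Ha (fixfree_FF _ Hfn)) as [xi Hxi];
    destruct (val_exists HM Htm (fixfree_FF _ Hfm)) as [xi' Hxi'];
    destruct (observe_interpretable HK' ET) as [g [G1 [G2 _]]];
    destruct (val_op_at o HT Ha Htm Hxi Hxi') as [chi [Hchi Hop]];
    eapply val_back; [apply observe_reds, reds_addop; [exact Hn | exact Hm]|];
    eapply val_ext; [|apply G1, Hchi]; intros r Hr; simpl; rewrite (G2 _ _ _ _ (Hop r Hr)); f_equal;
    [refine (val_det HM (phi := fun r => g (xi r)) (observe_typing HK' HX) _ HvX Hr);
     eapply val_back; [apply observe_reds; exact Hn | apply G1; assumption]
    |refine (val_det HM (phi := fun r => g (xi' r)) (observe_typing HK' HY) _ HvY Hr);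
     eapply val_back; [apply observe_reds; exact Hm | apply G1; assumption]].
  - exfalso. apply Hna. exists (IBase b). assumption.
  - destruct Hc as [Hc | [a Ea]]; [|exfalso; apply Hna; exists a; now rewrite <- Ea].
    destruct Hc' as [Hc' | [a Ea]]; [|exfalso; apply Hna; exists a; now rewrite <- Ea].
    destruct n; try discriminate; inv Htn. destruct m; try discriminate; inv Htm.
    match goal with F : Forall2 _ ts _, F' : Forall2 _ ts0 _ |- _ => rename F into F1, F' into F2 end.
    destruct (Forall2_nth_error_r F1 E) as [x [Ex Hx]]. destruct (Forall2_nth_error_r F2 E) as [y [Ey Hy]].
    simpl. eapply val_back.
    { apply observe_reds. eapply reds_trans; [apply reds_proj, reds_addop; [exact Hn | exact Hm]|].
      eapply reds_trans; [apply reds_proj, reds_step, red_addop_tup|].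
      - apply Forall2_length in F1, F2. congruence.
      - apply reds_step, red_proj. rewrite nth_error_map, nth_error_combine, Ex, Ey. reflexivity. }
    apply fixfree_tup in Hfn, Hfm. rewrite Forall_forall in Hfn, Hfm.
    eapply IH; eauto.
    + eapply addable_nth; eauto.
    + apply fixfree_FF, Hfn. eapply nth_error_In; eauto.
    + apply fixfree_FF, Hfm. eapply nth_error_In; eauto.
    + eapply val_forward; [| |exact HvX].
      * eapply observe_typing; eauto.
      * apply (observe_reds (OProj j :: K)) in Hn. eapply reds_trans; [exact Hn|].
        simpl. apply observe_reds, reds_step. now constructor.
    + eapply val_forward; [| |exact HvY].
      * eapply observe_typing; eauto.
      * apply (observe_reds (OProj j :: K)) in Hm. eapply reds_trans; [exact Hm|].
        simpl. apply observe_reds, reds_step. now constructor.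
  - destruct Hc as [Hc | [a Ea]]; [|exfalso; apply Hna; exists a; now rewrite <- Ea].
    destruct Hc' as [Hc' | [a Ea]]; [|exfalso; apply Hna; exists a; now rewrite <- Ea].
    destruct n; try discriminate; inv Htn. destruct m; try discriminate; inv Htm.
    simpl. eapply val_back.
    { apply observe_reds. eapply reds_trans; [apply reds_app; [apply reds_addop; [exact Hn | exact Hm] | apply reds_refl]|].
      eapply reds_trans; [apply reds_app; [apply reds_step, red_addop_lam | apply reds_refl]|].
      apply reds_step, red_beta. }
    change (subst1 u (AddOp o n m)) with (AddOp o (subst1 u n) (subst1 u m)).
    eapply IH; eauto.
    + eapply typing_subst1; eauto using closed_typing.
    + apply fixfree_FF, fixfree_subst; auto. intros [|i]; simpl; auto.
    + eapply typing_subst1; eauto using closed_typing.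
    + apply fixfree_FF, fixfree_subst; auto. intros [|i]; simpl; auto.
    + eapply val_forward; [| |exact HvX].
      * eapply observe_typing; eauto.
      * apply (observe_reds (OApp u :: K)) in Hn. eapply reds_trans; [exact Hn|].
        simpl. apply observe_reds, reds_step. constructor.
    + eapply val_forward; [| |exact HvY].
      * eapply observe_typing; eauto.
      * apply (observe_reds (OApp u :: K)) in Hm. eapply reds_trans; [exact Hm|].
        simpl. apply observe_reds, reds_step. constructor.
Qed.

(** As for products, now with the operation below a binder. The point [z] extends [r0] to an
    environment of the context of the body, so that values exist there. *)
Lemma val_observe_der T K b : path T K b -> forall r0 X s b' (z : cst (IBase b')) phi psi,
  has_type (TBase b' :: env_ctx r0) X T -> FF (TBase b' :: env_ctx r0) X ->
  has_type (env_ctx r0) s (TBase b') ->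
  val M (env_ctx r0) s (psi : env -> cst (IBase b')) ->
  val M (TBase b' :: env_ctx r0) (observe K X) (phi : env -> cst (IBase b)) ->
  val M (env_ctx r0) (observe K (Der X s)) (fun r => der M (fun y => phi (bind y r)) (psi r)).
Proof.
  intros HK; pose proof HK as HK'.
  induction HK as [b | j T Ts A K b E HK IH | A C u K b Hu Hf HK IH];
    intros r0 X s b' z phi psi HX HF Hs Hvs HvX;
    destruct (@observe_cases (bind z r0) _ _ HX HF) as [n [Hn [Htn [Hfn Hc]]]];
    change (env_ctx (bind z r0)) with (TBase b' :: env_ctx r0) in *.
  all: assert (Hbs : is_base (env_ctx r0) s) by (exists b'; assumption).
  all: destruct (excluded_middle_informative (exists a, has_type (TBase b' :: env_ctx r0) n (ity_ty a))) as [[a Ha] | Hna].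
  1,3,5: pose proof (typing_unique Htn Ha) as ET;
    destruct (@val_exists _ _ HM a n (bind z r0) Ha (fixfree_FF _ Hfn)) as [xi Hxi];
    destruct (observe_interpretable HK' ET) as [g [G1 [_ [_ G4]]]];
    destruct (val_der_at Ha Hs Hxi Hvs) as [chi [Hchi Hder]];
    eapply val_back; [eapply observe_reds, reds_der; [exact Hs | exact Hn | apply reds_refl]|];
    eapply val_ext; [|apply G1, Hchi]; intros r Hr; simpl; rewrite (G4 _ _ _ _ (Hder r Hr)); f_equal;
    apply functional_extensionality; intros y;
    refine (val_det HM (phi := fun r => g (xi r)) (observe_typing HK' HX) _ HvX (r := bind y r) _); [|simpl; now rewrite Hr];
    eapply val_back; [apply observe_reds; exact Hn | apply G1; assumption].
  - exfalso. apply Hna. exists (IBase b). assumption.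
  - destruct Hc as [Hc | [a Ea]]; [|exfalso; apply Hna; exists a; now rewrite <- Ea].
    destruct n; try discriminate; inv Htn.
    match goal with F : Forall2 _ _ _ |- _ => destruct (Forall2_nth_error_r F E) as [x [Ex Hx]] end.
    simpl. eapply val_back.
    { apply observe_reds. eapply reds_trans; [eapply reds_proj, reds_der; [exact Hs | exact Hn | apply reds_refl]|].
      eapply reds_trans; [apply reds_proj, reds_step, red_der_tup; assumption|].
      apply reds_step, red_proj. rewrite nth_error_map, Ex. reflexivity. }
    eapply IH; eauto.
    + apply fixfree_FF. apply fixfree_tup in Hfn. rewrite Forall_forall in Hfn.
      apply Hfn. eapply nth_error_In; eauto.
    + eapply val_forward; [| |exact HvX].
      * eapply observe_typing; eauto.
      * apply (observe_reds (OProj j :: K)) in Hn. eapply reds_trans; [exact Hn|].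
        simpl. apply observe_reds, reds_step. now constructor.
  - destruct Hc as [Hc | [a Ea]]; [|exfalso; apply Hna; exists a; now rewrite <- Ea].
    destruct n; try discriminate; inv Htn.
    simpl. eapply val_back.
    { apply observe_reds. eapply reds_trans; [apply reds_app; [eapply reds_der; [exact Hs | exact Hn | apply reds_refl] | apply reds_refl]|].
      eapply reds_trans; [apply reds_app; [apply reds_step, red_der_lam; assumption | apply reds_refl]|].
      apply reds_step, red_beta. }
    (* The observing argument is closed, so its substitution does not see the exchange of the two
       binders. *)
    replace (subst1 u (Der (swap n) (shift s))) with (Der (subst1 u n) s).
    2: { unfold subst1; simpl; f_equal.
      - unfold swap. rewrite subst_rename. apply subst_ext. intros [|[|i]]; simpl; auto.
        unfold shift. rewrite rename_subst_var. symmetry. eapply closed_subst; eauto.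
      - unfold shift. rewrite subst_rename. symmetry. apply subst_id. reflexivity. }
    eapply IH; eauto.
    + eapply typing_subst1; eauto using closed_typing.
    + apply fixfree_FF, fixfree_subst; auto. intros [|i]; simpl; auto.
    + eapply val_forward; [| |exact HvX].
      * eapply observe_typing; eauto.
      * apply (observe_reds (OApp u :: K)) in Hn. eapply reds_trans; [exact Hn|].
        simpl. apply observe_reds, reds_step. constructor.
Qed.

End Observations.

(** * Tuples of variables *)

Section Trees.
Variable Sg : sig.
Local Notation tm := (tm Sg).
Local Notation ty := (ty (base Sg)).
Local Notation ity := (ity (base Sg)).
Local Notation ctx := (ctx Sg).
Local Notation env := (env Sg).
Implicit Types (G D : ctx) (t s u v w n X : tm) (T A B C : ty) (a : ity) (g h : nat -> tm).

Fixpoint leaves T : list (base Sg) :=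
  match T with
  | TBase b => [b]
  | TTup A As => leaves A ++ concat (map leaves As)
  | _ => []
  end.

(** The number of the first leaf of component [i], leaves being counted from left to right. *)
Definition off (As : list ty) i : nat := length (concat (map leaves (firstn i As))).

(* The nested tuple of shape [T] with leaves [g o], [g (o + 1)], ... *)
Fixpoint tup T g (o : nat) : tm :=
  match T with
  | TTup A As => Tup (tup A g o ::
      (fix tups As o := match As with
       | [] => []
       | A :: As => tup A g o :: tups As (o + length (leaves A))
       end) As (o + length (leaves A)))
  | _ => g o
  end.

Fixpoint tups (As : list ty) g (o : nat) : list tm :=
  match As with
  | [] => []
  | A :: As => tup A g o :: tups As g (o + length (leaves A))
  end.

(** The brackets follow the shape of [T], just as the reduction of a product of two such tuples
    produces them. *)
Fixpoint sumtree T g (o : nat) : tm :=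
  match T with
  | TTup A As => osum (sumtree A g o)
      ((fix sums As o := match As with
       | [] => []
       | A :: As => sumtree A g o :: sums As (o + length (leaves A))
       end) As (o + length (leaves A)))
  | _ => g o
  end.

Fixpoint sums (As : list ty) g (o : nat) : list tm :=
  match As with
  | [] => []
  | A :: As => sumtree A g o :: sums As g (o + length (leaves A))
  end.

Lemma tup_tups A As g o : tup (TTup A As) g o = Tup (tups (A :: As) g o).
Proof.
  simpl. do 2 f_equal. generalize (o + length (leaves A)).
  induction As; intros k; simpl; f_equal; auto.
Qed.

Lemma sumtree_sums A As g o :
  sumtree (TTup A As) g o = osum (sumtree A g o) (sums As g (o + length (leaves A))).
Proof.
  simpl. f_equal. generalize (o + length (leaves A)).
  induction As; intros k; simpl; f_equal; auto.
Qed.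

Lemma nth_error_tups As g o i :
  nth_error (tups As g o) i = option_map (fun A => tup A g (o + off As i)) (nth_error As i).
Proof.
  revert o i; induction As as [|A As IH]; intros o [|i]; simpl; auto.
  - unfold off; simpl. now rewrite Nat.add_0_r.
  - rewrite IH. destruct (nth_error As i); simpl; auto. do 2 f_equal.
    unfold off; simpl. rewrite length_app. lia.
Qed.

Lemma off_S As i A : nth_error As i = Some A -> off As (S i) = off As i + length (leaves A).
Proof.
  revert i; induction As as [|A' As IH]; intros [|i] E; try discriminate; unfold off in *; simpl in *.
  - injection E as ->. rewrite app_nil_r. lia.
  - rewrite 2!length_app. rewrite IH by assumption. lia.
Qed.

Lemma off_le As i j : i <= j -> off As i <= off As j.
Proof.
  unfold off. revert j As. induction i as [|i IH]; intros j As H; simpl; [lia|].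
  destruct j as [|j]; [lia|]. destruct As as [|A As]; simpl; auto.
  rewrite 2!length_app. specialize (IH j As). lia.
Qed.

Lemma off_bound As i A : nth_error As i = Some A ->
  off As i + length (leaves A) <= length (concat (map leaves As)).
Proof.
  intros E. rewrite <- (off_S E). unfold off.
  rewrite <- (firstn_skipn (S i) As) at 2. rewrite map_app, concat_app, length_app. lia.
Qed.

Lemma leaves_nth As i A j b : nth_error As i = Some A -> nth_error (leaves A) j = Some b ->
  nth_error (concat (map leaves As)) (off As i + j) = Some b.
Proof.
  revert i; induction As as [|A' As IH]; intros [|i] E Hj; try discriminate; simpl in *.
  - injection E as ->. unfold off; simpl. rewrite nth_error_app1; auto.
    apply nth_error_Some. congruence.
  - specialize (IH _ E Hj). unfold off in *; simpl. rewrite length_app.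
    rewrite nth_error_app2 by lia. rewrite <- IH. f_equal. lia.
Qed.

Lemma leaves_inv As k b : nth_error (concat (map leaves As)) k = Some b ->
  exists i A j, nth_error As i = Some A /\ nth_error (leaves A) j = Some b /\ k = off As i + j.
Proof.
  revert k; induction As as [|A As IH]; intros k E; simpl in *; [destruct k; discriminate|].
  destruct (Nat.lt_ge_cases k (length (leaves A))) as [L | L].
  - rewrite nth_error_app1 in E by assumption. exists 0, A, k; auto.
  - rewrite nth_error_app2 in E by assumption. destruct (IH _ E) as [i [A' [j [H1 [H2 H3]]]]].
    exists (S i), A', j; repeat split; auto. unfold off in *; simpl. rewrite length_app. lia.
Qed.

Lemma leaves_nonempty T : has_dty T = true -> 0 < length (leaves T).
Proof.
  induction T using ty_nested_ind; simpl; intros HT; try discriminate; [lia|].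
  apply andb_prop in HT. rewrite length_app. destruct HT as [HT _]. specialize (IHT HT). lia.
Qed.

Lemma tup_ext T g h : has_dty T = true -> forall o o',
  (forall i, i < length (leaves T) -> g (o + i) = h (o' + i)) -> tup T g o = tup T h o'.
Proof.
  induction T using ty_nested_ind; intros HT o o' E; try discriminate.
  - simpl. specialize (E 0). rewrite 2!Nat.add_0_r in E. apply E. simpl; lia.
  - rewrite 2!tup_tups. f_equal. apply nth_error_ext. intros i. rewrite 2!nth_error_tups.
    destruct (nth_error (T :: Ts) i) as [A|] eqn:EA; simpl; auto. f_equal.
    pose proof (off_bound EA) as L. change (concat (map leaves (T :: Ts))) with (leaves (TTup T Ts)) in L.
    assert (HF : Forall (fun T => has_dty T = true -> forall o o',
      (forall i, i < length (leaves T) -> g (o + i) = h (o' + i)) -> tup T g o = tup T h o') (T :: Ts))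
      by now constructor.
    rewrite Forall_forall in HF. apply HF.
    + eapply nth_error_In; eauto.
    + eapply has_dty_nth; eauto.
    + intros j Hj. rewrite <- 2!Nat.add_assoc. apply E. lia.
Qed.

Lemma tup_map (f : tm -> tm) T g o : has_dty T = true -> (forall ts, f (Tup ts) = Tup (map f ts)) ->
  f (tup T g o) = tup T (fun i => f (g i)) o.
Proof.
  intros HT Hf. revert o. induction T using ty_nested_ind; intros o; try discriminate; auto.
  rewrite 2!tup_tups, Hf. f_equal. apply nth_error_ext. intros i.
  rewrite nth_error_map, 2!nth_error_tups.
  destruct (nth_error (T :: Ts) i) as [A|] eqn:EA; simpl; auto. f_equal.
  assert (HF : Forall (fun T => has_dty T = true -> forall o, f (tup T g o) = tup T (fun i => f (g i)) o) (T :: Ts))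
    by now constructor.
  rewrite Forall_forall in HF. apply HF; [eapply nth_error_In | eapply has_dty_nth]; eauto.
Qed.

Lemma tup_subst f T g o : has_dty T = true -> subst f (tup T g o) = tup T (fun i => subst f (g i)) o.
Proof. intros HT. now apply (tup_map (f := subst f)). Qed.

Lemma tup_rename r T g o : has_dty T = true -> rename r (tup T g o) = tup T (fun i => rename r (g i)) o.
Proof. intros HT. now apply (tup_map (f := rename r)). Qed.

(* [P A] is the type at the place of the part [A] of [T]. *)
Lemma tup_typing (P : ty -> ty) (HP : forall A As, P (TTup A As) = TTup (P A) (map P As)) T G g :
  has_dty T = true -> forall o,
  (forall i b, nth_error (leaves T) i = Some b -> has_type G (g (o + i)) (P (TBase b))) ->
  has_type G (tup T g o) (P T).
Proof.
  induction T using ty_nested_ind; intros HT o E; try discriminate.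
  - simpl. specialize (E 0 b eq_refl). now rewrite Nat.add_0_r in E.
  - rewrite tup_tups, HP. constructor. change (P T :: map P Ts) with (map P (T :: Ts)).
    apply nth_error_Forall2.
    + rewrite length_map. generalize o. generalize (T :: Ts). clear.
      induction l; intros o; simpl; auto.
    + intros i x y. rewrite nth_error_tups, nth_error_map.
      destruct (nth_error (T :: Ts) i) as [A|] eqn:EA; simpl; [|discriminate].
      intros [= <-] [= <-].
      assert (HF : Forall (fun T => has_dty T = true -> forall o,
        (forall i b, nth_error (leaves T) i = Some b -> has_type G (g (o + i)) (P (TBase b))) ->
        has_type G (tup T g o) (P T)) (T :: Ts)) by now constructor.
      rewrite Forall_forall in HF. apply HF.
      * eapply nth_error_In; eauto.
      * eapply has_dty_nth; eauto.
      * intros j b Hj. rewrite <- Nat.add_assoc. apply E.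
        change (leaves (TTup T Ts)) with (concat (map leaves (T :: Ts))). eapply leaves_nth; eauto.
Qed.

Lemma tup_xtuple T p : has_dty T = true -> forall o, xtuple T (tup T (fun i => Var (p i)) o).
Proof.
  induction T using ty_nested_ind; intros HT o; try discriminate.
  - constructor.
  - rewrite tup_tups. constructor. apply nth_error_Forall2.
    + generalize o. generalize (T :: Ts). clear. induction l; intros o; simpl; auto.
    + intros i A x EA. rewrite nth_error_tups, EA. intros [= <-].
      assert (HF : Forall (fun T => has_dty T = true -> forall o, xtuple T (tup T (fun i => Var (p i)) o)) (T :: Ts))
        by now constructor.
      rewrite Forall_forall in HF. apply HF; [eapply nth_error_In | eapply has_dty_nth]; eauto.
Qed.

Lemma reds_tup_nth G ts ts' : length ts = length ts' ->
  (forall i t t', nth_error ts i = Some t -> nth_error ts' i = Some t' -> reds G t t') ->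
  reds G (Tup ts) (Tup ts').
Proof. intros L H. apply reds_tup. now apply nth_error_Forall2. Qed.

Lemma length_tups As g o : length (tups As g o) = length As.
Proof. revert o; induction As; intros o; simpl; auto. Qed.

Lemma tup_reds T G g h : has_dty T = true -> forall o,
  (forall i, i < length (leaves T) -> reds G (g (o + i)) (h (o + i))) ->
  reds G (tup T g o) (tup T h o).
Proof.
  induction T using ty_nested_ind; intros HT o E; try discriminate.
  - simpl. specialize (E 0). rewrite Nat.add_0_r in E. apply E. simpl; lia.
  - rewrite 2!tup_tups. apply reds_tup_nth; [now rewrite 2!length_tups|].
    intros i x y. rewrite 2!nth_error_tups.
    destruct (nth_error (T :: Ts) i) as [A|] eqn:EA; simpl; [|discriminate].
    intros [= <-] [= <-].
    pose proof (off_bound EA) as L. change (concat (map leaves (T :: Ts))) with (leaves (TTup T Ts)) in L.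
    assert (HF : Forall (fun T => has_dty T = true -> forall o,
      (forall i, i < length (leaves T) -> reds G (g (o + i)) (h (o + i))) ->
      reds G (tup T g o) (tup T h o)) (T :: Ts)) by now constructor.
    rewrite Forall_forall in HF. apply HF.
    + eapply nth_error_In; eauto.
    + eapply has_dty_nth; eauto.
    + intros j Hj. rewrite <- Nat.add_assoc. apply E. lia.
Qed.

Lemma addop_tup op T G g h : has_dty T = true -> forall o,
  reds G (AddOp op (tup T g o) (tup T h o)) (tup T (fun i => AddOp op (g i) (h i)) o).
Proof.
  induction T using ty_nested_ind; intros HT o; try discriminate.
  - apply reds_refl.
  - rewrite 3!tup_tups. eapply reds_trans.
    { apply reds_step, red_addop_tup. now rewrite 2!length_tups. }
    apply reds_tup_nth.
    { rewrite length_map, length_combine, 3!length_tups. lia. }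
    intros i x y. rewrite nth_error_map, nth_error_combine, 3!nth_error_tups.
    destruct (nth_error (T :: Ts) i) as [A|] eqn:EA; simpl; [|discriminate].
    intros [= <-] [= <-]. simpl.
    assert (HF : Forall (fun T => has_dty T = true -> forall o,
      reds G (AddOp op (tup T g o) (tup T h o)) (tup T (fun i => AddOp op (g i) (h i)) o)) (T :: Ts))
      by now constructor.
    rewrite Forall_forall in HF. apply HF; [eapply nth_error_In | eapply has_dty_nth]; eauto.
Qed.

Lemma reds_osum G ts ts' : Forall2 (reds G) ts ts' -> forall t t', reds G t t' ->
  reds G (osum t ts) (osum t' ts').
Proof. induction 1; intros u u' Hu; simpl; auto. apply IHForall2. now apply reds_addop. Qed.

Lemma mul_tup T G g h : has_dty T = true -> forall o,
  reds G (Mul (tup T g o) (tup T h o)) (sumtree T (fun i => Mul (g i) (h i)) o).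
Proof.
  induction T using ty_nested_ind; intros HT o; try discriminate.
  - apply reds_refl.
  - rewrite 2!tup_tups, sumtree_sums. simpl tups. eapply reds_trans.
    { apply reds_step, red_mul_between_tup. now rewrite 2!length_tups. }
    pose proof (has_dty_tup HT) as HD. inv HD.
    apply reds_osum; auto. generalize (o + length (leaves T)).
    match goal with F : Forall _ Ts, F' : Forall _ Ts |- _ => revert F F' end.
    clear. induction Ts; intros F F' k; simpl; inv F; inv F'; constructor; auto.
Qed.

(** The point [g] with leaf [k] released: below a new binder, that leaf is the variable of
    differentiation and the others are kept. *)
Definition point_at (k : nat) g : nat -> tm := fun m => if m =? k then Var 0 else shift (g m).

Lemma nth_error_replace (Y : Type) (l : list Y) i x j : i < length l ->
  nth_error (firstn i l ++ x :: skipn (S i) l) j = if j =? i then Some x else nth_error l j.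
Proof.
  intros L. destruct (Nat.lt_ge_cases j i) as [Lj | Lj].
  - rewrite nth_error_app1 by (rewrite length_firstn; lia).
    rewrite nth_error_firstn. destruct (Nat.ltb_spec j i); [|lia].
    destruct (Nat.eqb_spec j i); [lia | reflexivity].
  - rewrite nth_error_app2 by (rewrite length_firstn; lia).
    rewrite length_firstn. replace (j - Nat.min i (length l)) with (j - i) by lia.
    destruct (Nat.eqb_spec j i) as [-> | N].
    + now rewrite Nat.sub_diag.
    + destruct (j - i) as [|m] eqn:Em; [lia|]. change (nth_error (skipn (S i) l) m = nth_error l j).
      rewrite nth_error_skipn. f_equal. lia.
Qed.

Lemma subst_under_subst_under u v t :
  subst_under u (subst_under v t) = subst_under (subst_under u v) t.
Proof. unfold subst_under. rewrite subst_subst. apply subst_ext. intros [|i]; reflexivity. Qed.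

Lemma subst_under_star u i (ss : list tm) :
  subst_under u (star i ss ss) =
  Tup (map (@shift Sg) (firstn i ss) ++ u :: map (@shift Sg) (skipn (S i) ss)).
Proof.
  unfold subst_under, star. simpl. f_equal. rewrite map_app; simpl. rewrite 2!map_map. f_equal; [|f_equal].
  all: apply map_ext; intros s; unfold shift; now rewrite subst_rename, rename_subst_var.
Qed.

(** The rule at a tuple is iterated down to the leaves. The substitutions it makes on the way
    compose to a single one, in which only one leaf varies. *)
Lemma der_tup T : has_dty T = true -> forall G t g o,
  reds G (Der t (tup T g o))
    (tup T (fun k => Der (subst_under (tup T (point_at k g) o) t) (g k)) o).
Proof.
  induction T using ty_nested_ind; intros HT G t g o; try discriminate.
  - simpl. replace (subst_under (point_at o g o) t) with t; [apply reds_refl|].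
    unfold point_at. rewrite Nat.eqb_refl. symmetry. apply subst_id. intros [|i]; reflexivity.
  - rewrite tup_tups. eapply reds_trans; [apply reds_step, red_der_at_tup|].
    rewrite (tup_tups T Ts (fun k => _)).
    apply reds_tup_nth.
    { now rewrite length_map, length_indexed, 2!length_tups. }
    intros i x y. rewrite nth_error_map, nth_error_indexed, 2!nth_error_tups.
    destruct (nth_error (T :: Ts) i) as [A|] eqn:EA; simpl; [|discriminate].
    intros [= <-] [= <-]. fold (tups (T :: Ts) g o).
    assert (HF : Forall (fun T => has_dty T = true -> forall G t g o,
      reds G (Der t (tup T g o))
        (tup T (fun k => Der (subst_under (tup T (point_at k g) o) t) (g k)) o)) (T :: Ts))
      by now constructor.
    rewrite Forall_forall in HF.
    assert (HA : has_dty A = true) by (eapply has_dty_nth; eauto).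
    eapply reds_trans; [apply HF; [eapply nth_error_In; eauto | exact HA]|].
    match goal with |- reds _ ?a ?b => replace b with a; [apply reds_refl|] end.
    apply tup_ext; auto. intros k Hk. f_equal.
    change (tup T g o :: tups Ts g (o + length (leaves T))) with (tups (T :: Ts) g o).
    rewrite subst_under_subst_under, subst_under_star. f_equal.
    match goal with |- _ = ?rhs =>
      change rhs with (tup (TTup T Ts) (point_at (o + off (T :: Ts) i + k) g) o) end.
    rewrite tup_tups. f_equal.
    apply nth_error_ext. intros j.
    rewrite <- firstn_map, <- skipn_map, nth_error_replace, nth_error_map, 2!nth_error_tups.
    2: { rewrite length_map, length_tups. apply nth_error_Some. congruence. }
    destruct (Nat.eqb_spec j i) as [-> | N]; [now rewrite EA|].
    destruct (nth_error (T :: Ts) j) as [B|] eqn:EB; simpl; auto. f_equal.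
    assert (HB : has_dty B = true) by (eapply has_dty_nth; eauto).
    unfold shift at 1. rewrite tup_rename by assumption. apply tup_ext; auto.
    intros m Hm. unfold point_at. destruct (Nat.eqb_spec (o + off (T :: Ts) j + m) (o + off (T :: Ts) i + k)); [|reflexivity].
    (* Different components have disjoint ranges of leaf numbers, because the offsets are
       monotone. *)
    exfalso. destruct (Nat.lt_ge_cases j i).
    + pose proof (off_le (T :: Ts) (i := S j) (j := i) ltac:(lia)) as L. rewrite (off_S EB) in L. lia.
    + pose proof (off_le (T :: Ts) (i := S i) (j := j) ltac:(lia)) as L. rewrite (off_S EA) in L. lia.
Qed.

End Trees.

(** * Gradients and directional derivatives *)

Section Gradient.
Variables (Sg : sig) (M : model Sg).
Hypothesis HM : lawful M.
Local Notation tm := (tm Sg).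
Local Notation ty := (ty (base Sg)).
Local Notation ity := (ity (base Sg)).
Local Notation ctx := (ctx Sg).
Local Notation env := (env Sg).
Local Notation increment := (increment Sg).
Implicit Types (G D : ctx) (t s u v w n X : tm) (T A B C : ty) (a : ity) (g h : nat -> tm) (r : env).

Definition grad T t : tm := tup T (fun i => pder i t) 0.

(** The first differentiation is peeled off first, as in [fder] and [dirpow]. *)
Fixpoint iter_grad T k t : tm :=
  match k with 0 => t | S k => iter_grad T k (grad T t) end.

(** [L] consists of the projections that lead to leaf [i]. In dT'/dT a copy of [T'] stands at each
    leaf of [T], so the same projections can be followed by any observation of [T']. *)
Lemma leaf_path T T' : has_dty T = true -> forall i, i < length (leaves T) ->
  exists L, (forall K b, path T' K b -> path (dty T' T) (L ++ K) b) /\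
    forall D g o, reds D (observe L (tup T g o)) (g (o + i)).
Proof.
  induction T using ty_nested_ind; intros HT i Hi; try discriminate.
  - exists []. simpl in *. replace i with 0 by lia. split; auto.
    intros D g o. rewrite Nat.add_0_r. apply reds_refl.
  - destruct (nth_error (leaves (TTup T Ts)) i) as [c|] eqn:Ec; [|apply nth_error_None in Ec; lia].
    change (leaves (TTup T Ts)) with (concat (map (@leaves Sg) (T :: Ts))) in Ec.
    destruct (leaves_inv Ec) as [m [A [j [EA [Ej ->]]]]].
    assert (HF : Forall (fun T => has_dty T = true -> forall i, i < length (leaves T) ->
      exists L, (forall K b, path T' K b -> path (dty T' T) (L ++ K) b) /\
        forall D g o, reds D (observe L (tup T g o)) (g (o + i))) (T :: Ts)) by now constructor.
    rewrite Forall_forall in HF.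
    destruct (HF A) with (i := j) as [L [L1 L2]].
    { eapply nth_error_In; eauto. } { eapply has_dty_nth; eauto. } { apply nth_error_Some; congruence. }
    exists (OProj Sg m :: L). split.
    + intros K b HK. simpl. econstructor; [|apply L1; exact HK].
      rewrite nth_error_map_dty, EA. reflexivity.
    + intros D g o. rewrite tup_tups.
      match goal with |- reds D (observe _ ?t) ?u => change (reds D (observe L (Proj m t)) u) end.
      eapply reds_trans.
      * apply observe_reds, reds_step, red_proj. rewrite nth_error_tups, EA. reflexivity.
      * rewrite Nat.add_assoc. apply L2.
Qed.

Lemma observe_app (L K : list (obs Sg)) t : observe (L ++ K) t = observe K (observe L t).
Proof. unfold observe. apply fold_left_app. Qed.

(** In the context of an environment an irreducible term of tuple type is a tuple, since neutral
    ones have interpretable types; iterating this exposes all leaves. The parameter [P] covers both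
    [T] itself and dT'/dT. *)
Lemma tree_of_irr (P : ty -> ty) (HP : forall A As, P (TTup A As) = TTup (P A) (map P As))
    r0 T : has_dty T = true -> forall n, has_type (env_ctx r0) n (P T) -> irr (env_ctx r0) n ->
  forall o, exists g, n = tup T g o /\
    forall i b, nth_error (leaves T) i = Some b ->
      has_type (env_ctx r0) (g (o + i)) (P (TBase b)) /\ irr (env_ctx r0) (g (o + i)).
Proof.
  induction T using ty_nested_ind; intros HT n Hn Hi o; try discriminate.
  - exists (fun _ => n). split; auto. intros [|i] b' E; [|destruct i; discriminate].
    simpl in E. injection E as <-. auto.
  - rewrite HP in Hn.
    assert (Htup : exists ts, n = Tup ts /\ Forall2 (has_type (env_ctx r0)) ts (map P (T :: Ts))).
    { destruct (irr_nf (env_ictx (r := r0)) Hn Hi) as [_ [N _]].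
      destruct n; try (destruct (N eq_refl) as [_ [[|] E]]; discriminate); inv Hn; eauto. }
    destruct Htup as [ts [-> Hts]]. apply irr_tup in Hi.
    enough (Hg : exists g, ts = tups (T :: Ts) g o /\
      forall i b, nth_error (concat (map (@leaves Sg) (T :: Ts))) i = Some b ->
      has_type (env_ctx r0) (g (o + i)) (P (TBase b)) /\ irr (env_ctx r0) (g (o + i))).
    { destruct Hg as [g [-> Hg]]. exists g. split; [now rewrite tup_tups | exact Hg]. }
    assert (HF : Forall (fun T => has_dty T = true -> forall n, has_type (env_ctx r0) n (P T) ->
      irr (env_ctx r0) n ->
      forall o, exists g, n = tup T g o /\ forall i b, nth_error (leaves T) i = Some b ->
      has_type (env_ctx r0) (g (o + i)) (P (TBase b)) /\ irr (env_ctx r0) (g (o + i))) (T :: Ts))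
      by now constructor.
    apply has_dty_tup in HT. clear - HF HT Hts Hi HP. revert HF HT ts Hts Hi o.
    generalize (T :: Ts). induction l as [|A l IH]; intros HF HT ts Hts Hi o; simpl in Hts; inv Hts.
    + exists (fun _ => Tup []). split; auto. intros [|] b E; discriminate.
    + inv HF. inv HT. inv Hi.
      match goal with K1 : has_type _ x _, K2 : irr _ x, K3 : has_dty A = true, K : has_dty A = true -> _ |- _ =>
        destruct (K K3 x K1 K2 o) as [g1 [-> Hg1]] end.
      match goal with K1 : Forall _ l, K2 : Forall (fun T => has_dty T = true) l, K3 : Forall2 _ l0 _, K4 : Forall (irr _) l0 |- _ =>
        destruct (IH K1 K2 l0 K3 K4 (o + length (leaves A))) as [g2 [-> Hg2]] end.
      assert (HA : has_dty A = true) by assumption.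
      (* The leaf functions of the first component and of the remaining ones are glued at the
         boundary between their ranges. *)
      exists (fun k => if k <? o + length (leaves A) then g1 k else g2 k). split.
      * simpl. f_equal.
        -- apply tup_ext; auto. intros i Hlt.
           destruct (Nat.ltb_spec (o + i) (o + length (leaves A))); [reflexivity | lia].
        -- assert (HL : Forall (fun T => has_dty T = true) l) by assumption.
           assert (Hext : forall l o' g h, Forall (fun T => has_dty T = true) l ->
             (forall i, g (o' + i) = h (o' + i)) -> tups l g o' = tups l h o').
           { clear. induction l; intros o' g h HL E; simpl; auto. inv HL. f_equal.
             - apply tup_ext; auto.
             - apply IHl; auto. intros i. rewrite <- Nat.add_assoc. apply E. }
           apply Hext; auto. intros i.
           destruct (Nat.ltb_spec (o + length (leaves A) + i) (o + length (leaves A))); [lia | reflexivity].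
      * intros i b E. simpl in E. destruct (Nat.lt_ge_cases i (length (leaves A))) as [L | L].
        -- rewrite nth_error_app1 in E by assumption.
           destruct (Nat.ltb_spec (o + i) (o + length (leaves A))); [auto | lia].
        -- rewrite nth_error_app2 in E by assumption.
           destruct (Nat.ltb_spec (o + i) (o + length (leaves A))); [lia|].
           replace (o + i) with (o + length (leaves A) + (i - length (leaves A))) by lia. auto.
Qed.

(* Meaningful for [n > 0] only; base types need not have a zero. *)
Definition fsum b (phi : nat -> cst (IBase b)) (o n : nat) : cst (IBase b) :=
  fold_left (fun x i => add M x (phi i)) (seq (S o) (n - 1)) (phi o).

Lemma fold_add_assoc b (phi : nat -> cst (IBase b)) l x y :
  fold_left (fun x i => add M x (phi i)) l (add M x y) =
  add M x (fold_left (fun x i => add M x (phi i)) l y).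
Proof.
  revert y; induction l as [|i l IH]; intros y; simpl; auto.
  rewrite <- IH. now rewrite (addA HM).
Qed.

Lemma fsum_add b (phi : nat -> cst (IBase b)) o (n m : nat) : 0 < n -> 0 < m ->
  fsum phi o (n + m) = add M (fsum phi o n) (fsum phi (o + n) m).
Proof.
  intros Hn Hm. unfold fsum. replace (n + m - 1) with ((n - 1) + m) by lia.
  rewrite seq_app, fold_left_app. replace m with (S (m - 1)) at 1 by lia. simpl.
  replace (S (o + (n - 1))) with (o + n) by lia. apply fold_add_assoc.
Qed.

Lemma FF_addop G o t s : FF G t -> FF G s -> FF G (AddOp o t s).
Proof.
  intros [n [Hn Hf]] [m [Hm Hf']]. exists (AddOp o n m); split; [now apply reds_addop | now split].
Qed.

Lemma FF_mul G t s : FF G t -> FF G s -> FF G (Mul t s).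
Proof.
  intros [n [Hn Hf]] [m [Hm Hf']]. exists (Mul n m); split; [now apply reds_mul | now split].
Qed.

Lemma FF_der G t s A : has_type G s A -> FF (A :: G) t -> FF G s -> FF G (Der t s).
Proof.
  intros Hs [n [Hn Hf]] [m [Hm Hf']]. exists (Der n m); split; [now apply reds_der with A | now split].
Qed.

Lemma FF_rename G D p t T : has_type G t T -> FF G t -> renok p G D -> FF D (rename p t).
Proof.
  intros Ht [n [Hn Hf]] Hp. exists (rename p n); split; [eapply reds_rename; eauto | now apply fixfree_rename].
Qed.

(** Associativity of addition at the observed base type turns the sum bracketed along the shape of
    [T] into a sum over its leaves. *)
Lemma val_sumtree T T' K b : has_dty T = true -> path T' K b -> addable T' = true ->
  forall r0 (w : nat -> tm) (phi : nat -> env -> cst (IBase b)) o,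
  (forall i, i < length (leaves T) -> has_type (env_ctx r0) (w (o + i)) T' /\
     FF (env_ctx r0) (w (o + i)) /\ val M (env_ctx r0) (observe K (w (o + i))) (phi (o + i))) ->
  has_type (env_ctx r0) (sumtree T w o) T' /\ FF (env_ctx r0) (sumtree T w o) /\
  val M (env_ctx r0) (observe K (sumtree T w o))
    (fun r => fsum (fun i => phi i r) o (length (leaves T))).
Proof.
  intros HT HK HA r0 w phi. revert HT. induction T using ty_nested_ind; intros HT o Hw; try discriminate.
  - destruct (Hw 0) as [H1 [H2 H3]]; [simpl; lia|]. rewrite Nat.add_0_r in *. auto.
  - rewrite sumtree_sums.
    pose proof (has_dty_tup HT) as HD. inv HD.
    assert (Hlen : length (leaves (TTup T Ts)) = length (leaves T) + length (concat (map (@leaves Sg) Ts)))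
      by (simpl; apply length_app).
    rewrite Hlen in *.
    assert (H0 : has_type (env_ctx r0) (sumtree T w o) T' /\ FF (env_ctx r0) (sumtree T w o) /\
      val M (env_ctx r0) (observe K (sumtree T w o))
        (fun r => fsum (fun i => phi i r) o (length (leaves T)))).
    { apply IHT; auto. intros i Hi. apply Hw. lia. }
    assert (Hpos : 0 < length (leaves T)) by (apply leaves_nonempty; assumption).
    revert H0 Hw Hpos. generalize (sumtree T w o). generalize (length (leaves T)). clear IHT Hlen HT.
    match goal with F : Forall _ Ts, F' : Forall _ Ts |- _ => revert F F' end.
    induction Ts as [|A Ts IH]; intros F F' N t H0 Hw Hpos; simpl.
    + rewrite Nat.add_0_r. assumption.
    + inv F. inv F'. rewrite length_app, Nat.add_assoc, <- Nat.add_assoc with (n := o).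
      assert (HposA : 0 < length (leaves A)) by (apply leaves_nonempty; assumption).
      simpl in Hw. rewrite length_app in Hw.
      apply IH; auto; [| intros i Hi; apply Hw; lia | lia].
      assert (HwA : has_type (env_ctx r0) (sumtree A w (o + N)) T' /\ FF (env_ctx r0) (sumtree A w (o + N)) /\
        val M (env_ctx r0) (observe K (sumtree A w (o + N)))
          (fun r => fsum (fun i => phi i r) (o + N) (length (leaves A)))).
      { match goal with K : has_dty A = true -> _ |- _ => apply K; auto end.
        intros i Hi. rewrite <- Nat.add_assoc. apply Hw. lia. }
      destruct H0 as [H01 [H02 H03]]. destruct HwA as [A1 [A2 A3]].
      split; [|split].
      * constructor; auto.
      * now apply FF_addop.
      * eapply val_ext; [|eapply (val_observe_addop HM oplus HK HA H01 H02 A1 A2 H03 A3)].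
        intros r _. simpl. symmetry. now apply fsum_add.
Qed.

Definition upd (i : nat) (x : {a : ity & cst a}) r : env := firstn i r ++ x :: skipn (S i) r.

(** The semantic counterpart of [pder]. The value [phi r] is a default for indices out of range or
    not of base type. *)
Definition pd b i (phi : env -> cst (IBase b)) r : cst (IBase b) :=
  match nth_error r i with
  | Some (existT _ a y) =>
      match a return cst a -> cst (IBase b) with
      | IBase b' => fun y => der M (fun z => phi (upd i (existT _ (IBase b') z) r)) y
      | IArr _ _ => fun _ => phi r
      end y
  | None => phi r
  end.

(** The semantic counterpart of [dirpow], with the same order of differentiations. The sum runs over
    the indices of [incs], so the default [phi r] is not reached when [incs] is nonempty. *)
Fixpoint dirder b (incs : list increment) (k : nat) (phi : env -> cst (IBase b)) r : cst (IBase b) :=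
  match k with
  | 0 => phi r
  | S k => fsum (fun i => match nth_error incs i with
                          | Some q => mul M (dirder incs k (pd i phi) r) (snd (projT2 q))
                          | None => phi r
                          end) 0 (length incs)
  end.

Lemma nth_error_upd i x r j : i < length r ->
  nth_error (upd i x r) j = if j =? i then Some x else nth_error r j.
Proof. apply nth_error_replace. Qed.

Lemma env_ctx_upd i b (z : cst (IBase b)) r : nth_error (env_ctx r) i = Some (TBase b) ->
  env_ctx (upd i (existT _ (IBase b) z) r) = env_ctx r.
Proof.
  intros E. apply nth_error_ext. intros j. unfold env_ctx in *.
  assert (L : i < length r).
  { rewrite <- (length_map (fun p => ity_ty (projT1 p))). apply nth_error_Some. congruence. }
  rewrite 2!nth_error_map, nth_error_upd by assumption.
  destruct (Nat.eqb_spec j i) as [-> | N]; auto. rewrite nth_error_map in E. now rewrite E.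
Qed.

Lemma env_base i b r : nth_error (env_ctx r) i = Some (TBase b) ->
  exists y, nth_error r i = Some (existT _ (IBase b) y).
Proof.
  unfold env_ctx. rewrite nth_error_map.
  destruct (nth_error r i) as [[[b'|a1 a2] y]|]; simpl; intros E; try discriminate.
  injection E as <-. eauto.
Qed.

Definition base_ctx (bs : list (base Sg)) : ctx := map (@TBase _) bs.

Lemma nth_error_base_ctx bs i : nth_error (base_ctx bs) i = option_map (@TBase _) (nth_error bs i).
Proof. apply nth_error_map. Qed.

Lemma ev_pder bs i b F (phi : env -> cst (IBase b)) : i < length bs ->
  (forall r, env_ctx r = base_ctx bs -> ev M F r (phi r)) ->
  forall r, env_ctx r = base_ctx bs -> ev M (pder i F) r (pd i phi r).
Proof.
  intros Hi HF r Hr.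
  destruct (nth_error bs i) as [c|] eqn:Ec; [|apply nth_error_None in Ec; lia].
  assert (E : nth_error (env_ctx r) i = Some (TBase c)) by (now rewrite Hr, nth_error_base_ctx, Ec).
  destruct (env_base E) as [y Ey].
  unfold pd. rewrite Ey. exists c, (fun z => phi (upd i (existT _ (IBase c) z) r)), y.
  split; [|split; [exact Ey | reflexivity]].
  intros z. eapply ev_rename; [|apply HF; now rewrite env_ctx_upd].
  intros j x. rewrite nth_error_upd by (apply nth_error_Some; congruence).
  destruct (Nat.eqb_spec j i) as [-> | N]; simpl; auto.
Qed.

Lemma ev_osum r b (w : nat -> tm) (phi : nat -> cst (IBase b)) l :
  (forall i, In i l -> ev M (w i) r (phi i)) -> forall t x, ev M t r (x : cst (IBase b)) ->
  ev M (osum t (map w l)) r (fold_left (fun x i => add M x (phi i)) l x).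
Proof.
  induction l as [|i l IH]; intros Hw t x Ht; simpl; auto.
  apply IH; [intros; apply Hw; simpl; auto|].
  exists x, (phi i). split; [assumption | split; [apply Hw; simpl; auto | reflexivity]].
Qed.

Lemma map_indexed_seq (Y Z : Type) (f : nat * Y -> Z) (l : list Y) (F : nat -> Z) :
  (forall i y, nth_error l i = Some y -> F (S i) = f (i, y)) ->
  map f (indexed l) = map F (seq 1 (length l)).
Proof.
  intros H. apply nth_error_ext. intros i. rewrite 2!nth_error_map, nth_error_indexed.
  rewrite nth_error_seq. destruct (nth_error l i) as [y|] eqn:E; simpl.
  - destruct (Nat.ltb_spec i (length l)); simpl; [now rewrite (H _ _ E)|].
    assert (nth_error l i <> None) by congruence. apply nth_error_Some in H1. lia.
  - apply nth_error_None in E. destruct (Nat.ltb_spec i (length l)); [lia | reflexivity].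
Qed.

Lemma ev_dirpow bs (q : increment) (ps : list increment) k : bs = map (@projT1 _ _) (q :: ps) -> forall b F (phi : env -> cst (IBase b)),
  (forall r, env_ctx r = base_ctx bs -> ev M F r (phi r)) ->
  forall r, env_ctx r = base_ctx bs ->
  ev M (dirpow (pt_incr q) (map (@pt_incr Sg) ps) k F) r (dirder (q :: ps) k phi r).
Proof.
  intros Hbs; induction k as [|k IH]; intros b F phi HF r Hr; simpl; auto.
  assert (Hl : length bs = S (length ps)) by (subst; simpl; now rewrite length_map).
  (* All summands as one function of the index, the head having index 0; [Var 0] is a default beyond
     the list. *)
  set (Fi := fun i => Mul (dirpow (pt_incr q) (map (@pt_incr Sg) ps) k (pder i F))
     (match nth_error (q :: ps) i with Some q => pt_incr q | None => Var 0 end)).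
  rewrite (map_indexed_seq (F := Fi)).
  2: { intros i y E. rewrite nth_error_map in E. unfold Fi; simpl.
       destruct (nth_error ps i); [|discriminate]. injection E as <-. reflexivity. }
  rewrite length_map. unfold fsum. simpl. rewrite Nat.sub_0_r.
  assert (Hterm : forall i q', nth_error (q :: ps) i = Some q' ->
    ev M (Mul (dirpow (pt_incr q) (map (@pt_incr Sg) ps) k (pder i F)) (pt_incr q')) r
      (mul M (dirder (q :: ps) k (pd i phi) r) (snd (projT2 q')))).
  { intros i q' E.
    exists (dirder (q :: ps) k (pd i phi) r), (projT1 q'), (snd (projT2 q')).
    split; [|split; reflexivity]. apply IH; auto. intros r' Hr'. eapply ev_pder; eauto.
    assert (nth_error (q :: ps) i <> None) by congruence. apply nth_error_Some in H. simpl in H. lia. }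
  apply ev_osum.
  - intros i Hi. apply in_seq in Hi. unfold Fi.
    destruct (nth_error (q :: ps) i) as [q'|] eqn:E.
    + apply Hterm. assumption.
    + apply nth_error_None in E. simpl in E. lia.
  - apply (Hterm 0). reflexivity.
Qed.

End Gradient.

(** * Taylor terms at a generic point *)

Section Derivatives.
Variables (Sg : sig) (M : model Sg).
Hypothesis HM : lawful M.
Local Notation tm := (tm Sg).
Local Notation ty := (ty (base Sg)).
Local Notation ity := (ity (base Sg)).
Local Notation ctx := (ctx Sg).
Local Notation env := (env Sg).
Local Notation increment := (increment Sg).
Implicit Types (G D : ctx) (t s u v w X : tm) (T A B C : ty) (a : ity) (g h : nat -> tm) (r : env).

Definition pvar i : nat -> nat := fun j => if j =? i then 0 else S j.

Lemma pder_typing bs i c p T' : nth_error bs i = Some c -> has_type (base_ctx bs) p T' ->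
  has_type (base_ctx bs) (pder i p) T' /\
  has_type (TBase c :: base_ctx bs) (rename (pvar i) p) T' /\
  renok (pvar i) (base_ctx bs) (TBase c :: base_ctx bs).
Proof.
  intros Ei Hp.
  assert (Hr : renok (pvar i) (base_ctx bs) (TBase c :: base_ctx bs)).
  { intros j A E. unfold pvar. destruct (Nat.eqb_spec j i) as [-> | N]; simpl; auto.
    rewrite nth_error_base_ctx, Ei in E. simpl in E. congruence. }
  assert (Hrp : has_type (TBase c :: base_ctx bs) (rename (pvar i) p) T') by (eapply typing_renok; eauto).
  repeat split; auto.
  unfold pder. apply ty_der_base with c; auto. constructor. now rewrite nth_error_base_ctx, Ei.
Qed.

Lemma pder_FF bs i c p T' : nth_error bs i = Some c -> has_type (base_ctx bs) p T' ->
  FF (base_ctx bs) p -> FF (base_ctx bs) (pder i p).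
Proof.
  intros Ei Hp HF. destruct (pder_typing Ei Hp) as [_ [_ Hr]].
  unfold pder. apply FF_der with (TBase c).
  - constructor. now rewrite nth_error_base_ctx, Ei.
  - eapply FF_rename; eauto.
  - now apply fixfree_FF.
Qed.

Lemma observe_rename T K b : path T K b -> forall p t, rename p (observe K t) = observe K (rename p t).
Proof. intros HK p t. rewrite 2!rename_subst_var. eapply observe_subst; eauto. Qed.

(** The observed partial derivative is the derivative of the observation of [p] in which leaf [i]
    has been made the bound variable by [pvar i]. *)
Lemma val_observe_pder bs r0 i c T' K b p (phi : env -> cst (IBase b)) :
  env_ctx r0 = base_ctx bs -> nth_error bs i = Some c -> path T' K b ->
  has_type (base_ctx bs) p T' -> FF (base_ctx bs) p ->
  val M (base_ctx bs) (observe K p) phi -> val M (base_ctx bs) (observe K (pder i p)) (pd M i phi).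
Proof.
  intros E0 Ei HK Hp HF Hv. destruct (pder_typing Ei Hp) as [_ [Hrp Hr]].
  assert (Hi : has_type (base_ctx bs) (Var i) (TBase c))
    by (constructor; now rewrite nth_error_base_ctx, Ei).
  rewrite <- E0 in Hi.
  destruct (@interpretable_choice _ _ HM (IBase c) (Var i) r0 Hi I) as [psi Hpsi].
  (* In the renamed term the new first entry of the environment stands for entry [i]; the value at
     the empty environment is a default outside the context. *)
  assert (Hvp : val M (TBase c :: base_ctx bs) (observe K (rename (pvar i) p))
    (fun r' => match r' with [] => phi [] | x :: r => phi (upd i x r) end)).
  { rewrite <- (observe_rename HK). destruct Hv as [F [H1 [H2 H3]]].
    exists (rename (pvar i) F). split; [|split].
    - eapply reds_rename; eauto. eapply observe_typing; eauto.
    - now apply interpretable_rename.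
    - intros [|[a x] r] Er; [discriminate|]. simpl in Er. injection Er as Ea Er.
      change (TBase c) with (ity_ty (IBase c)) in Ea. apply ity_ty_inj in Ea. subst a.
      assert (Eri : nth_error (env_ctx r) i = Some (TBase c)) by (now rewrite Er, nth_error_base_ctx, Ei).
      assert (L : i < length r).
      { destruct (env_base Eri) as [y Ey]. apply nth_error_Some. congruence. }
      eapply ev_rename; [|apply H3; now rewrite env_ctx_upd].
      intros j y. rewrite nth_error_upd by assumption. unfold pvar.
      destruct (Nat.eqb_spec j i) as [-> | N]; simpl; auto. }
  rewrite <- E0 in Hrp, Hvp, Hr |- *. rewrite <- E0 in Hp, HF.
  eapply val_ext; [|eapply (@val_observe_der _ _ HM T' K b HK r0 (rename (pvar i) p) (Var i) c (psi r0));
    [exact Hrp | eapply FF_rename; eauto | exact Hi | | exact Hvp]].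
  - intros r Er. simpl. unfold pd. rewrite (Hpsi r Er). reflexivity.
  - exists (Var i). split; [apply reds_refl | split; [exact I | exact Hpsi]].
Qed.

Lemma FF_tree T G g : has_dty T = true -> forall o,
  (forall i, i < length (leaves T) -> FF G (g (o + i))) -> FF G (tup T g o).
Proof.
  induction T using ty_nested_ind; intros HT o E; try discriminate.
  - simpl. specialize (E 0). rewrite Nat.add_0_r in E. apply E. simpl; lia.
  - rewrite tup_tups. apply FF_tup. apply Forall_forall. intros x Hx.
    destruct (In_nth_error _ _ Hx) as [i Hi]. rewrite nth_error_tups in Hi.
    destruct (nth_error (T :: Ts) i) as [A|] eqn:EA; simpl in Hi; [|discriminate].
    injection Hi as <-.
    pose proof (off_bound EA) as L.
    change (concat (map (@leaves Sg) (T :: Ts))) with (leaves (TTup T Ts)) in L.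
    assert (HF : Forall (fun T => has_dty T = true -> forall o,
      (forall i, i < length (leaves T) -> FF G (g (o + i))) -> FF G (tup T g o)) (T :: Ts)) by now constructor.
    rewrite Forall_forall in HF. apply HF.
    + eapply nth_error_In; eauto.
    + eapply has_dty_nth; eauto.
    + intros j Hj. rewrite <- Nat.add_assoc. apply E. lia.
Qed.

Lemma grad_typing T p T' : has_dty T = true -> has_type (base_ctx (leaves T)) p T' ->
  has_type (base_ctx (leaves T)) (grad T p) (dty T' T).
Proof.
  intros HT Hp. apply (tup_typing (P := dty T')); auto.
  intros i b E. now apply (pder_typing E Hp).
Qed.

Lemma grad_FF T p T' : has_dty T = true -> has_type (base_ctx (leaves T)) p T' ->
  FF (base_ctx (leaves T)) p -> FF (base_ctx (leaves T)) (grad T p).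
Proof.
  intros HT Hp HF. apply FF_tree; auto. intros i Hi.
  destruct (nth_error (leaves T) i) as [c|] eqn:Ec; [|apply nth_error_None in Ec; lia].
  eapply pder_FF; eauto.
Qed.

Fixpoint iter_dty T k T' : ty := match k with 0 => T' | S k => iter_dty T k (dty T' T) end.

(** The outermost shape of the type belongs to the last differentiation, and the first factor of
    [mulpow] removes it; the first differentiation remains for the last factor. *)
Lemma iter_dty_S T k T' : iter_dty T (S k) T' = dty (iter_dty T k T') T.
Proof. revert T'; induction k as [|k IH]; intros T'; simpl in *; auto. Qed.

Lemma addable_dty T T' : has_dty T = true -> addable T' = true -> addable (dty T' T) = true.
Proof.
  intros HT HT'. induction T using ty_nested_ind; simpl in *; try discriminate; auto.
  apply andb_prop in HT. destruct HT as [H1 H2]. rewrite IHT by assumption. simpl.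
  rewrite forallb_forall in *. rewrite Forall_forall in H. intros x Hx.
  apply in_map_iff in Hx. destruct Hx as [A [<- HA]]. apply H; auto.
Qed.

Lemma addable_iter_dty T k T' : has_dty T = true -> addable T' = true ->
  addable (iter_dty T k T') = true.
Proof. revert T'; induction k; intros T' HT HT'; simpl; auto using addable_dty. Qed.

Lemma iter_grad_typing T k : has_dty T = true -> forall p T', has_type (base_ctx (leaves T)) p T' ->
  has_type (base_ctx (leaves T)) (iter_grad T k p) (iter_dty T k T').
Proof. intros HT; induction k; intros p T' Hp; simpl; auto using grad_typing. Qed.

Lemma iter_grad_FF T k : has_dty T = true -> forall p T', has_type (base_ctx (leaves T)) p T' ->
  FF (base_ctx (leaves T)) p -> FF (base_ctx (leaves T)) (iter_grad T k p).
Proof. intros HT; induction k; intros p T' Hp HF; simpl; eauto using grad_typing, grad_FF. Qed.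

Lemma mulpow_S t (h : tm) k : mulpow t h (S k) = Mul (mulpow t h k) h.
Proof. revert t; induction k as [|k IH]; intros t; simpl in *; auto. Qed.

Lemma mulpow_typing G T T' k t (h : tm) : has_dty T = true -> addable T' = true ->
  has_type G t (iter_dty T k T') -> has_type G h T -> has_type G (mulpow t h k) T'.
Proof.
  intros HT HT'. revert t. induction k as [|k IH]; intros t Ht Hh; [assumption|].
  rewrite iter_dty_S in Ht. simpl. apply IH; auto. eapply ty_mul; eauto. now apply addable_iter_dty.
Qed.

Lemma mulpow_FF G t (h : tm) k : FF G t -> FF G h -> FF G (mulpow t h k).
Proof. revert t; induction k; intros t Ht Hh; simpl; auto using FF_mul. Qed.

Lemma mulpow_subst f t (h : tm) k : subst f (mulpow t h k) = mulpow (subst f t) (subst f h) k.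
Proof. revert t; induction k as [|k IH]; intros t; simpl; auto. Qed.

Lemma mulpow_reds G t t' (h h' : tm) k : reds G t t' -> reds G h h' -> reds G (mulpow t h k) (mulpow t' h' k).
Proof. revert t t'; induction k; intros t t' H1 H2; simpl; auto using reds_mul. Qed.

(** Induction on [k], pairing the last factor of the product with the first differentiation. The
    product [Y] of the other factors has type dT'/dT and reduces to a tuple; the observation of its
    leaf [i] is, by the induction hypothesis for [grad T p], the directional derivative of order [k]
    of the partial derivative in direction [i]. Multiplying by the last factor sums these up with
    the increments as weights. *)
Lemma val_mulpow T (incs : list increment) r0 H : has_dty T = true ->
  leaves T = map (@projT1 _ _) incs -> env_ctx r0 = base_ctx (leaves T) ->
  (forall i q, nth_error incs i = Some q ->
     has_type (base_ctx (leaves T)) (H i) (TBase (projT1 q)) /\ FF (base_ctx (leaves T)) (H i) /\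
     val M (base_ctx (leaves T)) (H i) (fun _ => snd (projT2 q))) ->
  forall k T' p K b (phi : env -> cst (IBase b)), addable T' = true -> path T' K b ->
  has_type (base_ctx (leaves T)) p T' -> FF (base_ctx (leaves T)) p ->
  val M (base_ctx (leaves T)) (observe K p) phi ->
  val M (base_ctx (leaves T)) (observe K (mulpow (iter_grad T k p) (tup T H 0) k)) (dirder M incs k phi).
Proof.
  intros HT Hl E0 HH k.
  assert (Hlen : length (leaves T) = length incs) by (now rewrite Hl, length_map).
  assert (Hq : forall i, i < length (leaves T) -> exists q, nth_error incs i = Some q /\
    nth_error (leaves T) i = Some (projT1 q)).
  { intros i Hi. destruct (nth_error incs i) as [q|] eqn:E; [|apply nth_error_None in E; lia].
    exists q; split; auto. rewrite Hl, nth_error_map. unfold increment in *. now rewrite E. }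
  assert (Htt : has_type (base_ctx (leaves T)) (tup T H 0) T).
  { apply (tup_typing (P := fun A => A)); auto; [intros; now rewrite map_id|].
    intros i c E. destruct (Hq i) as [q [Eq Eq']]; [apply nth_error_Some; congruence|].
    replace (TBase c) with (TBase (projT1 q)) by congruence. now apply HH. }
  assert (HtF : FF (base_ctx (leaves T)) (tup T H 0)).
  { apply FF_tree; auto. intros i Hi. destruct (Hq i Hi) as [q [Eq Eq']]. now apply (HH i q). }
  induction k as [|k IH]; intros T' p K b phi HT' HK Hp HF Hv; [assumption|].
  pose proof (grad_typing HT Hp) as Hg. pose proof (grad_FF HT Hp HF) as HgF.
  pose proof (addable_dty HT HT') as HA.
  rewrite mulpow_S. change (iter_grad T (S k) p) with (iter_grad T k (grad T p)).
  set (Y := mulpow (iter_grad T k (grad T p)) (tup T H 0) k) in *.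
  assert (HY : has_type (base_ctx (leaves T)) Y (dty T' T)).
  { apply mulpow_typing with T; auto. now apply iter_grad_typing. }
  assert (HYF : FF (base_ctx (leaves T)) Y).
  { apply mulpow_FF; auto. eapply iter_grad_FF; eauto. }
  destruct (FF_irr HY HYF) as [n [Hn [Hi Hf]]].
  pose proof (reds_typing HY Hn) as Htn.
  rewrite <- E0 in Htn, Hi.
  destruct (@tree_of_irr _ (dty T') (fun A As => eq_refl) r0 T HT n Htn Hi 0) as [y [-> Hy]].
  eapply val_back.
  { eapply observe_reds, reds_trans; [apply reds_mul; [exact Hn | apply reds_refl]|]. now apply mul_tup. }
  rewrite <- E0 in *.
  unfold dirder; fold (@dirder Sg M b). rewrite <- Hlen.
  refine (proj2 (proj2 (@val_sumtree _ _ HM T T' K b HT HK HT' r0 (fun i => Mul (y i) (H i))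
    (fun i r => match nth_error incs i with
                | Some q => mul M (dirder M incs k (pd M i phi) r) (snd (projT2 q))
                | None => phi r
                end) 0 _))).
  intros i Hlt. destruct (Hq i Hlt) as [q [Eq Eq']]. simpl. rewrite Eq.
  destruct (HH i q Eq) as [Q1 [Q2 Q3]]. destruct (Hy i _ Eq') as [Y1 Y2]. simpl in Y1, Y2.
  assert (YF : FF (env_ctx r0) (y i)) by (eapply fixfree_FF, irr_fixfree; eauto).
  split; [eapply ty_mul_base; eauto | split; [now apply FF_mul|]].
  eapply (val_observe_mul HM HK HT' Y1 YF Q1 Q3).
  (* Leaf [y i] is reached from [Y] by projections, so observing it along [K] amounts to observing
     [Y] along [L ++ K]; likewise for the gradient of [p]. *)
  destruct (leaf_path T' HT Hlt) as [L [L1 L2]].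
  assert (HvY : val M (env_ctx r0) (observe (L ++ K) Y) (dirder M incs k (pd M i phi))).
  { apply (IH (dty T' T) (grad T p)); auto.
    rewrite observe_app. eapply val_back; [apply observe_reds, L2|].
    simpl. rewrite E0 in *. eapply val_observe_pder; eauto. }
  eapply val_forward; [| |exact HvY].
  - eapply observe_typing; [apply L1; exact HK | exact HY].
  - rewrite observe_app. apply observe_reds. eapply reds_trans; [apply observe_reds; exact Hn | apply L2].
Qed.

(** Specializes the generic point: when closed terms with the values in [r] replace the variables,
    the value at [r] becomes the value of a closed term. *)
Lemma val_subst r t T a (phi : env -> cst a) (f : nat -> tm) : has_type (env_ctx r) t T ->
  val M (env_ctx r) t phi ->
  (forall i a (c : cst a), nth_error r i = Some (existT _ a c) ->
     has_type [] (f i) (ity_ty a) /\ ev M (f i) [] c) ->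
  (forall i, interpretable (f i)) -> val M [] (subst f t) (fun _ => phi r).
Proof.
  intros Ht [F [H1 [H2 H3]]] Hf Hi. exists (subst f F). split; [|split].
  - eapply reds_subst; eauto. intros i A E. unfold env_ctx in E. rewrite nth_error_map in E.
    destruct (nth_error r i) as [[a' c]|] eqn:Ei; [|discriminate]. injection E as <-. now apply (Hf i a' c).
  - now apply interpretable_subst.
  - intros [|] Er; [|discriminate]. eapply ev_subst; [|now apply H3].
    intros i a' c E. now apply Hf.
Qed.

(** Convertibility in the form that confluence makes transitive. The derivatives of [f] at the
    generic point and the gradients of [p] are compared through common reducts, neither having to
    reduce to the other. *)
Definition joinable G t u : Prop := exists w, reds G t w /\ reds G u w.

Lemma joinable_refl G t : joinable G t t.
Proof. exists t; split; apply reds_refl. Qed.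

Lemma joinable_sym G t u : joinable G t u -> joinable G u t.
Proof. intros [w [H1 H2]]; exists w; auto. Qed.

Lemma reds_joinable G t u : reds G t u -> joinable G t u.
Proof. intros H; exists u; split; [assumption | apply reds_refl]. Qed.

Lemma joinable_trans G t u v T : has_type G u T -> joinable G t u -> joinable G u v -> joinable G t v.
Proof.
  intros Hu [w [H1 H2]] [w' [H3 H4]]. destruct (confluence Hu H2 H3) as [z [Z1 Z2]].
  exists z; split; eapply reds_trans; eauto.
Qed.

Lemma joinable_rename G D p t u T T' : has_type G t T -> has_type G u T' -> renok p G D ->
  joinable G t u -> joinable D (rename p t) (rename p u).
Proof.
  intros Ht Hu Hp [w [H1 H2]]. exists (rename p w); split; eapply reds_rename; eauto.
Qed.

Lemma joinable_val D a t u T (phi : env -> cst a) : has_type D u T -> joinable D t u ->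
  val M D u phi -> val M D t phi.
Proof.
  intros Hu [w [H1 H2]] Hv. eapply val_back; [exact H1|]. eapply val_forward; eauto.
Qed.

Lemma joinable_tup T G g h : has_dty T = true -> forall o,
  (forall i, i < length (leaves T) -> joinable G (g (o + i)) (h (o + i))) ->
  joinable G (tup T g o) (tup T h o).
Proof.
  intros HT o H.
  assert (Hw : forall k, exists w, o <= k < o + length (leaves T) -> reds G (g k) w /\ reds G (h k) w).
  { intros k. destruct (classic (o <= k < o + length (leaves T))) as [L | L]; [|exists (g k); tauto].
    destruct (H (k - o)) as [w Hw]; [lia|]. replace (o + (k - o)) with k in Hw by lia. exists w; auto. }
  exists (tup T (fun k => proj1_sig (constructive_indefinite_description _ (Hw k))) o).
  split; apply tup_reds; auto; intros i Hi;
    destruct (constructive_indefinite_description _ (Hw (o + i))) as [w HHw]; simpl; apply HHw; lia.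
Qed.

(** As in term equality, only free variables are constrained; the others may be sent anywhere. *)
Definition closes (f : nat -> tm) G t : Prop :=
  forall i A, free i t -> nth_error G i = Some A -> has_type [] (f i) A.

Lemma closes_typing f G t T : has_type G t T -> closes f G t -> has_type [] (subst f t) T.
Proof. intros Ht Hf. eapply typing_subst; eauto. Qed.

Lemma closes_stable f G t g : closes f G t -> forall T, has_type G t T ->
  forall i, free i t -> subst g (f i) = f i.
Proof.
  intros Hf T Ht i Hi. destruct (typing_free Ht Hi) as [A E]. eapply closed_subst. apply Hf; eauto.
Qed.

Lemma fprime_typing G T T' (f : tm) : has_dty T = true -> has_type G f (TArr T T') ->
  has_type G (fprime T f) (TArr T (dty T' T)) /\ forall i, free i (fprime T f) -> free i f.
Proof.
  intros HT Hf.
  assert (Hgen : has_type G (Lam T (Der (App (shift (shift f)) (Var 0)) (Var 0))) (TArr T (dty T' T)) /\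
    forall i, free i (Lam T (Der (App (shift (shift f)) (Var 0)) (Var 0))) -> free i f).
  { split.
    - constructor. apply ty_der; auto; [now constructor|].
      apply ty_app with T; [|now constructor]. now do 2 apply typing_shift.
    - intros i Hi. simpl in Hi. destruct Hi as [[Hi | Hi] | Hi]; try discriminate.
      apply free_rename in Hi. destruct Hi as [j [Hj Ej]]. apply free_rename in Hj.
      destruct Hj as [k [Hk ->]]. injection Ej as ->. assumption. }
  destruct f; try exact Hgen. clear Hgen. inv Hf. simpl. split.
  - constructor. apply ty_der; auto; [now constructor|].
    eapply typing_rename; eauto. intros [|i] A _ E; simpl in *; auto.
  - intros i [Hi | Hi]; [|discriminate].
    apply free_rename in Hi. destruct Hi as [[|j] [Hj Ej]]; [discriminate|].
    simpl in Ej. injection Ej as ->. assumption.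
Qed.

(* The derivative of [f] is, up to the reduction of [f] applied to a generic point,
   the body [b] abstracted over the point of differentiation. *)
Lemma fprime_body G T T' (f : tm) g : has_dty T = true -> has_type G f (TArr T T') -> closes g G f ->
  exists b, (forall D X, red D (App (subst g (fprime T f)) X) (Der (subst (ups (scons X Var)) b) X)) /\
    forall D X u, reds D (App (subst g f) u) (subst_under u (subst (ups (scons X Var)) b)).
Proof.
  intros HT Hf Hg. pose proof (fun q => closes_stable q Hg) as Hst.
  assert (Hgen : exists b, (forall D X, red D (App (subst g (Lam T (Der (App (shift (shift f)) (Var 0)) (Var 0)))) X)
      (Der (subst (ups (scons X Var)) b) X)) /\
    forall D X u, reds D (App (subst g f) u) (subst_under u (subst (ups (scons X Var)) b))).
  (* A function that is not an abstraction is differentiated through its eta-expansion, so the body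
     is its application to the variable of differentiation. *)
  { exists (App (subst g f) (Var 0)). split.
    - intros D X. simpl.
      replace (subst (ups (ups g)) (shift (shift f))) with (subst g f).
      + apply red_beta.
      + unfold shift. rewrite 2!subst_rename. apply subst_ext_free. intros i Hi. simpl.
        unfold shift. rewrite rename_rename, rename_subst_var. symmetry. eapply Hst; eauto.
    - intros D X u. unfold subst_under. simpl.
      pose proof (closes_typing Hf Hg) as Hc.
      rewrite (closed_subst (ups (scons X Var)) Hc), (closed_subst (scons u _) Hc).
      apply reds_refl. }
  destruct f; try exact Hgen. clear Hgen. pose proof Hf as Hf0. inv Hf. simpl.
  exists (subst (ups (ups g)) (rename (upr S) f)). split.
  - intros D X. apply red_beta.
  - intros D X u. eapply reds_trans; [apply reds_step, red_beta|].
    match goal with |- reds _ ?a ?b => replace b with a; [apply reds_refl|] end.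
    unfold subst1, subst_under. rewrite 2!subst_subst, subst_rename, subst_subst.
    apply subst_ext_free. intros [|i] Hi; simpl; auto.
    assert (Hi' : free i (Lam T f)) by exact Hi.
    destruct (typing_free Hf0 Hi') as [A EA]. pose proof (Hg i A Hi' EA) as Hc.
    unfold shift. rewrite rename_rename, !rename_subst_var, !subst_subst. simpl.
    repeat rewrite (closed_subst _ Hc). symmetry.
    repeat first [rewrite subst_subst | rewrite (closed_subst _ Hc)]. reflexivity.
Qed.

(** The derivative of the body at the generic point splits into one derivative per leaf. Below the
    binder of leaf [i], the body at the released point and [p] with variable [i] renamed to the
    bound one are both obtained from [App (subst g f) X] renamed in this way. *)
Lemma fprime_joinable G T T' f g p : has_dty T = true -> has_type G f (TArr T T') -> closes g G f ->
  has_type (base_ctx (leaves T)) p T' ->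
  joinable (base_ctx (leaves T)) (App (subst g f) (tup T Var 0)) p ->
  joinable (base_ctx (leaves T)) (App (subst g (fprime T f)) (tup T Var 0)) (grad T p).
Proof.
  intros HT Hf Hg Hp HJ. destruct (fprime_body HT Hf Hg) as [b [B1 B2]].
  set (D := base_ctx (leaves T)) in *. set (X := tup T Var 0) in *.
  assert (HX : has_type D X T).
  { apply (tup_typing (P := fun A => A)); auto; [intros; now rewrite map_id|].
    intros i c E. constructor. unfold D. simpl; now rewrite nth_error_base_ctx, E. }
  pose proof (closes_typing Hf Hg) as Hc.
  assert (HfX : has_type D (App (subst g f) X) T') by (econstructor; [eapply closed_typing; eauto | exact HX]).
  assert (Hr : reds D (App (subst g (fprime T f)) X)
    (tup T (fun k => Der (subst_under (tup T (point_at k Var) 0) (subst (ups (scons X Var)) b)) (Var k)) 0)).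
  { eapply reds_trans; [apply reds_step, B1 | now apply der_tup]. }
  assert (Hj : joinable D (tup T (fun k => Der (subst_under (tup T (point_at k Var) 0)
      (subst (ups (scons X Var)) b)) (Var k)) 0) (grad T p)).
  { apply joinable_tup; auto. intros i Hi. simpl.
    destruct (nth_error (leaves T) i) as [c|] eqn:Ec; [|apply nth_error_None in Ec; lia].
    destruct (pder_typing Ec HfX) as [_ [Ht2 Hrk]].
    assert (Hj : joinable (TBase c :: D) (subst_under (tup T (point_at i Var) 0) (subst (ups (scons X Var)) b))
      (rename (pvar i) p)).
    { apply joinable_trans with (rename (pvar i) (App (subst g f) X)) T'; auto.
      - apply joinable_sym, reds_joinable. simpl.
        replace (rename (pvar i) (subst g f)) with (subst g f)
          by (rewrite rename_subst_var; symmetry; eapply closed_subst; eauto).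
        replace (rename (pvar i) X) with (tup T (point_at i (@Var Sg)) 0); [apply B2|].
        unfold X. rewrite tup_rename by assumption. apply tup_ext; auto. intros m _.
        unfold point_at, pvar. simpl. now destruct (m =? i).
      - eapply joinable_rename; eauto. }
    destruct Hj as [w [W1 W2]].
    assert (Hti : has_type D (Var i) (TBase c)) by (constructor; unfold D; now rewrite nth_error_base_ctx, Ec).
    exists (Der w (Var i)). split; [|unfold pder]; (eapply reds_der; [exact Hti | assumption | apply reds_refl]). }
  destruct Hj as [w [W1 W2]]. exists w; split; [eapply reds_trans; eauto | assumption].
Qed.

Lemma fder_typing T k : has_dty T = true -> forall G T' f, has_type G f (TArr T T') ->
  has_type G (fder T k f) (TArr T (iter_dty T k T')).
Proof.
  intros HT; induction k as [|k IH]; intros G T' f Hf; simpl; auto.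
  apply IH. now apply fprime_typing.
Qed.

Lemma fder_free T k : has_dty T = true -> forall G T' f, has_type G f (TArr T T') ->
  forall i, free i (fder T k f) -> free i f.
Proof.
  intros HT; induction k as [|k IH]; intros G T' f Hf i Hi; simpl in *; auto.
  destruct (fprime_typing HT Hf) as [H1 H2]. apply H2. eapply IH; eauto.
Qed.

Lemma fder_joinable T k : has_dty T = true -> forall G T' f g p, has_type G f (TArr T T') -> closes g G f ->
  has_type (base_ctx (leaves T)) p T' ->
  joinable (base_ctx (leaves T)) (App (subst g f) (tup T Var 0)) p ->
  joinable (base_ctx (leaves T)) (App (subst g (fder T k f)) (tup T Var 0)) (iter_grad T k p).
Proof.
  intros HT; induction k as [|k IH]; intros G T' f g p Hf Hg Hp HJ; simpl; auto.
  destruct (fprime_typing HT Hf) as [H1 H2].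
  eapply IH; eauto.
  - intros i A Hi; apply Hg; auto.
  - now apply grad_typing.
  - eapply fprime_joinable; eauto.
Qed.

(** Substituting normalizable terms may create new redexes, so reducibility is used. Variables that
    are not free in [t] are kept, which makes the substitution well-typed in [G]; since the result
    is closed, its reduction can afterwards be moved to the empty context. *)
Lemma FF_close G t T f : has_type G t T -> FF G t -> closes f G t ->
  (forall i, free i t -> FF [] (f i)) -> FF [] (subst f t).
Proof.
  intros Ht [n [Hn Hf]] Hc HF.
  set (f' := fun i => if excluded_middle_informative (free i t) then f i else Var i).
  assert (E : subst f' t = subst f t).
  { apply subst_ext_free. intros i Hi. unfold f'. destruct (excluded_middle_informative (free i t)); tauto. }
  assert (Hty : forall i A, nth_error G i = Some A -> has_type G (f' i) A).
  { intros i A Ei. unfold f'. destruct (excluded_middle_informative (free i t)) as [Hi | Hi]; [|now constructor].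
    apply closed_typing. now apply Hc. }
  assert (HR : forall i A, nth_error G i = Some A -> RED A G (f' i)).
  { intros i A Ei. specialize (Hty i A Ei). unfold f' in *.
    destruct (excluded_middle_informative (free i t)) as [Hi | Hi]; [|now apply RED_var].
    destruct (HF i Hi) as [m [Hm Hfm]]. pose proof (Hc i A Hi Ei) as Hcl.
    assert (HmG : reds G (f i) m).
    { pose proof (reds_rename (D := G) (r := fun i => i) Hcl Hm) as H.
      rewrite 2!rename_subst_var in H. erewrite 2!closed_subst in H; eauto using reds_typing.
      apply H. intros [|j] B Ej; discriminate. }
    eapply RED_back; [exact Hty | exact HmG|].
    rewrite <- (subst_var m). apply (fixfree_RED Hfm (closed_typing G (reds_typing Hcl Hm))).
    intros; now apply RED_var. }
  pose proof (reds_typing Ht Hn) as Htn.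
  destruct (RED_normalizable (fixfree_RED Hf Htn HR)) as [m [Hm Sm]].
  assert (Hall : reds G (subst f t) m).
  { rewrite <- E. eapply reds_trans; [eapply reds_subst; eauto | exact Hm]. }
  pose proof (closes_typing Ht Hc) as Hcl.
  pose proof (closed_typing G Hcl) as HclG.
  assert (Hfm : fixfree m) by (eapply irr_fixfree; [eapply reds_typing; eauto | now apply sirr_irr]).
  destruct (@reds_subst_free Sg G [] Var (subst f t) m T HclG Hall) as [Hr _].
  - intros i A Hi _. destruct (typing_free Hcl Hi) as [B EB]. destruct i; discriminate.
  - exists m; split; [|assumption]. now rewrite 2!subst_var in Hr.
Qed.

End Derivatives.

(** * Term equality *)

Section Equality.
Variables (Sg : sig) (M : model Sg).
Hypothesis HM : lawful M.
Local Notation tm := (tm Sg).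
Local Notation ty := (ty (base Sg)).
Local Notation ity := (ity (base Sg)).
Local Notation ctx := (ctx Sg).
Local Notation env := (env Sg).
Implicit Types (G D : ctx) (t : tm) (s : nat -> tm) (T A B C : ty) (a : ity) (r : env).

Definition cval t a (c : cst a) : Prop := val M [] t (fun _ => c).

Lemma cval_det t T a (c c' : cst a) : has_type [] t T -> cval t c -> cval t c' -> c = c'.
Proof. intros Ht V V'. exact (val_det HM Ht V V' (r := []) eq_refl). Qed.

Lemma cval_ev t T a (c : cst a) : has_type [] t T -> irr [] t -> ev M t [] c -> interpretable t -> cval t c.
Proof. intros Ht Hi He HI. exists t. split; [apply reds_refl | split; auto]. intros [|] E; [exact He | discriminate]. Qed.

(** The values [w] and [v] are determined by the terms, by confluence and determinism of the
    interpreter, so existence suffices and they can be recomputed where needed. *)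
Definition observably_sums t (s : nat -> tm) T : Prop := forall K b, path T K b ->
  exists (w : cst (IBase b)) (v : nat -> cst (IBase b)),
    cval (observe K t) w /\ (forall k, cval (observe K (s k)) (v k)) /\ hsum M v w.

(** Each constant is itself a closed term and hence an admissible argument of an observation; so a
    pointwise infinite sum of function constants is visible to the observations. *)
Lemma hsum_observed a : forall t s (c : cst a) (v : nat -> cst a),
  has_type [] t (ity_ty a) -> (forall k, has_type [] (s k) (ity_ty a)) ->
  cval t c -> (forall k, cval (s k) (v k)) -> observably_sums t s (ity_ty a) -> hsum_at M v c.
Proof.
  induction a as [b | a1 IH1 a2 IH2]; intros t s c v Ht Hs Hc Hv H; simpl.
  - destruct (H [] b (path_nil b)) as [w [v' [W [V HS]]]]. simpl in W, V.
    rewrite (cval_det Ht Hc W).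
    replace v with v'; [assumption|]. apply functional_extensionality. intros k.
    exact (cval_det (Hs k) (V k) (Hv k)).
  - intros x. assert (Hx : has_type [] (@Cst Sg a1 x) (ity_ty a1)) by constructor.
    assert (Vx : cval (@Cst Sg a1 x) x)
      by (exists (Cst x); split; [apply reds_refl | split; [exact I | reflexivity]]).
    apply (IH2 (App t (Cst x)) (fun k => App (s k) (Cst x))).
    + econstructor; eauto.
    + intros k; econstructor; [apply Hs | exact Hx].
    + exact (val_app Hc Vx).
    + intros k. exact (val_app (Hv k) Vx).
    + intros K b HK. apply (H (OApp (Cst x) :: K) b). now constructor.
Qed.

Lemma FF_irr_seq T (s : nat -> tm) : (forall k, has_type [] (s k) T) -> (forall k, FF [] (s k)) ->
  exists n : nat -> tm, forall k, reds [] (s k) (n k) /\ irr [] (n k) /\ fixfree (n k) /\ has_type [] (n k) T.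
Proof.
  intros Hs HF.
  assert (H : forall k, exists n, reds [] (s k) n /\ irr [] n /\ fixfree n /\ has_type [] n T).
  { intros k. destruct (FF_irr (Hs k) (HF k)) as [n [H1 [H2 H3]]]. exists n; repeat split; auto.
    eapply reds_typing; eauto. }
  exists (fun k => proj1_sig (constructive_indefinite_description _ (H k))).
  intros k. destruct (constructive_indefinite_description _ (H k)). assumption.
Qed.

Lemma ictx_nil : ictx (Sg := Sg) [].
Proof. intros [|] A E; discriminate. Qed.

Lemma observably_sums_reds t (s : nat -> tm) t' s' T U : has_type [] t T -> (forall k, has_type [] (s k) T) ->
  forall o : obs Sg, (forall K b, path U K b -> path T (o :: K) b) ->
  reds [] (observe [o] t) t' -> (forall k, reds [] (observe [o] (s k)) (s' k)) ->
  observably_sums t s T -> observably_sums t' s' U.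
Proof.
  intros Ht Hs o Ho Hr Hrs H K b HK. destruct (H (o :: K) b (Ho K b HK)) as [w [v [W [V HS]]]].
  exists w, v. split; [|split; auto].
  - eapply val_forward; [|apply observe_reds, Hr | exact W]; auto. exact (observe_typing (Ho K b HK) Ht).
  - intros k. eapply val_forward; [|apply observe_reds, Hrs | exact (V k)]; auto.
    exact (observe_typing (Ho K b HK) (Hs k)).
Qed.

Lemma closed_eq_interpretable a t s : has_type [] t (ity_ty a) -> (forall k, has_type [] (s k) (ity_ty a)) ->
  FF [] t -> (forall k, FF [] (s k)) -> observably_sums t s (ity_ty a) -> closed_eq M (Fin t) (Sum s).
Proof.
  intros Ht Hs HF HFs HO.
  destruct (FF_irr Ht HF) as [n [N1 [N2 N3]]]. pose proof (reds_typing Ht N1) as Hn.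
  destruct (FF_irr_seq Hs HFs) as [m Hm].
  destruct (irr_nf ictx_nil Hn N2) as [Nf [_ Ni]]. specialize (Ni a eq_refl).
  destruct (ev_total HM (r := []) Ni Hn) as [c Hc].
  assert (Hv : forall k, exists v : cst a, nf [] (m k) /\ interpretable (m k) /\ ev M (m k) [] v).
  { intros k. destruct (Hm k) as [M1 [M2 [M3 M4]]].
    destruct (irr_nf ictx_nil M4 M2) as [Mf [_ Mi]]. specialize (Mi a eq_refl).
    destruct (ev_total HM (r := []) Mi M4) as [v E]. eauto. }
  set (v := fun k => proj1_sig (constructive_indefinite_description _ (Hv k))).
  assert (Hv' : forall k, nf [] (m k) /\ interpretable (m k) /\ ev M (m k) [] (v k)).
  { intros k. unfold v. destruct (constructive_indefinite_description _ (Hv k)). assumption. }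
  apply closed_eq_nf with (Fin n) (Sum m).
  - split; assumption.
  - intros k. split; [apply Hm | apply Hv'].
  - apply nf_eq_interp with a c; simpl; auto.
    + intros k. apply Hm.
    + exists v. split; [intros k; apply Hv'|].
      apply (hsum_observed Ht Hs); auto.
      * eapply val_back; [exact N1|]. eapply cval_ev; eauto.
      * intros k. eapply val_back; [apply Hm|]. eapply cval_ev; apply Hm || apply Hv'.
Qed.

Lemma intro_of_irr T t : has_type [] t T -> irr [] t -> (forall a, T <> ity_ty a) -> intro t = true /\ nf [] t.
Proof.
  intros Ht Hi Ha. destruct (irr_nf ictx_nil Ht Hi) as [Nf [Hn _]]. split; [|assumption].
  destruct (intro t); auto. destruct (Hn eq_refl) as [_ [a E]]. now apply Ha in E.
Qed.

(** The relation on normal forms is rebuilt along the type. At an arrow one has to ask first whether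
    the whole type is interpretable: then normal forms are compared by their values and need not be
    abstractions, whereas otherwise they are abstractions and are compared at all arguments. *)
Lemma closed_eq_observed T : addable T = true -> forall t s,
  has_type [] t T -> (forall k, has_type [] (s k) T) -> FF [] t -> (forall k, FF [] (s k)) ->
  observably_sums t s T -> closed_eq M (Fin t) (Sum s).
Proof.
  induction T as [b | T Ts IHT IHTs | A C IHA IHC | A C IHA IHC] using ty_nested_ind;
    intros HT t s Ht Hs HF HFs HO; try discriminate.
  - now apply (@closed_eq_interpretable (IBase b)).
  - assert (Hne : forall a : ity, TTup T Ts <> ity_ty a) by (intros [] ?; discriminate).
    destruct (FF_irr Ht HF) as [n [N1 [N2 N3]]]. pose proof (reds_typing Ht N1) as Hn.
    destruct (FF_irr_seq Hs HFs) as [m Hm].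
    assert (Htup : forall u, has_type [] u (TTup T Ts) -> irr [] u -> fixfree u -> nf [] u /\
      exists us, u = Tup us /\ Forall2 (has_type []) us (T :: Ts) /\ Forall (@fixfree Sg) us).
    { intros u Hu Hi Hff. destruct (intro_of_irr Hu Hi Hne) as [Iu Nu]. split; auto.
      destruct u; try discriminate; inv Hu. eexists; repeat split; eauto. now apply fixfree_tup. }
    destruct (Htup n Hn N2 N3) as [Nn [ns [-> [Hns Fns]]]].
    assert (Hms : forall k, nf [] (m k) /\
      exists us, m k = Tup us /\ Forall2 (has_type []) us (T :: Ts) /\ Forall (@fixfree Sg) us)
      by (intros k; apply Htup; apply Hm).
    apply closed_eq_nf with (Fin (Tup ns)) (Sum m).
    + split; assumption.
    + intros k. split; [apply Hm | apply Hms].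
    + apply nf_eq_tup with (length (T :: Ts)).
      * exists ns; split; auto. eapply Forall2_length; eauto.
      * intros k. destruct (Hms k) as [_ [us [-> [Hus _]]]]. exists us; split; auto. eapply Forall2_length; eauto.
      * intros j Hj. destruct (nth_error (T :: Ts) j) as [A|] eqn:EA; [|apply nth_error_None in EA; lia].
        assert (Hc : forall us d, Forall2 (has_type []) us (T :: Ts) -> Forall (@fixfree Sg) us ->
          has_type [] (nth j us d) A /\ fixfree (nth j us d) /\ nth_error us j = Some (nth j us d)).
        { intros us d Hus Fus. destruct (Forall2_nth_error_r Hus EA) as [u [Eu Hu]].
          rewrite (nth_error_nth _ _ d Eu). repeat split; auto.
          rewrite Forall_forall in Fus. eapply Fus, nth_error_In; eauto. }
        assert (IH : Forall (fun T => addable T = true -> forall t s,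
          has_type [] t T -> (forall k, has_type [] (s k) T) -> FF [] t -> (forall k, FF [] (s k)) ->
          observably_sums t s T -> closed_eq M (Fin t) (Sum s)) (T :: Ts)) by now constructor.
        rewrite Forall_forall in IH. specialize (IH A (nth_error_In _ _ EA) (addable_nth HT EA)).
        simpl. apply IH.
        -- now apply Hc.
        -- intros k. destruct (Hms k) as [_ [us [-> [Hus Fus]]]]. now apply Hc.
        -- apply fixfree_FF. now apply Hc.
        -- intros k. destruct (Hms k) as [_ [us [-> [Hus Fus]]]]. apply fixfree_FF. now apply Hc.
        -- apply (@observably_sums_reds t s _ _ (TTup T Ts) A Ht Hs (OProj Sg j)); auto.
           ++ intros K b HK. econstructor; eauto.
           ++ simpl. eapply reds_trans; [apply reds_proj; exact N1|]. apply reds_step, red_proj. now apply Hc.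
           ++ intros k. simpl. destruct (Hm k) as [M1 _]. destruct (Hms k) as [_ [us [E [Hus Fus]]]].
              rewrite E in *. eapply reds_trans; [apply reds_proj; exact M1|]. apply reds_step, red_proj. now apply Hc.
  - destruct (classic (exists a : ity, TArr A C = ity_ty a)) as [[a E] | Ha].
    { rewrite E in *. eapply closed_eq_interpretable; eauto. }
    assert (Hne : forall a : ity, TArr A C <> ity_ty a) by (intros a E; eauto).
    destruct (FF_irr Ht HF) as [n [N1 [N2 N3]]]. pose proof (reds_typing Ht N1) as Hn.
    destruct (FF_irr_seq Hs HFs) as [m Hm].
    assert (Hlam : forall u, has_type [] u (TArr A C) -> irr [] u -> nf [] u /\ is_lam A u).
    { intros u Hu Hi. destruct (intro_of_irr Hu Hi Hne) as [Iu Nu]. split; auto.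
      destruct u; try discriminate; inv Hu. eexists; eauto. }
    assert (Hms : forall k, nf [] (m k) /\ is_lam A (m k)) by (intros k; apply Hlam; apply Hm).
    apply closed_eq_nf with (Fin n) (Sum m).
    + split; [assumption | now apply Hlam].
    + intros k. split; [apply Hm | apply Hms].
    + apply nf_eq_lam with A; [now apply Hlam | intros k; apply Hms|].
      (* The argument is only known to normalize. Its [Fix]-free reduct [u'] is an admissible
         argument for observations, and the values obtained for it pass back to [u] along the
         reduction. *)
      intros u Hu Wu. destruct (wn_FF Hu Wu) as [u' [U1 U2]].
      assert (Hu' : has_type [] u' A) by (eapply reds_typing; eauto).
      assert (HFa : forall q, fixfree q -> FF [] (App q u))
        by (intros q Hq; exists (App q u'); split; [now apply reds_app, U1; apply reds_refl | now split]).
      assert (HO' : observably_sums (App n u') (fun k => App (m k) u') C).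
      { apply (@observably_sums_reds t s _ _ (TArr A C) C Ht Hs (OApp u')); auto.
        - intros K b HK. now constructor.
        - simpl. apply reds_app; [assumption | apply reds_refl].
        - intros k. simpl. apply reds_app; [apply Hm | apply reds_refl]. }
      simpl. apply IHC; auto.
      * econstructor; eauto.
      * intros k. econstructor; [apply Hm | exact Hu].
      * intros k. apply HFa, Hm.
      * intros K b HK. destruct (HO' K b HK) as [w [v [W [V HS]]]]. exists w, v. split; [|split; auto].
        -- eapply val_back; [|exact W]. apply observe_reds, reds_app; [apply reds_refl | exact U1].
        -- intros k. eapply val_back; [|exact (V k)]. apply observe_reds, reds_app; [apply reds_refl | exact U1].
Qed.

End Equality.

(** * Taylor's theorem under each observation, and its assembly *)

Lemma list_choice (X Y : Type) (p : Y -> X) (l : list X) : forall P : nat -> Y -> Prop,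
  (forall i x, nth_error l i = Some x -> exists y, p y = x /\ P i y) ->
  exists ys, map p ys = l /\ forall i y, nth_error ys i = Some y -> P i y.
Proof.
  induction l as [|x l IH]; intros P H.
  - exists []; split; auto. intros [|]; discriminate.
  - destruct (H 0 x eq_refl) as [y [<- Hy]].
    destruct (IH (fun i => P (S i))) as [ys [<- Hys]]; [intros i x E; now apply (H (S i))|].
    exists (y :: ys); split; auto. intros [|i] z E; [injection E as <-; assumption | now apply Hys].
Qed.

Section Taylor.
Variables (Sg : sig) (M : model Sg).
Hypothesis HM : lawful M.
Local Notation tm := (tm Sg).
Local Notation ty := (ty (base Sg)).
Local Notation ity := (ity (base Sg)).
Local Notation ctx := (ctx Sg).
Local Notation env := (env Sg).
Local Notation increment := (increment Sg).
Implicit Types (G D : ctx) (t : tm) (T A B C : ty) (a : ity) (r : env) (u : nat -> tm).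

Lemma closed_tree T t : has_dty T = true -> has_type [] t T -> FF [] t ->
  exists g, reds [] t (tup T g 0) /\ forall i b, nth_error (leaves T) i = Some b ->
    has_type [] (g i) (TBase b) /\ fixfree (g i) /\ interpretable (g i).
Proof.
  intros HT Ht HF. destruct (FF_irr Ht HF) as [n [N1 [N2 N3]]]. pose proof (reds_typing Ht N1) as Hn.
  destruct (@tree_of_irr Sg (fun A => A)) with (r0 := @nil {a : ity & cst a}) (T := T) (n := n) (o := 0)
    as [g [-> Hg]]; auto.
  { intros; now rewrite map_id. }
  exists g; split; auto. intros i b E. destruct (Hg i b E) as [G1 G2]. simpl in G1, G2.
  split; [assumption | split; [eapply irr_fixfree; eauto|]].
  now apply (irr_nf (@ictx_nil Sg) G1 G2) with (IBase b).
Qed.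

Lemma ev_closed t A a (c : cst a) r : has_type [] t A -> ev M t [] c -> ev M t r c.
Proof.
  intros Ht Hc. rewrite <- (closed_subst Var Ht), <- rename_subst_var with (r := fun i => i).
  eapply ev_rename; [|exact Hc]. intros [|] x E; discriminate.
Qed.

(** Both sides are read off one function [phi], the value of the observation of [f] at the generic
    point: the leaves of [t] form the environment [r1], at which [phi] gives the left side, and the
    leaves of [t0] form [r0], at which the directional derivatives of [phi] give the summands. *)
Lemma observed_taylor G T T' f u t t0 : has_dty T = true -> addable T' = true ->
  has_type G f (TArr T T') -> closes u G f -> has_type [] t T -> has_type [] t0 T ->
  FF [] t -> FF [] t0 -> FF [] (App (subst u f) t) ->
  let s := fun k => mulpow (App (subst u (fder T k f)) t0) (AddOp ominus t t0) k in
  (forall k, has_type [] (s k) T') -> (forall k, FF [] (s k)) ->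
  observably_sums M (App (subst u f) t) (fun k => Mul (s k) (@Cst Sg (IBase (scalar M)) (inv_fact M k))) T'.
Proof.
  intros HT HT' Hf Hu Ht Ht0 Ft Ft0 Fft s Hs HsF K b HK.
  pose proof (closes_typing Hf Hu) as Hf1.
  destruct (closed_tree HT Ht Ft) as [y [Ry Hy]]. destruct (closed_tree HT Ht0 Ft0) as [x [Rx Hx]].
  set (H := fun i => AddOp ominus (y i) (x i)).
  assert (Hincs : exists incs : list increment, map (fun q : increment => projT1 q) incs = leaves T /\
    forall i q, nth_error incs i = Some q ->
      ev M (x i) [] (fst (projT2 q)) /\ ev M (y i) [] (add M (fst (projT2 q)) (snd (projT2 q))) /\
      forall D, val M D (H i) (fun _ => snd (projT2 q))).
  { apply list_choice with (P := fun i (q : increment) =>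
      ev M (x i) [] (fst (projT2 q)) /\ ev M (y i) [] (add M (fst (projT2 q)) (snd (projT2 q))) /\
      forall D, val M D (H i) (fun _ => snd (projT2 q))).
    intros i c E. destruct (Hx i c E) as [X1 [X2 X3]]. destruct (Hy i c E) as [Y1 [Y2 Y3]].
    destruct (ev_total HM (r := []) (a := IBase c) X3 X1) as [vx Ex].
    destruct (ev_total HM (r := []) (a := IBase c) Y3 Y1) as [vy Ey].
    (* The increment at a leaf leads from the value in [t0] to the value in [t], because subtracting
       and adding back is the identity. *)
    exists (existT _ c (vx, sub M vy vx)). simpl. split; [reflexivity | split; [assumption | split]].
    - rewrite (addC HM), (subK HM). assumption.
    - intros D. exists (H i). split; [apply reds_refl | split; [now split|]].
      intros r _. exists vy, vx. repeat split; eapply ev_closed; eauto. }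
  destruct Hincs as [incs [Hl Hincs]].
  set (D := base_ctx (leaves T)). set (X := tup T (@Var Sg) 0).
  set (r0 := map (@pt_start Sg) incs). set (r1 := map (@pt_end Sg M) incs).
  assert (E0 : env_ctx r0 = D) by (unfold r0, D, env_ctx, base_ctx; rewrite <- Hl, !map_map; reflexivity).
  assert (E1 : env_ctx r1 = D) by (unfold r1, D, env_ctx, base_ctx; rewrite <- Hl, !map_map; reflexivity).
  assert (Hnth : forall i q, nth_error incs i = Some q -> nth_error (leaves T) i = Some (projT1 q)).
  { intros i q E. rewrite <- Hl. unfold increment in *. rewrite nth_error_map, E. reflexivity. }
  assert (HXt : has_type D X T).
  { apply (tup_typing (P := fun A => A)); auto; [intros; now rewrite map_id|].
    intros i c E. constructor. unfold D. simpl. now rewrite nth_error_base_ctx, E. }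
  set (p := App (subst u f) X).
  assert (Hp : has_type D p T') by (econstructor; [eapply closed_typing; eauto | exact HXt]).
  assert (Fp : FF D p).
  { assert (Hft : has_type [] (App (subst u f) t) T') by (econstructor; eauto).
    eapply FF_app_xtuple with (t := t); eauto using closed_typing.
    - apply (tup_xtuple (fun i => i)). assumption.
    - rewrite <- (closed_subst Var Hft), <- rename_subst_var with (r := fun i => i).
      eapply FF_rename; eauto. intros [|] A E; discriminate. }
  assert (HoK : exists phi : env -> cst (IBase b), val M D (observe K p) phi).
  { rewrite <- E0. apply val_exists; auto.
    - rewrite E0. exact (observe_typing HK Hp).
    - rewrite E0. destruct Fp as [n [N1 N2]]. exists (observe K n).
      split; [now apply observe_reds | eapply observe_fixfree; eauto]. }
  destruct HoK as [phi Hphi].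
  (* Beyond the leaves [close g] is the identity, so that all its values are interpretable terms. *)
  set (close := fun (g : nat -> tm) i => if i <? length (leaves T) then g i else Var i).
  assert (Hclose : forall g, tup T (fun i => subst (close g) (Var i)) 0 = tup T g 0).
  { intros g. apply tup_ext; auto. intros i Hi. simpl. unfold close.
    apply Nat.ltb_lt in Hi. now rewrite Hi. }
  assert (Hci : forall g, (forall i c, nth_error (leaves T) i = Some c -> interpretable (g i)) ->
    forall i, interpretable (close g i)).
  { intros g Hg i. unfold close. destruct (Nat.ltb_spec i (length (leaves T))) as [L|L]; [|exact I].
    destruct (nth_error (leaves T) i) as [c|] eqn:E; [eauto | apply nth_error_None in E; lia]. }
  assert (Hcl : forall g i q, nth_error incs i = Some q -> close g i = g i).
  { intros g i q E. unfold close. apply Hnth in E.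
    assert (L : i < length (leaves T)) by (apply nth_error_Some; congruence).
    apply Nat.ltb_lt in L. now rewrite L. }
  exists (phi r1), (fun k => mul M (dirder M incs k phi r0) (inv_fact M k)). split; [|split].
  - assert (V : val M [] (subst (close y) (observe K p)) (fun _ => phi r1)).
    { rewrite <- E1 in *. eapply (val_subst (T := TBase b)).
      - exact (observe_typing HK Hp).
      - exact Hphi.
      - intros i a c E. unfold r1 in E. rewrite nth_error_map in E.
        destruct (nth_error incs i) as [q|] eqn:Eq; [|discriminate]. simpl in E.
        unfold pt_end in E. rewrite (Hcl y i q Eq).
        assert (Ea : IBase (projT1 q) = a) by (now injection E). subst a.
        apply inj_pair2 in E || (injection E as E; apply inj_pair2 in E). subst c.
        split; [now apply (Hy i _ (Hnth i q Eq)) | now apply (Hincs i q Eq)].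
      - apply Hci. intros i c E. now apply (Hy i c E). }
    rewrite (observe_subst HK) in V. unfold p, X in V. simpl in V.
    rewrite (closed_subst (close y) Hf1), tup_subst, Hclose in V by assumption.
    eapply val_back; [|exact V]. apply observe_reds, reds_app; [apply reds_refl | exact Ry].
  - intros k.
    assert (HHk : forall i q, nth_error incs i = Some q ->
      has_type [] (H i) (TBase (projT1 q)) /\ fixfree (H i) /\ interpretable (H i)).
    { intros i q E. destruct (Hx i _ (Hnth i q E)) as [X1 [X2 X3]].
      destruct (Hy i _ (Hnth i q E)) as [Y1 [Y2 Y3]]. repeat split; auto. now constructor. }
    set (Q := fun e : tm => mulpow e (tup T H 0) k).
    set (fk := subst u (fder T k f)).
    assert (Hfk : has_type [] fk (TArr T (iter_dty T k T'))).
    { eapply closes_typing; [eapply fder_typing; eauto|]. intros i A Hi. apply Hu. eapply fder_free; eauto. }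
    assert (HtH : has_type [] (tup T H 0) T).
    { apply (tup_typing (P := fun A => A)); auto; [intros; now rewrite map_id|].
      intros i c E. simpl. destruct (Hx i c E) as [X1 _]. destruct (Hy i c E) as [Y1 _]. now constructor. }
    assert (HQ : has_type D (Q (App fk X)) T').
    { apply mulpow_typing with T; auto; [|eapply closed_typing; eauto].
      econstructor; [eapply closed_typing; eauto | exact HXt]. }
    assert (HQ' : has_type D (Q (iter_grad T k p)) T').
    { apply mulpow_typing with T; auto; [|eapply closed_typing; eauto]. now apply iter_grad_typing. }
    assert (V : val M D (observe K (Q (iter_grad T k p))) (dirder M incs k phi)).
    { apply (@val_mulpow Sg M HM T incs r0 H HT) with (T' := T'); auto.
      intros i q E. destruct (HHk i q E) as [H1 [H2 H3]].
      split; [eapply closed_typing; eauto | split; [now apply fixfree_FF | now apply Hincs]]. }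
    (* The derivative of order [k] at the generic point and the iterated gradient of [p] have a
       common reduct, so the value computed for the gradient holds for the actual summand. *)
    assert (J : joinable D (observe K (Q (App fk X))) (observe K (Q (iter_grad T k p)))).
    { destruct (@fder_joinable Sg T k HT G T' f u p Hf Hu Hp (joinable_refl _ _)) as [w [W1 W2]].
      exists (observe K (Q w)). split; apply observe_reds, mulpow_reds; auto using reds_refl. }
    pose proof (joinable_val (observe_typing HK HQ') J V) as V'.
    assert (V0 : val M [] (subst (close x) (observe K (Q (App fk X)))) (fun _ => dirder M incs k phi r0)).
    { rewrite <- E0 in *. eapply (val_subst (T := TBase b)).
      - exact (observe_typing HK HQ).
      - exact V'.
      - intros i a c E. unfold r0 in E. rewrite nth_error_map in E.
        destruct (nth_error incs i) as [q|] eqn:Eq; [|discriminate]. simpl in E.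
        unfold pt_start in E. rewrite (Hcl x i q Eq).
        assert (Ea : IBase (projT1 q) = a) by (now injection E). subst a.
        apply inj_pair2 in E || (injection E as E; apply inj_pair2 in E). subst c.
        split; [now apply (Hx i _ (Hnth i q Eq)) | now apply (Hincs i q Eq)].
      - apply Hci. intros i c E. now apply (Hx i c E). }
    rewrite (observe_subst HK) in V0. unfold Q, X in V0.
    rewrite mulpow_subst, (closed_subst (close x) HtH) in V0. simpl in V0.
    rewrite (closed_subst (close x) Hfk), tup_subst, Hclose in V0 by assumption.
    refine (@val_observe_mul Sg M HM T' K b HK [] (s k) _ (scalar M) (fun _ => dirder M incs k phi r0)
      (fun _ => inv_fact M k) HT' (Hs k) (HsF k) _ _ _).
    + exact (ty_cst [] (inv_fact M k)).
    + exists (Cst (inv_fact M k)). split; [apply reds_refl | split; [exact I | reflexivity]].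
    + eapply val_back; [|exact V0]. apply observe_reds, mulpow_reds.
      * apply reds_app; [apply reds_refl | exact Rx].
      * eapply reds_trans; [apply reds_addop; [exact Ry | exact Rx]|]. now apply addop_tup.
  - assert (Hne : incs <> []).
    { intros E. pose proof (leaves_nonempty HT) as L. rewrite <- Hl, E in L. simpl in L. lia. }
    destruct Hphi as [F [F1 [F2 F3]]]. pose proof (reds_typing (observe_typing HK Hp) F1) as HtF.
    destruct incs as [|q ps]; [congruence|].
    destruct (taylor HM (p := q) (ps := ps) (r := []) (F := F) (b := b)
      (v := fun k => dirder M (q :: ps) k phi r0) (w := phi r1)) as [z [Hz ->]].
    + assumption.
    + rewrite app_nil_r. fold r0. now rewrite E0.
    + intros k. rewrite app_nil_r. fold r0. apply ev_dirpow with (leaves T); auto.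
    + rewrite app_nil_r. fold r1. now apply F3.
    + replace (dirder M (q :: ps) 0 phi r0) with (mul M (dirder M (q :: ps) 0 phi r0) (inv_fact M 0))
        by apply (mul_inv_fact0 HM).
      exact (hsum_cons HM (v := fun k => mul M (dirder M (q :: ps) k phi r0) (inv_fact M k)) Hz).
Qed.

End Taylor.

Unset Implicit Arguments.

Theorem theorem21 (Sg : sig) (M : model Sg) (HM : lawful M)
    (G : ctx Sg) (T T' : ty (base Sg)) (f t t0 : tm Sg)
    (hf : has_type G f (TArr T T'))
    (ht : has_type G t T)
    (ht0 : has_type G t0 T)
    (hsum_typed : forall k : nat, has_type G (taylor_term M T f t t0 k) T')
    (hft_wn : expr_wn G (Fin (App f t)))
    (hsum_wn : expr_wn G (Sum (taylor_term M T f t t0))) :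
  term_eq M G (Fin (App f t)) (Sum (taylor_term M T f t t0)).
Proof.
  set (s := fun k => mulpow (App (fder T k f) t0) (AddOp ominus t t0) k).
  assert (Hc : forall k, has_type G (@Cst Sg (IBase (scalar M)) (inv_fact M k)) (TBase (scalar M)))
    by (intros k; exact (ty_cst G (inv_fact M k))).
  assert (Hs : addable T' = true /\ forall k, has_type G (s k) T').
  { assert (Hk : forall k, addable T' = true /\ has_type G (s k) T').
    { intros k. pose proof (hsum_typed k) as Hk. inv Hk.
      match goal with H : has_type G (Cst _) _ |- _ => rewrite (typing_unique H (Hc k)) in * end. now split. }
    split; [apply (Hk 0) | apply Hk]. }
  destruct Hs as [HT' Hs].
  assert (HsF : forall k, FF G (s k)).
  { intros k. apply (FF_mul_base_inv HT' (Hs k) (Hc k)). exact (wn_FF (hsum_typed k) (hsum_wn k)). }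
  assert (Hft : has_type G (App f t) T') by (econstructor; eauto).
  assert (HT : has_dty T = true /\ has_type G (App (fprime T f) t0) (dty T' T) /\
    has_type G (AddOp ominus t t0) T /\ addable T = true).
  (* The summand of order 1 is the product of [f'] at [t0] with [t (-) t0]. Its typing shows that
     [T] has derivatives and is addable. *)
  { pose proof (Hs 1) as H1. unfold s in H1. simpl in H1. inv H1.
    match goal with H : has_type G (AddOp _ _ _) ?A |- _ => pose proof H as Ha; inv H end.
    match goal with H : has_type G t ?A |- _ => pose proof (typing_unique H ht); subst A end.
    auto. }
  destruct HT as [HT [Hf1 [Ha HTa]]].
  (* Normalizability of the difference comes from the summand of order 1, and that of [t] and [t0]
     from the difference. *)
  assert (Fa : FF G (AddOp ominus t t0)) by exact (FF_mul_inv HT HT' Hf1 Ha (HsF 1)).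
  destruct (FF_addop_inv HTa ht ht0 Fa) as [Ft Ft0].
  intros u Hu. change (closed_eq M (Fin (subst u (App f t))) (Sum (fun k => subst u (taylor_term M T f t t0 k)))).
  (* Term equality provides closed normalizable terms just for the variables free in one of the two
     sides; every term whose free variables are among these is closed and kept normalizable by
     [u]. *)
  assert (Hclose : forall e, (forall i, free i e -> free i (App f t) \/ exists k, free i (taylor_term M T f t t0 k)) ->
    closes u G e /\ forall A, has_type G e A -> FF G e -> FF [] (subst u e)).
  { intros e He.
    assert (Hce : closes u G e) by (intros i A Hi E; now apply (Hu i A (He i Hi))).
    split; [assumption|]. intros A HA Fe. apply (FF_close HA Fe Hce).
    intros i Hi. destruct (typing_free HA Hi) as [B E]. destruct (Hu i B (He i Hi) E) as [U1 U2].
    exact (wn_FF U1 U2). }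
  destruct (Hclose f) as [Cf _]; [simpl; auto|].
  destruct (Hclose t) as [Ct Et]; [simpl; auto|].
  (* The free variables of [t0] already occur in the summand of order 0, which is [f] at [t0] up to
     a scalar. *)
  destruct (Hclose t0) as [Ct0 Et0]; [intros i Hi; right; exists 0; simpl; auto|].
  destruct (Hclose (App f t)) as [Cft Eft]; [auto|].
  assert (Ck : forall k, closes u G (s k) /\ FF [] (subst u (s k))).
  { intros k. destruct (Hclose (s k)) as [C E]; [intros i Hi; right; exists k; now left|]. eauto. }
  assert (Es : forall k, subst u (s k) =
    mulpow (App (subst u (fder T k f)) (subst u t0)) (AddOp ominus (subst u t) (subst u t0)) k).
  { intros k. unfold s. now rewrite mulpow_subst. }
  apply (closed_eq_observed HM HT').
  - eapply closes_typing; eauto.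
  - intros k. eapply closes_typing; [apply hsum_typed|].
    apply Hclose. intros i Hi. right. now exists k.
  - exact (Eft _ Hft (wn_FF Hft hft_wn)).
  - intros k. simpl. apply FF_mul; [apply Ck | now apply fixfree_FF].
  - simpl.
    assert (HO := @observed_taylor Sg M HM G T T' f u (subst u t) (subst u t0) HT HT' hf Cf
      (closes_typing ht Ct) (closes_typing ht0 Ct0) (Et _ ht Ft) (Et0 _ ht0 Ft0)
      (Eft _ Hft (wn_FF Hft hft_wn))). simpl in HO.
    intros K b HK. destruct (HO) with (K := K) (b := b) as [w [v [W [V S]]]]; auto.
    + intros k. rewrite <- Es. eapply closes_typing; [apply Hs | apply Ck].
    + intros k. rewrite <- Es. apply Ck.
    + exists w, v. repeat split; auto. intros k. specialize (V k). rewrite <- Es in V. exact V.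
Qed.
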